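(* Let $n>1$ be an integer. If $n$ is not a power of $2$, then a convex $n$-gon $T\in\Theta_n$ attains the minimum of $\delta(X_T)$ over $\Theta_n$ if and only if $T$ is a Reinhardt $n$-gon. Moreover, a Reinhardt $n$-gon exists if and only if $n$ is not a power of $2$.
   Context: $\Omega=\mathbb{R}/2\pi\mathbb{Z}$ carries the normalized Lebesgue (uniform probability) measure, with expectation $\mathbb{E}$. $\Theta_n$ is the set of (possibly degenerate) convex $n$-gons $T=T(\alpha_1,\dots,\alpha_n)$, where $\alpha_1,\dots,\alpha_n$ are distinct complex numbers arranged counterclockwise, i.e. $\arg(\alpha_2-\alpha_1)\le\arg(\alpha_3-\alpha_2)\le\cdots\le\arg(\alpha_{n+1}-\alpha_n)\le\arg(\alpha_2-\alpha_1)+2\pi$ for suitable choices of arguments modulo $2\pi$ (with $\alpha_{n+1}=\alpha_1$); a degenerate polygon is identified with the polygon on its extremal points. $X_T(\omega)$ is the length of the orthogonal projection of $T$ along direction $\omega$ (the width of $T$ along the direction $\omega+\frac{\pi}{2}$), equivalently $X_T(\omega)=\sum_{j=1}^n|\alpha_{j+1}-\alpha_j|\max\{\sin(\arg(\alpha_{j+1}-\alpha_j)-\omega),0\}$. The deviation rate is $\delta(X_T)=\sqrt{\mathbb{E}(X_T^2)-\mathbb{E}(X_T)^2}/\mathbb{E}(X_T)$. A Reuleaux body is a convex body of constant width $r$ whose boundary consists of a finite number of circular arcs, each having radius $r$ and center on the boundary. An endpoint of these arcs is called essential if the two neighboring arcs meeting there have different centers (so that they cannot be joined into a single circular arc). A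 Reinhardt $n$-gon is an equilateral (non-degenerate) convex $n$-gon inscribed in some Reuleaux body (all its vertices lie on the boundary of the body) whose vertex set contains all the essential endpoints of the circular arcs of that body. *)

(* Defs.v *)
From HB Require Import structures.
From mathcomp Require Import all_boot all_order all_algebra.
From mathcomp Require Import complex.
From mathcomp Require Import all_classical all_reals all_analysis.
Set Implicit Arguments.
Unset Strict Implicit.
Unset Printing Implicit Defensive.
Import Order.TTheory GRing.Theory Num.Theory.
Import numFieldNormedType.Exports.
Local Open Scope classical_set_scope.
Local Open Scope ring_scope.
Local Open Scope complex_scope.

(* The plane is the field R[i] of complex numbers.  The library attaches the
   topology of R[i] to the alias R[i]^o, and the real vector space structure
   (scalars in R) to the alias Rcomplex R; the casts below only select these. *)

Section Plane.
Variable R : realType.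
Implicit Types (K S T : set R[i]) (z : R[i]).

Definition cis (t : R) : R[i] := cos t +i* sin t.

Definition convex K : Prop := @convex_set R (Rcomplex R) K.

Definition convex_hull S : set R[i] := smallest convex S.

Definition extreme_point K z : Prop :=
  K z /\ forall (x y : R[i]) (t : R), K x -> K y -> 0 < t < 1 ->
    z = t%:C * x + (1 - t)%:C * y -> x = z /\ y = z.

Definition boundary (K : set R[i]^o) : set R[i] := closure K `\` interior K.

Definition convex_body (K : set R[i]^o) : Prop :=
  [/\ compact K, convex K & interior K !=set0].

(* [coproj w z] is the coordinate, on the axis of direction w + pi / 2, of the
   orthogonal projection of z along the direction w. *)
Definition coproj (w : R) z : R := complex.Im (z * cis (- w)).

(* The length X_K(w) of the orthogonal projection of K along the direction w,
   that is, the width of K in the direction w + pi / 2. *)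
Definition proj_length K (w : R) : R := sup (coproj w @` K) - inf (coproj w @` K).

Lemma twopi_gt0 : 0 < 2 * pi :> R.
Proof. by rewrite mulr_gt0 ?ltr0n ?pi_gt0. Qed.

(* The normalized Lebesgue measure of R / 2 pi Z, carried by the system of
   representatives [0, 2 pi] (whose two identified endpoints are null). *)
Definition expect (f : R -> R) : R := fine 'E_(uniform_prob twopi_gt0)[f].

Definition delta (f : R -> R) : R :=
  Num.sqrt (expect (fun w => f w ^+ 2) - expect f ^+ 2) / expect f.

End Plane.

Section Polygons.
Variables (R : realType) (n : nat).
Implicit Types (alpha : 'I_n -> R[i]) (T : set R[i]).

(* [ordS] is the cyclic successor on 'I_n. *)
Definition edge alpha (j : 'I_n) : R[i] := alpha (ordS j) - alpha j.

(* [th j] is a choice of arg (edge alpha j); only its values at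
   0, ..., n.-1 matter. *)
Definition counterclockwise alpha : Prop :=
  exists th : nat -> R,
    [/\ forall j : 'I_n, edge alpha j = `|edge alpha j| * cis (th j),
        forall j : nat, (j.+1 < n)%N -> th j <= th j.+1
      & th n.-1 <= th 0%N + 2 * pi].

(* Polygons are sets, so that a degenerate polygon is the polygon on its
   extreme points. *)
Definition polygon_on alpha T : Prop :=
  [/\ injective alpha, counterclockwise alpha & T = convex_hull (range alpha)].

Definition Theta T : Prop := exists alpha, polygon_on alpha T.

Definition minimizes_delta T : Prop :=
  Theta T /\ forall S, Theta S -> delta (proj_length T) <= delta (proj_length S).

End Polygons.
Arguments Theta {R} n T.
Arguments minimizes_delta {R} n T.

Section Reuleaux.
Variable R : realType.

(* The angles are those of the radii from the center. *)
Record circle_arc := CircleArc {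
  arc_center : R[i];
  arc_from : R;
  arc_to : R;
  arc_from_lt_to : arc_from < arc_to;
  arc_to_le_turn : arc_to <= arc_from + 2 * pi
}.

Definition arc_point (r : R) (a : circle_arc) (t : R) : R[i] :=
  arc_center a + r%:C * cis t.

Definition arc_set r a : set R[i] :=
  arc_point r a @` `[arc_from a, arc_to a].

Definition arc_relint r a : set R[i] :=
  arc_point r a @` `]arc_from a, arc_to a[.

Definition arc_start r a : R[i] := arc_point r a (arc_from a).
Definition arc_end r a : R[i] := arc_point r a (arc_to a).

(* The body comes with a decomposition of its boundary into non-overlapping
   arcs, listed in the cyclic (counterclockwise) order of the boundary, so that
   the arcs k and k + 1 (cyclically) are the neighboring arcs meeting at the
   end of the arc k. *)
Record reuleaux_body := ReuleauxBody {
  rb_set :> set R[i];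
  rb_width : R;
  rb_size : nat;
  rb_arc : 'I_rb_size -> circle_arc;
  rb_convex_body : convex_body rb_set;
  rb_constant_width : forall w, proj_length rb_set w = rb_width;
  rb_boundary :
    boundary rb_set = \bigcup_(k in setT) arc_set rb_width (rb_arc k);
  rb_centers : forall k, boundary rb_set (arc_center (rb_arc k));
  rb_chain : forall k,
    arc_end rb_width (rb_arc k) = arc_start rb_width (rb_arc (ordS k));
  rb_non_overlapping : forall j k, j != k ->
    arc_relint rb_width (rb_arc j) `&` arc_relint rb_width (rb_arc k) = set0
}.

Definition essential_endpoints (B : reuleaux_body) : set R[i] :=
  [set arc_end (rb_width B) (rb_arc k) | k in
    [set k : 'I_(rb_size B) |
      arc_center (rb_arc k) <> arc_center (rb_arc (ordS k))]].

(* Non-degeneracy: all the n vertices are extreme points. *)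
Definition reinhardt (n : nat) (T : set R[i]) : Prop :=
  exists alpha : 'I_n -> R[i],
    [/\ polygon_on alpha T,
        forall j, extreme_point T (alpha j),
        forall j k, `|edge alpha j| = `|edge alpha k|
      & exists B : reuleaux_body,
          range alpha `<=` boundary B /\ essential_endpoints B `<=` range alpha].

End Reuleaux.

(* Main.v *)
Require Import Defs.
From mathcomp Require Import all_boot all_order all_algebra.
From mathcomp Require Import complex.
From mathcomp Require Import all_classical all_reals all_analysis.
From mathcomp Require Import measurable_realfun ring lra zify.
Set Implicit Arguments.
Unset Strict Implicit.
Unset Printing Implicit Defensive.
Import Order.TTheory GRing.Theory Num.Theory.
Import numFieldNormedType.Exports.
Local Open Scope classical_set_scope.
Local Open Scope ring_scope.
Local Open Scope complex_scope.

(** The projection of a polygon T with edge lengths l_j and edge directions th_j has the length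
    X (w) = (1/2) \sum_j l_j |sin (w - th_j)| ([chain_proj_length]), which has period pi, and
    1 + delta ^ 2 = E (X ^ 2) / E (X) ^ 2. Between two consecutive directions modulo pi, X is a
    sinusoid. On a piece of length h the square of the integral of a sinusoid is at most cap h
    times the integral of its square, and cap is strictly concave; as the n lengths h add up to
    pi, Cauchy-Schwarz gives E (X ^ 2) >= kappa n * E (X) ^ 2 ([second_moment_ge]). Equality holds
    if and only if the polygon is equilateral and its directions modulo pi are equispaced,
    pi / n apart ([second_moment_eq], [equispaced_second_moment]).

    When do such polygons exist? Their edges are the terms of a vanishing sum of the powers
    z ^ m, m < n, of z = cis (pi / n), with signs. If n = 2 ^ k there is no such sum, by a parity
    argument ([signed_power_sum_neq0]). If n = m * q with m > 1 odd, directions taken in blocks of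
    q consecutive multiples of pi / n, separated by gaps of q multiples, give such a polygon
    ([block_polygon]). So if n is not a power of 2 the bound is attained, and the minimizing
    polygons are the equilateral ones with equispaced directions. It remains to see that these
    are the Reinhardt polygons.

    Let T be equilateral with equispaced directions. X has the same maximum r on each piece,
    attained at its midpoint, and T has diameter r. The edge j subtends an angle pi / n at a
    vertex at distance r from its two ends, since these realize the width at the midpoints next
    to th_j. The arcs of radius r about these vertices, over the edges, have normals that exhaust
    all the directions modulo pi, and they bound a body of constant width r, the intersection of
    the discs of radius r about their points ([arcs_boundary], [arcs_body_width]). So T is a
    Reinhardt polygon ([equispaced_reinhardt]).

    Conversely, let T be a Reinhardt polygon in a Reuleaux body B of width r. The centers of the
    arcs are corners of B, hence essential endpoints ([center_essential]), hence vertices of T. No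
    essential endpoint lies beyond an edge, so the part of the boundary beyond an edge is a
    single arc, and its center is a vertex at distance r from both ends of the edge
    ([chord_center]). If 2 * eta is the angle under which an edge is seen at that distance, the
    width of T has its maximal value r at th_j - eta and th_j + eta, for all j. Since X bends at each
    direction, this keeps two directions at least eta apart ([gap_ge]); then the maxima next to
    two neighboring directions belong to one sinusoid and coincide, so all the gaps are 2 * eta
    ([equal_maxima_equispaced]). *)

(** * Directions and distances in the plane *)

Section PlaneBasics.
Variable R : realType.
Implicit Types (v w t x y : R) (z : R[i]).

Lemma sinDkpi x (k : int) : sin (x + k%:~R * pi) = (-1) ^+ `|k|%N * sin x.
Proof.
have nat_case (m : nat) y : sin (y + m%:R * pi) = (-1) ^+ m * sin y.
  elim: m y => [|m IH] y; first by rewrite mul0r addr0 expr0 mul1r.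
  by rewrite -natr1 mulrDl mul1r addrA sinDpi IH exprS mulN1r mulNr.
case: k => m; first exact: nat_case.
rewrite NegzE mulrNz mulNr abszN absz_nat -{2}[x](subrK (m.+1%:R * pi)) nat_case.
by rewrite mulrA -exprD -signr_odd oddD addbb expr0 mul1r.
Qed.

Lemma cosDkpi x (k : int) : cos (x + k%:~R * pi) = (-1) ^+ `|k|%N * cos x.
Proof.
have -> : cos (x + k%:~R * pi) = sin ((x + pi / 2) + k%:~R * pi).
  by rewrite -addrA [pi / 2 + _]addrC addrA sinDpihalf.
by rewrite sinDkpi sinDpihalf.
Qed.

Lemma normr_sinDkpi x (k : int) : `|sin (x + k%:~R * pi)| = `|sin x|.
Proof. by rewrite sinDkpi normrM normrX normrN1 expr1n mul1r. Qed.

Lemma sinDk2pi x (k : int) : sin (x + k%:~R * (2 * pi)) = sin x.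
Proof.
have -> : k%:~R * (2 * pi) = (k * 2)%:~R * pi :> R by rewrite intrM; ring.
by rewrite sinDkpi abszM mulnC exprM sqrrN !expr1n mul1r.
Qed.

Lemma cosDk2pi x (k : int) : cos (x + k%:~R * (2 * pi)) = cos x.
Proof. by rewrite -!sinDpihalf addrAC sinDk2pi. Qed.

Lemma cisDk2pi x (k : int) : cis (x + k%:~R * (2 * pi)) = cis x.
Proof. by rewrite /cis sinDk2pi cosDk2pi. Qed.

Lemma cisDk2pi_nat x (k : nat) : cis (x + k%:R * (2 * pi)) = cis x.
Proof. exact: (cisDk2pi x k). Qed.

Lemma cisD x y : cis (x + y) = cis x * cis y.
Proof.
by rewrite /cis sinD cosD; apply/eqP; rewrite eq_complex /= eqxx addrC eqxx.
Qed.

Lemma cis0 : cis (0 : R) = 1.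
Proof. by rewrite /cis sin0 cos0. Qed.

Lemma cispi : cis (pi : R) = -1.
Proof. by rewrite /cis sinpi cospi; apply/eqP; rewrite eq_complex /= oppr0 !eqxx. Qed.

Lemma exists_modpi (c x : R) : exists k : int, c <= x + k%:~R * pi < c + pi.
Proof.
have p0 := pi_gt0 R.
exists (- Num.floor ((x - c) / pi)).
have /andP[h1 h2] := floor_itv ((x - c) / pi).
rewrite rmorphN /= mulNr.
rewrite ler_pdivlMr // in h1.
rewrite intrD ltr_pdivrMr // mulrDl mul1r in h2.
by apply/andP; split; lra.
Qed.

Definition dot v z : R := complex.Re z * cos v + complex.Im z * sin v.

(** The norm of [R[i]] has its values in [R[i]]; squared distances stay in [R], and they are
    polynomial in the coordinates. *)
Definition sqn z : R := complex.Re z ^+ 2 + complex.Im z ^+ 2.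

Lemma dotD v z z' : dot v (z + z') = dot v z + dot v z'.
Proof. by case: z z' => [a b] [c d]; rewrite /dot /=; ring. Qed.

Lemma dotN v z : dot v (- z) = - dot v z.
Proof. by case: z => [a b]; rewrite /dot /=; ring. Qed.

Lemma dotB v z z' : dot v (z - z') = dot v z - dot v z'.
Proof. by rewrite dotD dotN. Qed.

Lemma dotZ v x z : dot v (x%:C * z) = x * dot v z.
Proof. by case: z => [a b]; rewrite /dot /=; ring. Qed.

Lemma dot_cis v t : dot v (cis t) = cos (t - v).
Proof. by rewrite /dot /= cosB. Qed.

Lemma dotDpi v z : dot (v + pi) z = - dot v z.
Proof. by rewrite /dot cosDpi sinDpi; ring. Qed.

Lemma dotDkpi x (m : int) z : dot (x + m%:~R * pi) z = (-1) ^+ `|m|%N * dot x z.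
Proof. by rewrite /dot sinDkpi cosDkpi; ring. Qed.

Lemma coprojE w z : coproj w z = dot (w + pi / 2) z.
Proof.
by case: z => a b; rewrite /coproj /dot /= cosDpihalf sinDpihalf cosN sinN; ring.
Qed.

Lemma coproj_dot v z : dot v z = coproj (v - pi / 2) z.
Proof. by rewrite coprojE subrK. Qed.

Lemma coprojDpi w z : coproj (w + pi) z = - coproj w z.
Proof. by rewrite !coprojE addrAC dotDpi. Qed.

Lemma coprojB w z z' : coproj w (z - z') = coproj w z - coproj w z'.
Proof. by rewrite !coprojE dotB. Qed.

Lemma coprojD w z z' : coproj w (z + z') = coproj w z + coproj w z'.
Proof. by rewrite !coprojE dotD. Qed.

Lemma coprojZ w x z : coproj w (x%:C * z) = x * coproj w z.
Proof. by rewrite !coprojE dotZ. Qed.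

Lemma coproj_cis w t : coproj w (cis t) = sin (t - w).
Proof. by rewrite coprojE dot_cis opprD addrA cosBpihalf. Qed.

Lemma sqn_ge0 z : 0 <= sqn z.
Proof. by rewrite addr_ge0 ?sqr_ge0. Qed.

Lemma sqnN z : sqn (- z) = sqn z.
Proof. by case: z => a b; rewrite /sqn /=; ring. Qed.

Lemma sqnC z z' : sqn (z - z') = sqn (z' - z).
Proof. by rewrite -sqnN opprB. Qed.

Lemma sqnZ x z : sqn (x%:C * z) = x ^+ 2 * sqn z.
Proof. by case: z => a b; rewrite /sqn /=; ring. Qed.

Lemma sqn_eq0 z : sqn z = 0 -> z = 0.
Proof.
case: z => a b; rewrite /sqn /= => h.
have [ha hb] : a ^+ 2 = 0 /\ b ^+ 2 = 0.
  by move: (sqr_ge0 a) (sqr_ge0 b) => ? ?; split; lra.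
by move/eqP: ha hb; rewrite sqrf_eq0 => /eqP-> /eqP; rewrite sqrf_eq0 => /eqP->.
Qed.

Lemma sqn0 : sqn 0 = 0.
Proof. by rewrite /sqn /= expr0n addr0. Qed.

Lemma sqn_cis t : sqn (cis t) = 1.
Proof. by rewrite /sqn /= cos2Dsin2. Qed.

Lemma sqn_dot v z : sqn z = dot v z ^+ 2 + dot (v + pi / 2) z ^+ 2.
Proof.
case: z => a b; rewrite /sqn /dot /= cosDpihalf sinDpihalf.
transitivity ((a ^+ 2 + b ^+ 2) * (cos v ^+ 2 + sin v ^+ 2)).
  by rewrite cos2Dsin2 mulr1.
ring.
Qed.

Lemma dot_inj v z z' : dot v z = dot v z' -> dot (v + pi / 2) z = dot (v + pi / 2) z' -> z = z'.
Proof.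
move=> e1 e2; apply/eqP; rewrite -subr_eq0; apply/eqP/sqn_eq0.
by rewrite (sqn_dot v) !dotB e1 e2 !subrr expr0n addr0.
Qed.

Lemma dot_le v z r : 0 <= r -> sqn z <= r ^+ 2 -> dot v z <= r.
Proof.
move=> r0; rewrite (sqn_dot v) => h.
have h2 : dot v z ^+ 2 <= r ^+ 2 by move: (sqr_ge0 (dot (v + pi / 2) z)); lra.
by rewrite leNgt; apply/negP => lt; nra.
Qed.

(** The equality case of [dot_le]: the component of z orthogonal to v vanishes. *)
Lemma dot_eq v z r : 0 <= r -> sqn z <= r ^+ 2 -> r <= dot v z -> z = r%:C * cis v.
Proof.
move=> r0 hz hd; have hd' : dot v z = r by apply/eqP; rewrite eq_le hd dot_le.
have h0 : dot (v + pi / 2) z = 0.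
  apply/eqP; rewrite -sqrf_eq0; rewrite (sqn_dot v) hd' in hz.
  by apply/eqP; move: (sqr_ge0 (dot (v + pi / 2) z)); lra.
move: hd' h0 {hd hz}; case: z => a b; rewrite /dot /= cosDpihalf sinDpihalf => h1 h2.
have e := cos2Dsin2 v.
apply/eqP; rewrite eq_complex /= !mul0r subr0 addr0 -h1; apply/andP; split; apply/eqP.
  transitivity (a * (cos v ^+ 2 + sin v ^+ 2)); first by rewrite e mulr1.
  transitivity ((a * cos v + b * sin v) * cos v - sin v * (a * - sin v + b * cos v)).
    ring.
  by rewrite h2 mulr0 subr0.
transitivity (b * (cos v ^+ 2 + sin v ^+ 2)); first by rewrite e mulr1.
transitivity ((a * cos v + b * sin v) * sin v + cos v * (a * - sin v + b * cos v)).
  ring.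
by rewrite h2 mulr0 addr0.
Qed.

Lemma exists_arg x y : x ^+ 2 + y ^+ 2 = 1 -> exists v, x = cos v /\ y = sin v.
Proof.
move=> h.
have hx : -1 <= x <= 1.
  by apply/andP; split; move: (sqr_ge0 y); nra.
have e : Num.sqrt (1 - x ^+ 2) = `|y| by rewrite -h addrAC subrr add0r sqrtr_sqr.
have [y0|y0] := leP 0 y.
  exists (acos x); rewrite acosK // sin_acos // e ger0_norm //.
exists (- acos x); rewrite cosN acosK // sinN sin_acos // e ltr0_norm // opprK //.
Qed.

Lemma polar z : exists v, z = (Num.sqrt (sqn z))%:C * cis v.
Proof.
have [/eqP/sqn_eq0->|nz] := boolP (sqn z == 0).
  by exists 0; rewrite sqn0 sqrtr0 mul0r.
set r := Num.sqrt _.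
have r0 : r != 0 by rewrite sqrtr_eq0 -ltNge lt_neqAle eq_sym nz sqn_ge0.
have r2 : r ^+ 2 = sqn z by rewrite sqr_sqrtr // sqn_ge0.
have [v [hx hy]] : exists v, complex.Re z / r = cos v /\ complex.Im z / r = sin v.
  apply: exists_arg; rewrite !expr_div_n -mulrDl r2 mulfV //.
exists v; apply/eqP; rewrite eq_complex /= -hx -hy !mul0r subr0 addr0.
by rewrite ![r * _]mulrC !divfK // !eqxx.
Qed.

Lemma sqn_polar (r : R) z : 0 <= r -> sqn z = r ^+ 2 -> exists v, z = r%:C * cis v.
Proof. by move=> r0 h; have [v] := polar z; rewrite h sqrtr_sqr ger0_norm // => ?; exists v. Qed.

Lemma exists_dot z : exists v, dot v z = Num.sqrt (sqn z).
Proof.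
by have [v hv] := polar z; exists v; rewrite {1}hv dotZ dot_cis subrr cos0 mulr1.
Qed.

Lemma sqn_le_dot z r : 0 <= r -> (forall v, dot v z <= r) -> sqn z <= r ^+ 2.
Proof.
move=> r0 h; have [v hv] := exists_dot z; move: (h v); rewrite hv => h'.
by rewrite -(sqr_sqrtr (sqn_ge0 z)) ler_sqr // nnegrE sqrtr_ge0.
Qed.

Lemma norm_lt_sqn z e : 0 < e -> (`|z| < e%:C) = (sqn z < e ^+ 2).
Proof.
move=> e0; rewrite normc_def ltcR -/(sqn z).
by rewrite -{2}(sqr_sqrtr (sqn_ge0 z)) ltr_sqr // nnegrE ?sqrtr_ge0 // ltW.
Qed.

Lemma norm_sqn z : `|z| = (Num.sqrt (sqn z))%:C.
Proof. by rewrite normc_def. Qed.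

(** The radii of the balls of [R[i]^o] are elements of [R[i]], but the positive ones are
    real. *)
Lemma nbhsCP (K : set R[i]^o) z :
  nbhs (z : R[i]^o) K <-> exists e : R, 0 < e /\ forall u : R[i], sqn (u - z) < e ^+ 2 -> K u.
Proof.
split.
  move/nbhs_ballP => [e /= e0 h].
  have [er ee] : exists er : R, e = er%:C.
    by case: e e0 {h} => a b; rewrite ltcE /= => /andP[/eqP-> _]; exists a.
  exists er; move: e0 h; rewrite ee ltcR => er0 h; split=> // y hy.
  by apply: h; rewrite -ball_normE /= -norm_lt_sqn // in hy *; rewrite distrC.
move=> [e [e0 h]]; apply/nbhs_ballP; exists e%:C; rewrite /= ?ltcR // => y.
by rewrite -ball_normE /= distrC norm_lt_sqn // => /h.
Qed.

Lemma interiorCP (K : set R[i]^o) z :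
  interior K z <-> exists e : R, 0 < e /\ forall u : R[i], sqn (u - z) < e ^+ 2 -> K u.
Proof. exact: nbhsCP. Qed.

End PlaneBasics.

(** * Expectations from primitives *)

Section Primitives.
Variable R : realType.
Implicit Types (f F : R -> R) (a b x : R).

Lemma exists_primitive f a : continuous f ->
  exists F, forall x, a < x -> is_derive x 1 F (f x).
Proof.
move=> cf.
exists (fun x => (\int[lebesgue_measure]_(t in [set` `[a, x]]) (f t))%R) => x ax.
have xu : x < x + 1 by rewrite ltrDl.
have [] := @continuous_FTC1_closed _ f a x (x + 1) xu _ ax (cf x).
  apply: continuous_compact_integrable; first exact: segment_compact.
  exact: continuous_subspaceT.
by move=> d1 d2; rewrite -d2 derive1E; exact/derivableP.
Qed.

(** After this lemma an expectation is a matter of derivatives. The primitive is asked for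
    on a neighborhood of [0, 2 * pi], and is thus continuous at both ends. *)
Lemma expect_primitive f F : continuous f -> (forall x, 0 <= f x) ->
  (forall x, -1 < x -> is_derive x 1 F (f x)) ->
  expect f = (F (2 * pi) - F 0) / (2 * pi).
Proof.
move=> cf f0 dF; have p0 := twopi_gt0 R.
have dvF x : -1 < x -> derivable F x 1 by move=> /dF [].
have cF x : -1 < x -> {for x, continuous F}.
  by move=> /dvF d; exact/differentiable_continuous/derivable1_diffP.
rewrite /expect expectation.unlock integral_uniform //; last first.
  by apply/measurable_EFinP; apply: continuous_measurable_fun.
set I := (\int[_]_(_ in _) _)%E.
have -> : I = (F (2 * pi) - F 0)%:E.
  rewrite EFinB; apply: continuous_FTC2 => //.
  - exact: continuous_subspaceT.
  - split.
    + by move=> x; rewrite in_itv /= => /andP[x0 _]; apply: dvF; lra.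
    + by apply: cvg_at_right_filter; apply: cF; lra.
    + by apply: cvg_at_left_filter; apply: cF; lra.
  - move=> x; rewrite in_itv /= => /andP[x0 _]; rewrite derive1E.
    by apply: (@derive_val _ _ _ _ _ _ _ (dF _ _)); lra.
by rewrite -EFinM /= subr0 mulrC.
Qed.

(** At the endpoints f and g may differ: there a width function passes from one sinusoid to
    the next. *)
Lemma primitive_unique F G f g a b : a <= b ->
  (forall x, a <= x <= b -> is_derive x 1 F (f x)) ->
  (forall x, a <= x <= b -> is_derive x 1 G (g x)) ->
  (forall x, a < x < b -> f x = g x) ->
  F b - F a = G b - G a.
Proof.
move=> ab dF dG fg.
have dH x : a <= x <= b -> is_derive x 1 (F - G) (f x - g x).
  by move=> xab; apply: is_deriveB; [exact: dF|exact: dG].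
have cH : {within `[a, b], continuous (F - G)}.
  apply: derivable_within_continuous => x; rewrite in_itv /= => xab.
  by case: (dH x xab).
have d0 x : x \in `]a, b[ -> is_derive x 1 (F - G) 0.
  rewrite in_itv /= => /andP[ax xb].
  have xab : a <= x <= b by rewrite !ltW.
  by have := dH x xab; rewrite fg ?ax // subrr.
have [c cab] := @MVT_segment _ (F - G) (fun=> 0) a b ab d0 cH.
rewrite mul0r /= => /eqP; rewrite subr_eq0 => /eqP /= h.
have h' : F b - G b = F a - G a by [].
by lra.
Qed.

End Primitives.

(** * A concave function *)

Section CapFunction.
Variable R : realType.
Implicit Types (h x y t : R) (f g df : R -> R).

Lemma is_derive_div f g x (a b : R) : g x != 0 ->
  is_derive x 1 f a -> is_derive x 1 g b ->
  is_derive x 1 (fun t => f t / g t) ((a * g x - f x * b) / g x ^+ 2).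
Proof.
move=> gx df dg.
have dV : is_derive x 1 (fun t => (g t)^-1) (- (g x) ^- 2 *: b).
  exact: is_deriveV.
have -> : (fun t => f t / g t) = (f * (fun t => (g t)^-1)) by [].
apply: is_derive_eq; rewrite /GRing.scale /=.
by field.
Qed.

Lemma is_derive_shiftr f x c (a : R) :
  is_derive (x + c) 1 f a -> is_derive x 1 (fun t => f (t + c)) a.
Proof.
move=> df; have ds : is_derive x 1 (fun t => t + c) 1.
  by apply: is_derive_eq; rewrite addr0.
by have := @is_derive1_comp _ f (fun t => t + c) x a 1 df ds; rewrite mulr1.
Qed.

Lemma is_derive_sin_shift c (x : R) : is_derive x 1 (fun t => sin (t - c)) (cos (x - c)).
Proof. by apply: (@is_derive_shiftr (@sin R) x (- c)); exact: is_derive_sin. Qed.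

Lemma is_derive_cos_shift c (x : R) : is_derive x 1 (fun t => cos (t - c)) (- sin (x - c)).
Proof. by apply: (@is_derive_shiftr (@cos R) x (- c)); exact: is_derive_cos. Qed.

Lemma mean_value f df x y : x < y ->
  (forall t, x <= t <= y -> is_derive t 1 f (df t)) ->
  exists c, x < c < y /\ f y - f x = df c * (y - x).
Proof.
move=> xy dF.
have cF : {within `[x, y], continuous f}.
  apply: derivable_within_continuous => t; rewrite in_itv /= => txy.
  by case: (dF t txy).
have dF' t : t \in `]x, y[ -> is_derive t 1 f (df t).
  by rewrite in_itv /= => /andP[h1 h2]; apply: dF; rewrite !ltW.
have [c + h] := MVT xy dF' cF.
by rewrite in_itv /= => cxy; exists c.
Qed.

Lemma xcos_lt_sin x : 0 < x <= pi -> x * cos x < sin x.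
Proof.
move=> /andP[x0 xpi].
have [c [/andP[c0 cx] /=]] :
    exists c, 0 < c < x /\ (sin x - x * cos x) - (sin 0 - 0 * cos 0) = (c * sin c) * (x - 0).
  apply: (@mean_value (fun t => sin t - t * cos t) (fun t => t * sin t)) => // t _.
  by apply: is_derive_eq; rewrite /GRing.scale /=; ring.
rewrite sin0 mul0r !subr0 => e.
have : 0 < c * sin c * x by rewrite !mulr_gt0 // sin_gt0_pi // c0 (lt_le_trans cx).
by lra.
Qed.

Lemma sin_le_id x : 0 <= x -> sin x <= x.
Proof.
rewrite le_eqVlt => /orP[/eqP<-|x0]; first by rewrite sin0.
have [c [_]] := @mean_value (@sin R) (@cos R) 0 x x0 (fun t _ => is_derive_sin t).
by rewrite sin0 !subr0 => ->; have := cos_le1 c; nra.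
Qed.

Lemma sin_lt_id x : 0 < x -> sin x < x.
Proof.
move=> x0; have [xpi|xpi] := leP x pi; last first.
  by apply: le_lt_trans (sin_le1 x) _; have := pi_ge2 R; lra.
have x2 : 0 < x / 2 by rewrite divr_gt0.
have e : sin x = 2 * (sin (x / 2) * cos (x / 2)).
  by rewrite {1}(_ : x = (x / 2) *+ 2) ?sin_mulr2n; [ring|field].
have h1 := sin_le_id (ltW x2).
have h2 : cos (x / 2) < 1.
  have := cos2Dsin2 (x / 2).
  have : 0 < sin (x / 2) by apply: sin_gt0_pi; lra.
  by have := cos_le1 (x / 2); nra.
have h3 : 0 < sin (x / 2) by apply: sin_gt0_pi; lra.
by rewrite e; nra.
Qed.

(** The derivative of sin t / t has the sign of t * cos t - sin t, by [xcos_lt_sin]. *)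
Lemma sinc_decr x y : 0 < x -> x < y -> y <= pi -> sin y / y < sin x / x.
Proof.
move=> x0 xy ypi.
have [c [/andP[c1 c2] /= e]] :
    exists c, x < c < y /\ sin y / y - sin x / x
     = ((cos c * c - sin c * 1) / c ^+ 2) * (y - x).
  apply: (@mean_value (fun t => sin t / t)
    (fun t => (cos t * t - sin t * 1) / t ^+ 2)) => // t /andP[xt _].
  by apply: is_derive_div; rewrite gt_eqF // (lt_le_trans x0).
have c0 : 0 < c by apply: lt_trans c1.
have := @xcos_lt_sin c; rewrite c0 (ltW (lt_le_trans c2 ypi)) => /(_ isT) h.
rewrite -subr_lt0 e; rewrite nmulr_rlt0 ?subr_gt0 // mulr1.
by rewrite pmulr_llt0 ?invr_gt0 ?exprn_gt0 // subr_lt0 mulrC.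
Qed.

(** Let X (w) = e * cos (w - c) + o * sin (w - c) on an interval of length h with midpoint c.
    The integral of X is 2 * e * sin (h / 2), and that of X ^+ 2 is
    (e ^+ 2 * (h + sin h) + o ^+ 2 * (h - sin h)) / 2. So cap h is the largest possible
    quotient of the square of the first by the second; it is attained for o = 0. *)
Definition cap h : R := 4 * (1 - cos h) / (h + sin h).
Definition cap_slope h : R := 4 * (h * sin h) / (h + sin h) ^+ 2.

Lemma idDsin_gt0 h : 0 < h -> 0 < h + sin h.
Proof.
move=> h0; have [hpi|hpi] := leP h pi.
  by rewrite ltr_wpDr // sin_ge0_pi // hpi ltW.
by have := sin_geN1 h; have := pi_ge2 R; lra.
Qed.

Lemma is_derive_cap h : 0 < h -> is_derive h 1 cap (cap_slope h).
Proof.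
move=> h0; have s0 := idDsin_gt0 h0.
have d1 : is_derive h 1 (fun t => 4 * (1 - cos t) : R) (4 * sin h).
  by apply: is_derive_eq; rewrite /GRing.scale /=; ring.
have d2 : is_derive h 1 (fun t => t + sin t : R) (1 + cos h).
  by apply: is_derive_eq.
have d := @is_derive_div (fun t => 4 * (1 - cos t)) (fun t => t + sin t) h _ _
  (lt0r_neq0 s0) d1 d2.
rewrite /cap; apply: is_derive_eq; rewrite /cap_slope; congr (_ / _).
have := cos2Dsin2 h => e.
have -> : 4 * (1 - cos h) * (1 + cos h) = 4 * (1 - cos h ^+ 2) by ring.
by rewrite -e; ring.
Qed.

(** In terms of the sinc function u = sin h / h, which decreases from 1 to 0 on ]0, pi], the
    slope is 4 * u / (1 + u) ^+ 2, an increasing function of u on [0, 1] with values at most 1. *)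
Lemma cap_slopeE h : 0 < h -> cap_slope h = 4 * (sin h / h) / (1 + sin h / h) ^+ 2.
Proof.
move=> h0; rewrite /cap_slope; have := idDsin_gt0 h0 => s0; field.
by rewrite !lt0r_neq0 // ?andbT addrC.
Qed.

Lemma cap_slope_decr x y : 0 < x -> x < y -> y <= pi -> cap_slope y < cap_slope x.
Proof.
move=> x0 xy ypi; have y0 := lt_trans x0 xy.
rewrite !cap_slopeE //; have := sinc_decr x0 xy ypi.
have : sin x / x < 1 by rewrite ltr_pdivrMr // mul1r sin_lt_id.
have : 0 <= sin y / y by apply: divr_ge0; [apply: sin_ge0_pi; rewrite ypi ltW|exact: ltW].
move: (sin x / x) (sin y / y) => u v v0 u1 vu.
rewrite ltr_pdivrMr; last by nra.
rewrite mulrAC ltr_pdivlMr; last by nra.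
rewrite -subr_gt0.
have -> : 4 * u * (1 + v) ^+ 2 - 4 * v * (1 + u) ^+ 2 = 4 * ((u - v) * (1 - u * v)) by ring.
rewrite mulr_gt0 // mulr_gt0 ?subr_gt0 //.
have u0 : 0 < u by exact: le_lt_trans vu.
have uv : u * v <= u * 1 by rewrite ler_wpM2l ?ltW //; exact: lt_trans u1.
lra.
Qed.

Lemma cap_slope_le1 h : 0 < h <= pi -> cap_slope h <= 1.
Proof.
move=> /andP[h0 hpi]; rewrite cap_slopeE //.
have : 0 <= sin h / h by apply: divr_ge0; [apply: sin_ge0_pi; rewrite hpi ltW|exact: ltW].
move: (sin h / h) => u u0; rewrite ler_pdivrMr; last by rewrite exprn_gt0 // ltr_wpDr.
rewrite mul1r -subr_ge0; have -> : (1 + u) ^+ 2 - 4 * u = (1 - u) ^+ 2 by ring.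
exact: sqr_ge0.
Qed.

Lemma cap_slope_ge0 h : 0 < h <= pi -> 0 <= cap_slope h.
Proof.
move=> /andP[h0 hpi]; apply: divr_ge0; last exact: sqr_ge0.
by rewrite mulr_ge0 // mulr_ge0 ?(ltW h0) // sin_ge0_pi // hpi ltW.
Qed.

Lemma cap_gt0 h : 0 < h <= pi -> 0 < cap h.
Proof.
move=> /andP[h0 hpi]; rewrite /cap divr_gt0 ?idDsin_gt0 // mulr_gt0 // subr_gt0.
by rewrite -(cos0 R) ltr_cos // in_itv /= ?lexx ?pi_ge0 // ltW.
Qed.

Lemma cap_tangent_pos h0 h : 0 < h0 <= pi -> 0 < h <= pi -> h != h0 ->
  cap h < cap h0 + cap_slope h0 * (h - h0).
Proof.
move=> /andP[a0 api] /andP[b0 bpi]; rewrite neq_lt => /orP[lt|lt].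
  have [|c [/andP[c1 c2] e]] := mean_value (f := cap) (df := cap_slope) lt.
    by move=> t /andP[ht _]; apply: is_derive_cap; apply: lt_le_trans ht.
  have : cap_slope h0 < cap_slope c by apply: cap_slope_decr => //; apply: lt_trans c1.
  by nra.
have [|c [/andP[c1 c2] e]] := mean_value (f := cap) (df := cap_slope) lt.
  by move=> t /andP[ht _]; apply: is_derive_cap; apply: lt_le_trans ht.
have : cap_slope c < cap_slope h0.
  by apply: cap_slope_decr => //; apply: ltW; apply: lt_le_trans bpi.
by nra.
Qed.

Lemma cap0 : cap 0 = 0.
Proof. by rewrite /cap cos0 subrr mulr0 mul0r. Qed.

(** At h = 0, where cap is not differentiable in its closed form, strict concavity is
    replaced by positivity: if the tangent at h0 were not positive at 0, the tangent at
    h0 / 2, which lies above cap, would vanish at some positive e. *)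
Lemma cap_tangent h0 h : 0 < h0 <= pi -> 0 <= h <= pi -> h != h0 ->
  cap h < cap h0 + cap_slope h0 * (h - h0).
Proof.
move=> H0 /andP[]; rewrite le_eqVlt => /orP[/eqP<-|h0' hpi hn]; last first.
  by apply: cap_tangent_pos => //; rewrite h0'.
move=> _ _; rewrite cap0 sub0r.
have /andP[a0 api] := H0.
have H1 : 0 < h0 / 2 <= pi by apply/andP; split; lra.
have t1 : cap (h0 / 2) < cap h0 + cap_slope h0 * (h0 / 2 - h0).
  by apply: cap_tangent_pos => //; lra.
have sl : cap_slope h0 < cap_slope (h0 / 2) by apply: cap_slope_decr; lra.
have s0 := cap_slope_ge0 H0.
have g0 := cap_gt0 H1.
suff : cap_slope h0 * (h0 / 2) <= cap (h0 / 2) by lra.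
rewrite leNgt; apply/negP => lt.
(* the zero of the tangent at h0 / 2 *)
pose e := h0 / 2 - cap (h0 / 2) / cap_slope (h0 / 2).
have sp : 0 < cap_slope (h0 / 2) by apply: le_lt_trans sl.
have q : cap (h0 / 2) / cap_slope (h0 / 2) < h0 / 2.
  by rewrite ltr_pdivrMr //; apply: lt_le_trans lt _; rewrite mulrC ler_wpM2l; lra.
have q0 : 0 < cap (h0 / 2) / cap_slope (h0 / 2) by rewrite divr_gt0.
have He : 0 < e <= pi by apply/andP; rewrite /e; split; lra.
have : e != h0 / 2 by rewrite lt_eqF // /e; lra.
move=> /(cap_tangent_pos H1 He).
have -> : e - h0 / 2 = - (cap (h0 / 2) / cap_slope (h0 / 2)) by rewrite /e; lra.
rewrite mulrN mulrCA divff ?lt0r_neq0 // mulr1 subrr.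
by have := cap_gt0 He; lra.
Qed.

(** The slope of cap is at most 1, and cap e <= 2 * e controls the limit of cap at 0. *)
Lemma cap_le_id h : 0 < h <= pi -> cap h <= h.
Proof.
move=> /andP[h0 hpi]; rewrite leNgt; apply/negP => lt.
pose e := Num.min (h / 2) ((cap h - h) / 2).
have e0 : 0 < e by rewrite lt_min; apply/andP; split; lra.
have eh : e < h by rewrite gt_min; apply/orP; left; lra.
have ed : e < cap h - h by rewrite gt_min; apply/orP; right; lra.
have [|c [/andP[c1 c2] E]] := mean_value (f := cap) (df := cap_slope) eh.
  by move=> t /andP[ht _]; apply: is_derive_cap; apply: lt_le_trans ht.
have c0 : 0 < c <= pi by apply/andP; split; lra.
have := cap_slope_le1 c0.
suff : cap e <= 2 * e by nra.
rewrite /cap ler_pdivrMr ?idDsin_gt0 //.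
have -> : cos e = 1 - 2 * sin (e / 2) ^+ 2.
  rewrite {1}(_ : e = (e / 2) *+ 2); last by rewrite mulr2n; lra.
  by rewrite cos_mulr2n cos2sin2 mulr2n; ring.
have s1 : 0 <= sin (e / 2) by apply: sin_ge0_pi; apply/andP; split; lra.
have s2 : sin (e / 2) <= e / 2 by apply: sin_le_id; lra.
have s3 : 0 <= sin e by apply: sin_ge0_pi; apply/andP; split; lra.
by nra.
Qed.

End CapFunction.

(** * Integration over pieces *)

Section PiecewiseIntegral.
Variable R : realType.
Implicit Types (f g : R -> R).

Lemma nondecreasing_upto (t : nat -> R) (n : nat) :
  (forall i, (i < n)%N -> t i <= t i.+1) ->
  forall i j, (i <= j <= n)%N -> t i <= t j.
Proof.
move=> h i; elim=> [|j IH] /andP[ij jn].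
  by move: ij; rewrite leqn0 => /eqP->.
move: ij; rewrite leq_eqVlt => /orP[/eqP->//|ij].
by apply: le_trans (h j jn); apply: IH; rewrite -ltnS ij ltnW.
Qed.

(** The mean of a function of period pi over [0, 2 * pi] is its mean over the window
    [t 0, t n] of length pi, which is cut into (possibly empty) pieces with a known primitive. *)
Lemma expect_pieces f (n : nat) (t : nat -> R) (g G : nat -> R -> R) :
  continuous f -> (forall x, 0 <= f x) -> (forall x, f (x + pi) = f x) ->
  t n = t 0%N + pi -> (forall i, (i < n)%N -> t i <= t i.+1) ->
  (forall i (x : R), (i < n)%N -> is_derive x 1 (G i) (g i x)) ->
  (forall i x, (i < n)%N -> t i < x < t i.+1 -> f x = g i x) ->
  expect f = (\sum_(i < n) (G i (t i.+1) - G i (t i))) / pi.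
Proof.
move=> cf f0 fpi tn tmono dG fg.
have p0 := pi_gt0 R.
(* The primitive F has to cover both [0, 2 * pi] and the window. *)
pose a := Num.min (-1) (t 0%N - 1).
have a1 : a <= -1 by rewrite ge_min lexx.
have at0 : a < t 0%N.
  by apply: le_lt_trans (_ : t 0%N - 1 < _); rewrite ?gtrBl // ge_min lexx orbT.
have [F dF] := exists_primitive a cf.
have shift_const x y : a < x -> x <= y -> F (y + pi) - F (x + pi) = F y - F x.
  move=> ax xy.
  apply: (@primitive_unique R (fun t => F (t + pi)) F (fun t => f (t + pi)) f) => //.
    move=> z /andP[xz _]; apply: is_derive_shiftr; apply: dF.
    by apply: lt_le_trans (lt_le_trans ax xz) _; rewrite lerDl ltW.
  by move=> z /andP[xz _]; apply: dF; apply: lt_le_trans xz.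
have period_eq x : a < x -> F (x + pi) - F x = F (t 0%N + pi) - F (t 0%N).
  move=> ax; have [xt|/ltW tx] := leP x (t 0%N).
    by have := shift_const _ _ ax xt; lra.
  by have := shift_const _ _ at0 tx; lra.
have -> : expect f = (F (2 * pi) - F 0) / (2 * pi).
  apply: expect_primitive => //.
  by move=> x x1; apply: dF; apply: le_lt_trans x1.
have -> : F (2 * pi) - F 0 = (F (t 0%N + pi) - F (t 0%N)) *+ 2.
  have e1 : F (0 + pi) - F 0 = F (t 0%N + pi) - F (t 0%N) by apply: period_eq; lra.
  have e2 : F (pi + pi) - F pi = F (t 0%N + pi) - F (t 0%N) by apply: period_eq; lra.
  have -> : 2 * pi = pi + pi :> R by ring.
  by rewrite add0r in e1; rewrite mulr2n -{1}e1 -e2; ring.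
have -> : F (t 0%N + pi) - F (t 0%N) = \sum_(i < n) (G i (t i.+1) - G i (t i)).
  rewrite -tn -(telescope_sumr (fun i => F (t i))) // big_mkord.
  apply: eq_bigr => i _; have ltin := ltn_ord i.
  apply: (@primitive_unique R _ _ f (g i)); first exact: tmono.
  - move=> x /andP[tx _]; apply: dF; apply: lt_le_trans at0 _.
    apply: le_trans tx; apply: (@nondecreasing_upto t n) => //.
    by rewrite leq0n ltnW.
  - by move=> x _; apply: dG.
  - by move=> x; apply: fg.
set S := \sum_(_ < _) _; rewrite mulr2n; have pn := lt0r_neq0 p0.
by move: S pi pn => S p pn; field.
Qed.

End PiecewiseIntegral.

(** * The width as a sum of sines *)

Section WidthFunction.
Variable R : realType.

(** An edge of length l and direction s projects along w onto a segment of length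
    l * `|sin (w - s)|, and together the edges of a convex polygon cover its projection
    twice; so this is the function X_T of a polygon. *)
Definition sinsum (n : nat) (s lam : nat -> R) (w : R) : R :=
  (\sum_(m < n) lam m * `|sin (w - s m)|) / 2.

Definition sorted_modpi (n : nat) (s : nat -> R) : Prop :=
  (forall m, (m.+1 < n)%N -> s m <= s m.+1) /\ s n.-1 <= s 0%N + pi.

(** The minimum of E (X ^+ 2) / E (X) ^+ 2 over the width functions [sinsum] of n edges,
    by [second_moment_ge] and [equispaced_second_moment]. *)
Definition kappa (n : nat) : R := pi / (n%:R * cap (pi / n%:R)).

Lemma continuous_sin_shift c : continuous (fun w : R => sin (w - c)).
Proof.
by move=> w; case: (is_derive_sin_shift c w) => d _; exact/differentiable_continuous/derivable1_diffP.
Qed.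

Lemma continuous_sinsum n s lam : continuous (sinsum n s lam).
Proof.
have cs : continuous (fun w : R => \sum_(m < n) lam m * `|sin (w - s m)|).
  elim: n => [|n IH] w.
    by under eq_fun do rewrite big_ord0; exact: cvg_cst.
  under eq_fun do rewrite big_ord_recr /=.
  apply: cvgD; first exact: IH.
  apply: cvgM; first exact: cvg_cst.
  apply: cvg_norm; exact: continuous_sin_shift.
by move=> w; apply: (@cvgM _ _ _ _ _ (fun=> 2^-1)); [exact: cs|exact: cvg_cst].
Qed.

Lemma sinsumDpi n s lam w : sinsum n s lam (w + pi) = sinsum n s lam w.
Proof.
rewrite /sinsum; congr (_ / _); apply: eq_bigr => m _; congr (_ * _).
by rewrite addrAC sinDpi normrN.
Qed.

Lemma sinsum_ge0 n s lam w : (forall m, (m < n)%N -> 0 <= lam m) -> 0 <= sinsum n s lam w.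
Proof.
by move=> h; rewrite divr_ge0 // sumr_ge0 // => m _; rewrite mulr_ge0 // h.
Qed.

End WidthFunction.

(** * The minimal second moment *)

Section Optimum.
Variable R : realType.
Variables (n : nat) (s lam : nat -> R).
Hypothesis n_gt1 : (1 < n)%N.
Hypothesis s_sorted : sorted_modpi n s.
Hypothesis lam_gt0 : forall m, (m < n)%N -> 0 < lam m.

Let h0 : R := pi / n%:R.
Let X := sinsum n s lam.

(** The width function bends at the directions of the edges, and is a sinusoid ([wave])
    between two consecutive ones. The last breakpoint closes the period pi. *)
Definition breakpoint (i : nat) : R := if (i < n)%N then s i else s 0%N + pi.
Definition midpoint (i : nat) : R := (breakpoint i + breakpoint i.+1) / 2.
Definition gap (i : nat) : R := breakpoint i.+1 - breakpoint i.

(** Past the directions s 0, ..., s i, and before the next ones, sin (w - s m) is nonnegative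
    for m <= i and nonpositive for m > i. *)
Definition wave (i : nat) (w : R) : R :=
  (\sum_(m < n) (if (m <= i)%N then lam m else - lam m) * sin (w - s m)) / 2.
(** The coefficients of the cosine and of the sine of the distance to the midpoint of the
    piece, by [waveE]. *)
Definition even_part (i : nat) : R := wave i (midpoint i).
Definition odd_part (i : nat) : R := wave i (midpoint i + pi / 2).

Let n_gt0 : (0 < n)%N. Proof. exact: ltn_trans n_gt1. Qed.
Let nR_gt0 : 0 < n%:R :> R. Proof. by rewrite ltr0n. Qed.

Let h0_gt0 : 0 < h0. Proof. by rewrite divr_gt0 ?pi_gt0. Qed.

Let h0_lt_pi : h0 < pi.
Proof. by rewrite ltr_pdivrMr // ltr_pMr ?pi_gt0 // ltr1n. Qed.

Let nh0 : n%:R * h0 = pi. Proof. by rewrite mulrC divfK // lt0r_neq0. Qed.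

Lemma breakpoint_n : breakpoint n = breakpoint 0 + pi.
Proof. by rewrite /breakpoint ltnn n_gt0. Qed.

Lemma gap_ge0 i : (i < n)%N -> 0 <= gap i.
Proof.
move=> ltin; rewrite subr_ge0 /breakpoint ltin.
case: ltnP => h; first by apply s_sorted.1.
have -> : i = n.-1 by apply/eqP; rewrite eqn_leq -ltnS prednK // ltin; lia.
exact: s_sorted.2.
Qed.

Lemma breakpoint_mono i j : (i <= j <= n)%N -> breakpoint i <= breakpoint j.
Proof.
apply: nondecreasing_upto => k ltkn; rewrite -subr_ge0; exact: gap_ge0.
Qed.

Lemma sum_gap : \sum_(i < n) gap i = pi.
Proof.
rewrite -(big_mkord xpredT gap) /gap telescope_sumr // breakpoint_n; lra.
Qed.

Lemma gap_le_pi i : (i < n)%N -> gap i <= pi.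
Proof.
move=> ltin; rewrite -sum_gap (bigD1 (Ordinal ltin)) //= lerDl sumr_ge0 // => j _.
exact: gap_ge0.
Qed.

Lemma sinsum_wave i w : (i < n)%N -> breakpoint i <= w <= breakpoint i.+1 ->
  X w = wave i w.
Proof.
move=> ltin /andP[h1 h2]; congr (_ / 2); apply: eq_bigr => m _.
have ltmn := ltn_ord m.
have bm : breakpoint m = s m by rewrite /breakpoint ltmn.
have b0 : breakpoint 0 = s 0%N by rewrite /breakpoint n_gt0.
have mlo : breakpoint 0 <= breakpoint m by apply: breakpoint_mono; rewrite leq0n ltnW.
have whi : w <= breakpoint n by apply: le_trans h2 _; apply: breakpoint_mono; rewrite ltin leqnn.
have mhi : breakpoint m <= breakpoint n by apply: breakpoint_mono; rewrite leqnn ltnW.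
have wlo : breakpoint 0 <= w by apply: le_trans h1; apply: breakpoint_mono; rewrite leq0n ltnW.
rewrite breakpoint_n in whi mhi.
case: leqP => mi.
  have := @breakpoint_mono m i; rewrite mi ltnW // => /(_ isT) mle.
  rewrite ger0_norm // sin_ge0_pi // -bm; apply/andP; split; lra.
have := @breakpoint_mono i.+1 m; rewrite mi ltnW // => /(_ isT) mle.
rewrite mulNr -mulrN -sinN opprB -normrN -sinN opprB ger0_norm //.
by rewrite sin_ge0_pi // -bm; apply/andP; split; lra.
Qed.

Lemma waveE i w :
  wave i w = even_part i * cos (w - midpoint i) + odd_part i * sin (w - midpoint i).
Proof.
rewrite /even_part /odd_part; move: (midpoint i) => c.
rewrite /wave mulrAC [X in _ = _ + X]mulrAC -mulrDl; congr (_ / 2).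
rewrite !mulr_suml -big_split /=; apply: eq_bigr => m _.
set l := if _ then _ else _.
rewrite {1}(_ : w - s m = (c - s m) + (w - c)); last by ring.
rewrite (_ : c + pi / 2 - s m = (c - s m) + pi / 2); last by ring.
by rewrite sinD sinDpihalf; ring.
Qed.

Let P1 i w := even_part i * sin (w - midpoint i) - odd_part i * cos (w - midpoint i).

Let P2 i w := even_part i ^+ 2 * ((w - midpoint i) + sin (w - midpoint i) * cos (w - midpoint i)) / 2
  + even_part i * odd_part i * sin (w - midpoint i) ^+ 2
  + odd_part i ^+ 2 * ((w - midpoint i) - sin (w - midpoint i) * cos (w - midpoint i)) / 2.

Let dP1 i (x : R) : is_derive x 1 (P1 i) (wave i x).
Proof.
rewrite waveE /P1; move: (even_part i) (odd_part i) (midpoint i) => a b c.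
have ds := is_derive_sin_shift c x; have dc := is_derive_cos_shift c x.
by apply: is_derive_eq; rewrite /GRing.scale /=; ring.
Qed.

Let dP2 i (x : R) : is_derive x 1 (P2 i) (wave i x ^+ 2).
Proof.
rewrite waveE /P2; move: (even_part i) (odd_part i) (midpoint i) => a b c.
have ds := is_derive_sin_shift c x; have dc := is_derive_cos_shift c x.
apply: is_derive_eq; rewrite /GRing.scale /=.
have := cos2Dsin2 (x - c); move: (sin _) (cos _) => S C e.
transitivity (a ^+ 2 * ((C ^+ 2 + S ^+ 2) + C ^+ 2 - S ^+ 2) / 2 + a * b * 2 * (S * C)
  + b ^+ 2 * ((C ^+ 2 + S ^+ 2) - C ^+ 2 + S ^+ 2) / 2); last by field.
by rewrite e; field.
Qed.

Let halfE i : breakpoint i.+1 - midpoint i = gap i / 2.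
Proof. by rewrite /midpoint /gap; lra. Qed.

Let halfNE i : breakpoint i - midpoint i = - (gap i / 2).
Proof. by rewrite /midpoint /gap; lra. Qed.

Let X_pieces (f : R -> R) (g G : nat -> R -> R) :
  continuous f -> (forall x, 0 <= f x) -> (forall x, f (x + pi) = f x) ->
  (forall i (x : R), (i < n)%N -> is_derive x 1 (G i) (g i x)) ->
  (forall i x, (i < n)%N -> breakpoint i < x < breakpoint i.+1 -> f x = g i x) ->
  expect f = (\sum_(i < n) (G i (breakpoint i.+1) - G i (breakpoint i))) / pi.
Proof.
move=> cf f0 fpi dG fg; apply: (expect_pieces cf f0 fpi _ _ dG fg).
  exact: breakpoint_n.
by move=> i ltin; rewrite -subr_ge0; exact: gap_ge0.
Qed.

Let lam_ge0 m : (m < n)%N -> 0 <= lam m.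
Proof. by move=> /lam_gt0/ltW. Qed.

Lemma expect_sinsum :
  expect X = (\sum_(i < n) 2 * even_part i * sin (gap i / 2)) / pi.
Proof.
apply: (etrans (X_pieces (g := wave) (G := P1) _ _ _ (fun i x _ => dP1 i x) _)).
5: congr (_ / _); apply: eq_bigr => i _; rewrite /P1 halfE halfNE sinN cosN; ring.
- exact: continuous_sinsum.
- by move=> x; apply: sinsum_ge0.
- exact: sinsumDpi.
- by move=> i x ltin /andP[h1 h2]; apply: sinsum_wave => //; rewrite !ltW.
Qed.

Lemma expect_sinsum_sqr :
  expect (fun w => X w ^+ 2) = (\sum_(i < n)
    (even_part i ^+ 2 * (gap i + sin (gap i)) / 2
     + odd_part i ^+ 2 * (gap i - sin (gap i)) / 2)) / pi.
Proof.
apply: (etrans (X_pieces (g := fun i w => wave i w ^+ 2) (G := P2) _ _ _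
  (fun i x _ => dP2 i x) _)).
5: { congr (_ / _); apply: eq_bigr => i _; rewrite /P2 halfE halfNE sinN cosN.
  have -> : sin (gap i) = 2 * (sin (gap i / 2) * cos (gap i / 2)).
    by rewrite {1}(_ : gap i = (gap i / 2) *+ 2) ?sin_mulr2n; [ring|field].
  by field. }
- have -> : (fun w => X w ^+ 2) = (fun w => X w * X w) by apply/funext => w; rewrite expr2.
  by move=> w; apply: cvgM; exact: continuous_sinsum.
- by move=> x; exact: sqr_ge0.
- by move=> x; rewrite /X sinsumDpi.
- by move=> i x ltin /andP[h1 h2]; rewrite (sinsum_wave ltin) // !ltW.
Qed.

Lemma even_part_ge i : (i < n)%N -> lam i * sin (gap i / 2) / 2 <= even_part i.
Proof.
move=> ltin; have g0 := gap_ge0 ltin; have gpi := gap_le_pi ltin.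
rewrite /even_part -(sinsum_wave ltin); last first.
  by rewrite /midpoint; move: g0; rewrite /gap => g0; apply/andP; split; lra.
rewrite /X /sinsum ler_wpM2r // (bigD1 (Ordinal ltin)) //=.
have -> : midpoint i - s i = gap i / 2.
  by have := halfNE i; rewrite {1}/breakpoint ltin; lra.
rewrite ger0_norm; last by apply: sin_ge0_pi; apply/andP; split; lra.
rewrite lerDl sumr_ge0 // => j _; rewrite mulr_ge0 //; exact/lam_ge0/ltn_ord.
Qed.

Let half_gap_sin i : (i < n)%N -> 0 <= sin (gap i / 2).
Proof.
move=> ltin; have g0 := gap_ge0 ltin; have gpi := gap_le_pi ltin.
by apply: sin_ge0_pi; apply/andP; split; lra.
Qed.

Let even_part_ge0 i : (i < n)%N -> 0 <= even_part i.
Proof.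
move=> ltin; apply: le_trans (even_part_ge ltin).
by rewrite mulr_ge0 // mulr_ge0 ?lam_ge0 // half_gap_sin.
Qed.

Lemma expect_sinsum_gt0 : 0 < expect X.
Proof.
rewrite expect_sinsum divr_gt0 ?pi_gt0 //.
have term_ge0 (i : 'I_n) : true -> 0 <= 2 * even_part i * sin (gap i / 2).
  by move=> _; rewrite mulr_ge0 ?half_gap_sin // mulr_ge0 // even_part_ge0.
rewrite lt_neqAle sumr_ge0 // andbT eq_sym; apply/negP => /eqP /(psumr_eq0P term_ge0) z.
have gz i : (i < n)%N -> gap i = 0.
  move=> ltin; apply/eqP; rewrite eq_le gap_ge0 // andbT leNgt; apply/negP => g0.
  have /= e := z (Ordinal ltin) isT.
  have s0 : 0 < sin (gap i / 2).
    by apply: sin_gt0_pi; move: (gap_le_pi ltin) (pi_gt0 R) => ? ?; apply/andP; split; lra.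
  have ep : 0 < even_part i.
    apply: lt_le_trans (even_part_ge ltin).
    by rewrite divr_gt0 // mulr_gt0 // lam_gt0.
  have : 0 < 2 * even_part i * sin (gap i / 2) by apply: mulr_gt0 => //; lra.
  by rewrite e ltxx.
have := sum_gap; rewrite big1; first by move=> /eqP; rewrite lt_eqF // pi_gt0.
by move=> i _; exact/gz/ltn_ord.
Qed.

Let cap_h0_gt0 : 0 < cap h0.
Proof. by apply: cap_gt0; rewrite h0_gt0 ltW. Qed.

(** Summed over the pieces, with mu chosen as [mu0] below, this is a multiple of the excess
    of the second moment over its minimum. It is nonnegative by completing the square in the
    even part ([piece_slackE]), and because the concave function cap lies below its tangent
    at h0. As the gaps add up to n * h0, the term in [cap_slope] disappears from the sum. *)
Let piece_slack (mu : R) i :=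
  even_part i ^+ 2 * (gap i + sin (gap i)) / 2
  + odd_part i ^+ 2 * (gap i - sin (gap i)) / 2
  - mu * 2 * (2 * even_part i * sin (gap i / 2))
  + mu ^+ 2 * (cap h0 + cap_slope h0 * (gap i - h0)).

Let piece_slackE mu i : 0 < gap i -> piece_slack mu i =
  (gap i + sin (gap i)) / 2 * (even_part i - mu * 4 * sin (gap i / 2) / (gap i + sin (gap i))) ^+ 2
  + odd_part i ^+ 2 * (gap i - sin (gap i)) / 2
  + mu ^+ 2 * (cap h0 + cap_slope h0 * (gap i - h0) - cap (gap i)).
Proof.
move=> g0; have s0 := idDsin_gt0 g0.
have c1 : 1 - cos (gap i) = 2 * sin (gap i / 2) ^+ 2.
  rewrite {1}(_ : gap i = (gap i / 2) *+ 2); last by rewrite mulr2n; lra.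
  by rewrite cos_mulr2n cos2sin2 mulr2n; ring.
rewrite /piece_slack [cap (gap i)]/cap c1; field.
by rewrite lt0r_neq0.
Qed.

Let piece_slack_ge0 mu i : mu != 0 -> (i < n)%N -> 0 <= piece_slack mu i.
Proof.
move=> mu0 ltin; have := gap_ge0 ltin; rewrite le_eqVlt => /orP[/eqP g0|g0].
  rewrite /piece_slack -g0 mul0r sin0 !(addr0, subr0, mulr0, mul0r, add0r, oppr0) mulr_ge0 ?sqr_ge0 //.
  have := @cap_tangent R h0 0; rewrite cap0 h0_gt0 lexx pi_ge0 ltW // => /(_ isT isT).
  by rewrite lt_eqF // => /(_ isT)/ltW; rewrite sub0r.
rewrite piece_slackE //; apply: addr_ge0; first apply: addr_ge0.
- by rewrite mulr_ge0 ?sqr_ge0 // divr_ge0 // ltW // idDsin_gt0.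
- by rewrite divr_ge0 // mulr_ge0 ?sqr_ge0 // subr_ge0 sin_le_id // ltW.
- rewrite mulr_ge0 ?sqr_ge0 // subr_ge0.
  have [->|ne] := eqVneq (gap i) h0; first by rewrite subrr mulr0 addr0.
  by apply/ltW/cap_tangent; rewrite ?h0_gt0 ?g0 ?(ltW h0_lt_pi) ?gap_le_pi // ltW.
Qed.

Let piece_slack_eq0 mu i : mu != 0 -> (i < n)%N -> piece_slack mu i = 0 ->
  [/\ gap i = h0, odd_part i = 0
    & even_part i = mu * 4 * sin (h0 / 2) / (h0 + sin h0)].
Proof.
move=> mu0 ltin; have mu2 : 0 < mu ^+ 2 by rewrite lt_neqAle eq_sym sqrf_eq0 mu0 sqr_ge0.
have := gap_ge0 ltin; rewrite le_eqVlt => /orP[/eqP g0|g0].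
  rewrite /piece_slack -g0 mul0r sin0 !(addr0, subr0, mulr0, mul0r, add0r, oppr0).
  have := @cap_tangent R h0 0; rewrite cap0 h0_gt0 lexx pi_ge0 ltW // => /(_ isT isT).
  rewrite lt_eqF // => /(_ isT); rewrite sub0r => p /eqP.
  by rewrite mulf_eq0 gt_eqF //= gt_eqF.
rewrite piece_slackE //.
set A := _ / 2 * _; set B := _ * _ / 2; set C := mu ^+ 2 * _.
have A0 : 0 <= A by rewrite mulr_ge0 ?sqr_ge0 // divr_ge0 // ltW // idDsin_gt0.
have B0 : 0 <= B by rewrite divr_ge0 // mulr_ge0 ?sqr_ge0 // subr_ge0 sin_le_id // ltW.
have C0 : 0 <= C /\ (C = 0 -> gap i = h0).
  have [e|ne] := eqVneq (gap i) h0; first by rewrite /C e subrr mulr0 addr0 subrr mulr0.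
  have lt : cap (gap i) < cap h0 + cap_slope h0 * (gap i - h0).
    by apply/cap_tangent; rewrite ?h0_gt0 ?g0 ?(ltW h0_lt_pi) ?gap_le_pi // ltW.
  have C0 : 0 < C by rewrite mulr_gt0 // subr_gt0.
  by split; [exact: ltW|move=> e; rewrite e ltxx in C0].
move: C0 => [C0 Ceq] e.
have Ce : C = 0 by lra.
have Ae : A = 0 by lra.
have Be : B = 0 by lra.
have gh := Ceq Ce; split => //.
- move/eqP: Be; rewrite mulf_eq0 invr_eq0 pnatr_eq0 orbF mulf_eq0 sqrf_eq0 => /orP[/eqP//|].
  by rewrite subr_eq0 gt_eqF // sin_lt_id.
- move/eqP: Ae; rewrite mulf_eq0 mulf_eq0 invr_eq0 pnatr_eq0 orbF gt_eqF ?idDsin_gt0 //=.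
  by rewrite sqrf_eq0 subr_eq0 gh => /eqP.
Qed.

Let S1 := \sum_(i < n) 2 * even_part i * sin (gap i / 2).
Let S2 := \sum_(i < n)
    (even_part i ^+ 2 * (gap i + sin (gap i)) / 2
     + odd_part i ^+ 2 * (gap i - sin (gap i)) / 2).

Let sum_slack mu : \sum_(i < n) piece_slack mu i = S2 - 2 * mu * S1 + mu ^+ 2 * (n%:R * cap h0).
Proof.
rewrite /piece_slack big_split /= sumrB -!mulr_sumr.
have -> : \sum_(i < n) (cap h0 + cap_slope h0 * (gap i - h0)) = n%:R * cap h0.
  move: (cap h0) (cap_slope h0) => c d.
  rewrite big_split /= -mulr_sumr sumrB sum_gap !sumr_const card_ord.
  by rewrite -[h0 *+ n]mulr_natl nh0 subrr mulr0 addr0 mulr_natl.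
by rewrite /S1 /S2; ring.
Qed.

(** The minimizer of the quadratic polynomial [sum_slack]. *)
Let mu0 := S1 / (n%:R * cap h0).

Let S1_gt0 : 0 < S1.
Proof.
have := expect_sinsum_gt0; rewrite expect_sinsum -/S1.
by rewrite pmulr_lgt0 // invr_gt0 pi_gt0.
Qed.

Let mu0_neq0 : mu0 != 0.
Proof. by rewrite lt0r_neq0 // divr_gt0 ?S1_gt0 // mulr_gt0. Qed.

Let sum_slack0 : \sum_(i < n) piece_slack mu0 i
  = pi * (expect (fun w => X w ^+ 2) - kappa R n * expect X ^+ 2).
Proof.
rewrite sum_slack expect_sinsum expect_sinsum_sqr -/S1 -/S2 /kappa /mu0 -/h0.
have := cap_h0_gt0; move: (cap h0) => c /lt0r_neq0 c0.
have := lt0r_neq0 nR_gt0; have := lt0r_neq0 (pi_gt0 R).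
by move: S1 S2 pi n%:R => A B p N p0 N0; field; rewrite p0 N0 c0.
Qed.

(** On each piece the square of the integral of X is at most cap (gap i) times the integral
    of X ^+ 2, so by Cauchy-Schwarz the square of the whole integral is at most the sum of
    the cap (gap i) times the second moment; and that sum is at most n * cap (pi / n), by
    concavity. The two inequalities are used together, in the linearized form
    [piece_slack_ge0]. *)
Lemma second_moment_ge : kappa R n * expect X ^+ 2 <= expect (fun w => X w ^+ 2).
Proof.
rewrite -subr_ge0 -(pmulr_rge0 _ (pi_gt0 R)) -sum_slack0.
by apply: sumr_ge0 => i _; exact: piece_slack_ge0.
Qed.

(** Equality on each piece makes the gaps equal and the sinusoids translates of one cosine.
    The length of an edge is the jump of the slope of X at its direction, so the lengths are
    equal too. *)
Lemma second_moment_eq : expect (fun w => X w ^+ 2) = kappa R n * expect X ^+ 2 ->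
  forall m, (m < n)%N -> s m = s 0%N + m%:R * h0 /\ lam m = lam 0%N.
Proof.
move=> e.
have sl i : (i < n)%N -> piece_slack mu0 i = 0.
  move=> ltin; have : \sum_(i < n) piece_slack mu0 i = 0 by rewrite sum_slack0 e subrr mulr0.
  move/psumr_eq0P => z; apply: (z _ (Ordinal ltin)) => // j _.
  exact: piece_slack_ge0 (ltn_ord j).
set A := mu0 * 4 * sin (h0 / 2) / (h0 + sin h0).
have gE i : (i < n)%N -> gap i = h0 by move=> ltin; case: (piece_slack_eq0 mu0_neq0 ltin (sl i ltin)).
have bE i : (i <= n)%N -> breakpoint i = s 0%N + i%:R * h0.
  elim: i => [|i IH] ltin; first by rewrite mul0r addr0 /breakpoint n_gt0.
  have := gE i ltin; rewrite /gap IH 1?ltnW // => h.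
  by rewrite -natr1; lra.
have wE i w : (i < n)%N -> wave i w = A * cos (w - (s 0%N + i%:R * h0 + h0 / 2)).
  move=> ltin; have [_ o ev] := piece_slack_eq0 mu0_neq0 ltin (sl i ltin).
  rewrite waveE o ev mul0r addr0; congr (_ * cos (_ - _)).
  by rewrite /midpoint !bE // 1?ltnW // -natr1; lra.
have sE i : (i < n)%N -> s i = s 0%N + i%:R * h0.
  by move=> ltin; rewrite -bE 1?ltnW // /breakpoint ltin.
suff lamE i : (i < n)%N -> lam i = 2 * A * sin (h0 / 2).
  by move=> m ltmn; split; [exact: sE|rewrite !lamE].
case: i => [|i] ltin.
  have -> : lam 0%N = wave 0 (s 0%N + pi / 2) + wave n.-1 (s 0%N + pi / 2).
    rewrite /wave -mulrDl -big_split /= (bigD1 (Ordinal n_gt0)) //= big1.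
      have -> : s 0%N + pi / 2 - s 0%N = pi / 2 by ring.
      by rewrite sin_pihalf; lra.
    move=> j; rewrite -val_eqE /= -lt0n => j0.
    have -> : (j <= 0)%N = false by rewrite leqNgt j0.
    have -> : (j <= n.-1)%N by rewrite -ltnS prednK.
    ring.
  rewrite !wE ?prednK // mul0r addr0.
  rewrite (_ : s 0%N + pi / 2 - (s 0%N + h0 / 2) = - (h0 / 2) + pi / 2); last by ring.
  rewrite -subn1 natrB // mulrBl nh0.
  rewrite (_ : _ - _ = h0 / 2 - pi / 2); last by lra.
  by rewrite cosDpihalf cosBpihalf sinN; ring.
have -> : lam i.+1 = wave i.+1 (s i.+1 + pi / 2) - wave i (s i.+1 + pi / 2).
  rewrite /wave -mulrBl -sumrB (bigD1 (Ordinal ltin)) //= big1.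
    have -> : s i.+1 + pi / 2 - s i.+1 = pi / 2 by ring.
    by rewrite leqnn ltnn sin_pihalf; lra.
  move=> j; rewrite -val_eqE /= => ji.
  by rewrite [(j <= i.+1)%N]leq_eqVlt (negbTE ji) /= ltnS subrr.
rewrite !wE ?(ltnW ltin) // sE //.
rewrite (_ : _ - (_ + i.+1%:R * h0 + _) = - (h0 / 2) + pi / 2); last by ring.
rewrite (_ : _ - (_ + i%:R * h0 + _) = h0 / 2 + pi / 2); last by rewrite -natr1; lra.
by rewrite !cosDpihalf sinN; ring.
Qed.

End Optimum.

(** * Equispaced directions *)

Section Equispaced.
Variable R : realType.
Variables (n : nat) (s lam : nat -> R).
Hypothesis n_gt1 : (1 < n)%N.
Let h0 : R := pi / n%:R.
Hypothesis equi : forall m, (m < n)%N -> s m = s 0%N + m%:R * h0 /\ lam m = lam 0%N.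

Let n_gt0 : (0 < n)%N. Proof. exact: ltn_trans n_gt1. Qed.
Let nR_gt0 : 0 < n%:R :> R. Proof. by rewrite ltr0n. Qed.
Let h0_gt0 : 0 < h0. Proof. by rewrite divr_gt0 ?pi_gt0. Qed.
Let h0_lt_pi : h0 < pi.
Proof. by rewrite ltr_pdivrMr // ltr_pMr ?pi_gt0 // ltr1n. Qed.
Let nh0 : n%:R * h0 = pi. Proof. by rewrite mulrC divfK // lt0r_neq0. Qed.

Let sinh_gt0 : 0 < sin (h0 / 2).
Proof. by apply: sin_gt0_pi; move: h0_gt0 h0_lt_pi => ? ?; apply/andP; split; lra. Qed.

Lemma equispaced_sorted : sorted_modpi n s.
Proof.
split=> [m ltmn|]; first by rewrite (equi (ltnW ltmn)).1 (equi ltmn).1 -natr1; move: h0_gt0; lra.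
have ltn1 : (n.-1 < n)%N by rewrite prednK.
rewrite (equi ltn1).1 // lerD2l -nh0 ler_wpM2r ?(ltW h0_gt0) // ler_nat.
exact: leq_pred.
Qed.

Let bE i : (i <= n)%N -> breakpoint n s i = s 0%N + i%:R * h0.
Proof.
rewrite /breakpoint leq_eqVlt => /orP[/eqP->|lt]; first by rewrite ltnn nh0.
by rewrite lt (equi lt).1.
Qed.

Let midE i : (i < n)%N -> midpoint n s i = s 0%N + i%:R * h0 + h0 / 2.
Proof. by move=> lt; rewrite /midpoint !bE // 1?ltnW // -(natr1 i); lra. Qed.

(** Multiplied by 2 * sin (h0 / 2), the sines become differences of consecutive values of a
    cosine; the sum telescopes on both sides of the change of sign. *)
Lemma equispaced_wave i w : (i < n)%N -> wave n s lam i w =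
  lam 0%N / (2 * sin (h0 / 2)) * cos (w - (s 0%N + i%:R * h0 + h0 / 2)).
Proof.
move=> ltin.
pose E m := cos (w - s 0%N - m%:R * h0 + h0 / 2).
have step m : sin (w - (s 0%N + m%:R * h0)) * (2 * sin (h0 / 2)) = E m.+1 - E m.
  rewrite /E -(natr1 m).
  rewrite (_ : w - s 0%N - (m%:R + 1) * h0 + h0 / 2 = (w - (s 0%N + m%:R * h0)) - h0 / 2); last by lra.
  rewrite (_ : w - s 0%N - m%:R * h0 + h0 / 2 = (w - (s 0%N + m%:R * h0)) + h0 / 2); last by lra.
  by move: (w - _) => y; rewrite cosB cosD; ring.
have En : E n = - E 0%N.
  rewrite /E nh0 mul0r subr0 (_ : _ - pi + _ = (w - s 0%N + h0 / 2) - pi); last by ring.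
  by rewrite cosB cospi sinpi; ring.
have -> : wave n s lam i w = lam 0%N / (2 * sin (h0 / 2)) *
   ((\sum_(m < n) (if (m <= i)%N then 1 else -1) * (E m.+1 - E m)) / 2).
  rewrite /wave mulrA; congr (_ / 2); rewrite mulr_sumr; apply: eq_bigr => m _.
  rewrite (equi (ltn_ord m)).1 (equi (ltn_ord m)).2 -step.
  by case: ifP => _; field; rewrite lt0r_neq0.
congr (_ * _).
have -> : \sum_(m < n) (if (m <= i)%N then 1 else -1) * (E m.+1 - E m) = 2 * E i.+1.
  rewrite -(big_mkord xpredT (fun m => (if (m <= i)%N then 1 else -1) * (E m.+1 - E m))).
  rewrite (big_cat_nat (n := i.+1)) //=.
  rewrite (eq_big_nat _ _ (F2 := fun m => E m.+1 - E m)); last first.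
    by move=> m /andP[_]; rewrite ltnS => ->; rewrite mul1r.
  rewrite [X in _ + X](eq_big_nat _ _ (F2 := fun m => - (E m.+1 - E m))); last first.
    by move=> m /andP[lim _]; rewrite leqNgt lim mulN1r.
  by rewrite sumrN !telescope_sumr // En; ring.
rewrite mulrC mulKf //; congr cos; rewrite -(natr1 i); lra.
Qed.

Lemma equispaced_sinsum i w : (i < n)%N ->
  s 0%N + i%:R * h0 <= w <= s 0%N + i.+1%:R * h0 ->
  sinsum n s lam w =
  lam 0%N / (2 * sin (h0 / 2)) * cos (w - (s 0%N + i%:R * h0 + h0 / 2)).
Proof.
move=> ltin wi; rewrite -(equispaced_wave _ ltin).
by apply: (sinsum_wave _ n_gt1 equispaced_sorted) => //; rewrite !bE // ltnW.
Qed.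

Lemma equispaced_sinsum_le w : 0 <= lam 0%N ->
  sinsum n s lam w <= lam 0%N / (2 * sin (h0 / 2)).
Proof.
move=> l0; have [k /andP[k1 k2]] := exists_modpi (s 0%N) w.
set w' := w + k%:~R * pi in k1 k2.
have -> : sinsum n s lam w = sinsum n s lam w'.
  rewrite /sinsum; congr (_ / 2); apply: eq_bigr => m _; congr (_ * _).
  by rewrite /w' addrAC normr_sinDkpi.
have q0 : 0 <= (w' - s 0%N) / h0 by rewrite divr_ge0 ?subr_ge0 // ltW.
pose i := Num.truncn ((w' - s 0%N) / h0).
have /andP[i1 i2] := truncn_itv q0; rewrite -/i in i1 i2.
rewrite ler_pdivlMr // in i1; rewrite ltr_pdivrMr // in i2.
have ltin : (i < n)%N.
  rewrite -(ltr_nat R) -(ltr_pM2r h0_gt0) nh0; lra.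
rewrite (@equispaced_sinsum i) //; last by apply/andP; split; lra.
rewrite ler_piMr ?cos_le1 // divr_ge0 // mulr_ge0 // ltW //.
Qed.

Hypothesis lam_gt0 : forall m, (m < n)%N -> 0 < lam m.

(** All the pieces carry the same even sinusoid over the same length, so the inequalities
    behind [second_moment_ge] are equalities. *)
Lemma equispaced_second_moment :
  expect (fun w => sinsum n s lam w ^+ 2) = kappa R n * expect (sinsum n s lam) ^+ 2.
Proof.
rewrite (expect_sinsum_sqr _ n_gt1 equispaced_sorted).
rewrite (expect_sinsum n_gt1 equispaced_sorted lam_gt0).
set A := lam 0%N / (2 * sin (h0 / 2)).
have ev i : (i < n)%N -> even_part n s lam i = A.
  by move=> lt; rewrite /even_part equispaced_wave // midE // subrr cos0 mulr1.
have od i : (i < n)%N -> odd_part n s lam i = 0.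
  move=> lt; rewrite /odd_part equispaced_wave // midE // addrC addKr.
  by rewrite cos_pihalf mulr0.
have gE i : (i < n)%N -> gap n s i = h0.
  by move=> lt; rewrite /gap !bE // 1?ltnW // -(natr1 i); lra.
rewrite (eq_bigr (fun=> A ^+ 2 * (h0 + sin h0) / 2)); last first.
  by move=> i _; rewrite ev ?od ?gE // expr0n mul0r mul0r addr0.
rewrite [in RHS](eq_bigr (fun=> 2 * A * sin (h0 / 2))); last first.
  by move=> i _; rewrite ev ?gE.
rewrite !sumr_const card_ord -[_ *+ n]mulr_natl -[X in _ = _ * (X / _) ^+ 2]mulr_natl /kappa -/h0 /cap.
have -> : 1 - cos h0 = 2 * sin (h0 / 2) ^+ 2.
  rewrite {1}(_ : h0 = (h0 / 2) *+ 2); last by rewrite mulr2n; lra.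
  by rewrite cos_mulr2n cos2sin2 mulr2n; ring.
have := lt0r_neq0 (idDsin_gt0 h0_gt0); have := lt0r_neq0 nR_gt0.
have := lt0r_neq0 sinh_gt0; have := lt0r_neq0 (pi_gt0 R).
move: n%:R pi (sin (h0 / 2)) (h0 + sin h0) => N p S T p0 S0 N0 T0; field.
by rewrite p0 S0 N0 T0.
Qed.

End Equispaced.

(** * The deviation rate of a family of directions *)

Section DirectionFamilies.
Variable R : realType.

Definition dirsum (n : nat) (th l : 'I_n -> R) (w : R) : R :=
  (\sum_(j < n) l j * `|sin (w - th j)|) / 2.

(** The width depends on the directions modulo pi only. Modulo pi, an equispaced family
    exhausts a coset of the multiples of pi / n; being injective, p is a permutation. *)
Definition equispaced (n : nat) (th : 'I_n -> R) : Prop :=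
  exists (a : R) (p : 'I_n -> 'I_n) (k : 'I_n -> int), injective p /\
    forall j, th j = a + (p j)%:R * (pi / n%:R) + (k j)%:~R * pi.

Lemma dirsum_reindex n (th l : 'I_n -> R) (s lam : nat -> R) (p : 'I_n -> 'I_n)
    (k : 'I_n -> int) :
  injective p -> (forall j, th j = s (p j) + (k j)%:~R * pi) ->
  (forall j, l j = lam (p j)) -> dirsum th l = sinsum n s lam.
Proof.
move=> ip ths ls; apply/funext => w; rewrite /dirsum /sinsum; congr (_ / 2).
rewrite [RHS](reindex_inj ip) /=; apply: eq_bigr => j _.
rewrite ls ths; congr (_ * _).
rewrite -[in RHS](normr_sinDkpi _ (- k j)) rmorphN mulNr /=.
by congr (`|sin _|); ring.
Qed.

(** The representatives modulo pi in [0, pi[ are sorted. *)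
Lemma sort_directions n (th l : 'I_n -> R) : (0 < n)%N ->
  exists (s lam : nat -> R) (p : 'I_n -> 'I_n) (k : 'I_n -> int),
  [/\ sorted_modpi n s, injective p, forall j, th j = s (p j) + (k j)%:~R * pi
    & forall j, l j = lam (p j)].
Proof.
move=> n0.
have [k kP] : exists k : 'I_n -> int, forall j, 0 <= th j + (k j)%:~R * pi < pi.
  have /choice[k kP] : forall j, exists k : int, 0 <= th j + k%:~R * pi < pi.
    by move=> j; have := exists_modpi 0 (th j); rewrite add0r.
  by exists k.
pose r j := th j + (k j)%:~R * pi.
pose le_r i j := r i <= r j.
pose e := sort le_r (enum 'I_n).
have le_total : total le_r by move=> i j; exact: le_total.
have le_trans' : transitive le_r by move=> i j m; exact: le_trans.
have e_sorted : sorted le_r e by exact: sort_sorted.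
have e_size : size e = n by rewrite size_sort size_enum_ord.
have e_mem j : j \in e by rewrite mem_sort mem_enum.
have e_uniq : uniq e by rewrite sort_uniq enum_uniq.
pose j0 := Ordinal n0.
pose s m := r (nth j0 e m).
have idx j : (index j e < n)%N by rewrite -[X in (_ < X)%N]e_size index_mem.
exists s, (fun m => l (nth j0 e m)), (fun j => Ordinal (idx j)), (fun j => - k j).
have nthE j : nth j0 e (index j e) = j by exact: nth_index.
split=> [|i j /(congr1 val)/= eij|j|j] /=.
- split=> [m ltmn|]; first by apply: (sortedP j0 e_sorted); rewrite e_size.
  have /andP[h1 h2] := kP (nth j0 e n.-1); have /andP[h3 h4] := kP (nth j0 e 0).
  by rewrite /s /r; lra.
- by rewrite -(nthE i) eij nthE.
- by rewrite /s nthE /r rmorphN mulNr /= addrK.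
- by rewrite nthE.
Qed.

(** So the radicand of the minimal deviation rate is nonnegative, and comparing square roots
    is comparing radicands. *)
Lemma kappa_ge1 n : (1 < n)%N -> 1 <= kappa R n.
Proof.
move=> n1; have N0 : 0 < n%:R :> R by rewrite ltr0n ltnW.
have h0 : 0 < (pi / n%:R : R) <= pi.
  rewrite divr_gt0 ?pi_gt0 //= ler_pdivrMr // ler_pMr ?pi_gt0 // ler1n ltnW //.
rewrite /kappa ler_pdivlMr ?mul1r; last by rewrite mulr_gt0 // cap_gt0.
by have := cap_le_id h0; rewrite ler_pdivlMr // mulrC.
Qed.

Section Moments.
Variables (n : nat) (th l : 'I_n -> R).
Hypothesis n_gt1 : (1 < n)%N.
Hypothesis l_gt0 : forall j, 0 < l j.

Let n_gt0 : (0 < n)%N. Proof. exact: ltn_trans n_gt1. Qed.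

Let lam_gt0 (lam : nat -> R) (p : 'I_n -> 'I_n) : injective p ->
  (forall j, l j = lam (p j)) -> forall m, (m < n)%N -> 0 < lam m.
Proof.
move=> ip lE m ltmn; have /= := lE (invF ip (Ordinal ltmn)).
by rewrite f_invF /= => <-.
Qed.

Lemma expect_dirsum_gt0 : 0 < expect (dirsum th l).
Proof.
have [s [lam [p [k [ss ip ths lE]]]]] := sort_directions th l n_gt0.
rewrite (dirsum_reindex ip ths lE).
exact: (expect_sinsum_gt0 n_gt1 ss (lam_gt0 ip lE)).
Qed.

Lemma dirsum_second_moment_ge :
  kappa R n * expect (dirsum th l) ^+ 2 <= expect (fun w => dirsum th l w ^+ 2).
Proof.
have [s [lam [p [k [ss ip ths lE]]]]] := sort_directions th l n_gt0.
rewrite (dirsum_reindex ip ths lE).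
exact: (second_moment_ge n_gt1 ss (lam_gt0 ip lE)).
Qed.

Lemma dirsum_second_moment_eq :
  expect (fun w => dirsum th l w ^+ 2) = kappa R n * expect (dirsum th l) ^+ 2 ->
  equispaced th /\ forall i j, l i = l j.
Proof.
have [s [lam [p [k [ss ip ths lE]]]]] := sort_directions th l n_gt0.
rewrite (dirsum_reindex ip ths lE).
move=> /(second_moment_eq n_gt1 ss (lam_gt0 ip lE)) eq.
split; last by move=> i j; rewrite !lE (eq _ (ltn_ord _)).2 (eq _ (ltn_ord (p j))).2.
by exists (s 0%N), p, k; split=> // j; rewrite ths (eq _ (ltn_ord _)).1.
Qed.

Lemma equispaced_dirsumE (a : R) (p : 'I_n -> 'I_n) (k : 'I_n -> int) (l0 : R) :
  injective p ->
  (forall j, th j = a + (p j)%:R * (pi / n%:R) + (k j)%:~R * pi) ->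
  (forall j, l j = l0) ->
  dirsum th l = sinsum n (fun m => a + m%:R * (pi / n%:R)) (fun=> l0).
Proof. by move=> ip thE lE; apply: (dirsum_reindex ip thE lE). Qed.

Lemma equispaced_dirsum_second_moment : equispaced th -> (forall i j, l i = l j) ->
  expect (fun w => dirsum th l w ^+ 2) = kappa R n * expect (dirsum th l) ^+ 2.
Proof.
move=> [a [p [k [ip thE]]]] lE; pose j0 := Ordinal n_gt0.
rewrite (equispaced_dirsumE ip thE (fun j => lE j j0)).
by apply: equispaced_second_moment => // m _; rewrite mul0r addr0.
Qed.

End Moments.

Lemma deltaE (f : R -> R) : 0 < expect f ->
  delta f = Num.sqrt (expect (fun w => f w ^+ 2) / expect f ^+ 2 - 1).
Proof.
move=> f0; rewrite /delta.
move: (expect (fun w => f w ^+ 2)) (expect f) f0 => E2 E E0; have E1 := lt0r_neq0 E0.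
have -> : E2 / E ^+ 2 - 1 = E^-1 ^+ 2 * (E2 - E ^+ 2) by field.
rewrite sqrtrM ?sqr_ge0 // sqrtr_sqr; rewrite ger0_norm; last by rewrite invr_ge0 ltW.
by rewrite mulrC.
Qed.

Lemma delta_le (f g : R -> R) (c : R) : 0 < expect f -> 0 < expect g ->
  expect (fun w => f w ^+ 2) = c * expect f ^+ 2 ->
  c * expect g ^+ 2 <= expect (fun w => g w ^+ 2) -> delta f <= delta g.
Proof.
move=> f0 g0 ef cg; rewrite !deltaE // ef mulfK; last by rewrite sqrf_eq0 lt0r_neq0.
by rewrite ler_wsqrtr // lerD2r ler_pdivlMr // exprn_gt0.
Qed.

Lemma delta_le_inv (f g : R -> R) (c : R) : 1 <= c -> 0 < expect f -> 0 < expect g ->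
  expect (fun w => f w ^+ 2) = c * expect f ^+ 2 ->
  delta g <= delta f -> expect (fun w => g w ^+ 2) <= c * expect g ^+ 2.
Proof.
move=> c1 f0 g0 ef; rewrite !deltaE // ef mulfK; last by rewrite sqrf_eq0 lt0r_neq0.
by rewrite ler_sqrt ?subr_ge0 // lerD2r ler_pdivrMr // exprn_gt0.
Qed.

End DirectionFamilies.

(** * Convex hulls and their projections *)

Section ConvexHulls.
Variable R : realType.
Implicit Types (K S : set R[i]) (z : R[i]).

(** The convexity of the plane as a vector space over [R], in terms of complex products. *)
Lemma convexCP K : convex K <-> forall x y (t : R), K x -> K y -> 0 <= t <= 1 ->
  K (t%:C * x + (1 - t)%:C * y).
Proof.
have scaleE (t : R) (x : R[i]) : t *: (x : Rcomplex R) = t%:C * x.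
  by case: x => a b; apply/eqP; rewrite eq_complex /= !mul0r subr0 addr0 !eqxx.
split.
  move=> cK x y t Kx Ky /andP[t0 t1].
  have := cK x y (Itv01 t0 t1) (mem_set Kx) (mem_set Ky); rewrite inE.
  by rewrite /conv /= !scaleE.
move=> h x y l /set_mem Kx /set_mem Ky; rewrite inE.
have := h x y l%:num Kx Ky; rewrite -!scaleE; apply.
by rewrite ge0 le1.
Qed.

Lemma sub_convex_hull S : S `<=` convex_hull S.
Proof. exact: sub_gen_smallest. Qed.

Lemma convex_hull_sub S K : convex K -> S `<=` K -> convex_hull S `<=` K.
Proof. by move=> cK SK; apply: smallest_sub. Qed.

Lemma convex_halfplane w (c : R) : convex [set z : R[i] | coproj w z <= c].
Proof.
apply/convexCP => x y t /= hx hy /andP[t0 t1].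
by rewrite coprojD !coprojZ; nra.
Qed.

Lemma sqn_convex (x y p : R[i]) (t : R) :
  sqn (t%:C * x + (1 - t)%:C * y - p)
  = t * sqn (x - p) + (1 - t) * sqn (y - p) - t * (1 - t) * sqn (x - y).
Proof. by case: x y p => [a b] [c d] [e f]; rewrite /sqn /=; ring. Qed.

Lemma convex_disc (p : R[i]) (r : R) : convex [set z : R[i] | sqn (z - p) <= r ^+ 2].
Proof.
apply/convexCP => x y t /= hx hy /andP[t0 t1].
rewrite sqn_convex; have := sqn_ge0 (x - y) => ?.
have : 0 <= t * (1 - t) * sqn (x - y) by rewrite !mulr_ge0 // subr_ge0.
have : t * sqn (x - p) <= t * r ^+ 2 by rewrite ler_wpM2l.
have : (1 - t) * sqn (y - p) <= (1 - t) * r ^+ 2 by rewrite ler_wpM2l // subr_ge0.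
lra.
Qed.

Lemma sup_attained (E : set R) x : E x -> ubound E x -> sup E = x.
Proof.
move=> Ex ub; apply/eqP; rewrite eq_le; apply/andP; split.
  by apply: ge_sup => //; exists x.
by apply: ub_le_sup => //; exists x.
Qed.

Lemma inf_attained (E : set R) x : E x -> lbound E x -> inf E = x.
Proof.
move=> Ex lb; apply/eqP; rewrite eq_le; apply/andP; split.
  by apply: ge_inf => //; exists x.
by apply: lb_le_inf => //; exists x.
Qed.

Lemma proj_length_attained K w a b : K a -> K b ->
  (forall z, K z -> coproj w b <= coproj w z <= coproj w a) ->
  proj_length K w = coproj w a - coproj w b.
Proof.
move=> Ka Kb h.
congr (_ - _).
  apply: sup_attained; first by exists a.
  by move=> _ [z /h /andP[_ hz] <-].
apply: inf_attained; first by exists b.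
by move=> _ [z /h /andP[hz _] <-].
Qed.

Lemma convex_hull_coproj S w (x y : R) :
  (forall z, S z -> x <= coproj w z <= y) ->
  forall z, convex_hull S z -> x <= coproj w z <= y.
Proof.
move=> h z Hz; apply/andP; split; last first.
  have sub : convex_hull S `<=` [set z | coproj w z <= y].
    by apply: convex_hull_sub; [exact: convex_halfplane|move=> u /h /andP[]].
  exact: sub.
have sub : convex_hull S `<=` [set z | coproj (w + pi) z <= - x].
  apply: convex_hull_sub; first exact: convex_halfplane.
  by move=> u /h /andP[hu _] /=; rewrite coprojDpi lerN2.
by have := sub z Hz; rewrite /= coprojDpi lerN2.
Qed.

Lemma proj_length_hull S w a b : S a -> S b ->
  (forall z, S z -> coproj w b <= coproj w z <= coproj w a) ->
  proj_length (convex_hull S) w = coproj w a - coproj w b.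
Proof.
move=> Sa Sb h; apply: proj_length_attained; [exact: sub_convex_hull..|].
exact: convex_hull_coproj.
Qed.

End ConvexHulls.

(** * Closed chains of edges *)

Section ClosedChains.
Variable R : realType.

Lemma sum_period (V : zmodType) (n : nat) (f : nat -> V) (j : nat) :
  (forall i, f (i + n)%N = f i) -> \sum_(j <= i < j + n) f i = \sum_(i < n) f i.
Proof.
move=> fn; elim: j => [|j IH]; first by rewrite add0n big_mkord.
rewrite -IH.
have [->|n0] := eqVneq n 0%N; first by rewrite !addn0 !big_geq.
rewrite [in RHS]big_ltn; last by rewrite -{1}[j]addn0 ltn_add2l lt0n.
by rewrite addSn big_nat_recr /= ?fn 1?addrC // -addn1 leq_add2l lt0n.
Qed.

(** A polygon unrolled along the natural numbers: the vertices repeat with the period n while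
    the angles of the edges keep increasing. Arcs of the polygon become intervals of indices,
    whose order replaces the cyclic order of the vertices. *)
Record closed_chain (n : nat) (A : nat -> R[i]) (th l : nat -> R) : Prop := {
  chain_period : forall i, A (i + n)%N = A i;
  chain_length_period : forall i, l (i + n)%N = l i;
  chain_angle_period : forall i, th (i + n)%N = th i + 2 * pi;
  chain_angle_mono : forall i, th i <= th i.+1;
  chain_length_gt0 : forall i, 0 < l i;
  chain_step : forall i, A i.+1 = A i + (l i)%:C * cis (th i)
}.

Section Chain.
Variables (n : nat) (A : nat -> R[i]) (th l : nat -> R).
Hypothesis n_gt0 : (0 < n)%N.
Hypothesis chain : closed_chain n A th l.

Let width w := (\sum_(i < n) l i * `|sin (w - th i)|) / 2.

Lemma chain_mono i j : (i <= j)%N -> th i <= th j.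
Proof.
move=> ij; apply: (@nondecreasing_upto R th j); last by rewrite ij leqnn.
by move=> k _; exact: chain_angle_mono chain k.
Qed.

Lemma chain_periodM i k : A (i + k * n)%N = A i.
Proof.
elim: k => [|k IH]; first by rewrite mul0n addn0.
by rewrite mulSn addnA addnAC (chain_period chain) IH.
Qed.

Lemma chain_coproj w j a : (j <= a)%N ->
  coproj w (A a) - coproj w (A j) = \sum_(j <= i < a) l i * sin (th i - w).
Proof.
move=> ja; rewrite -(telescope_sumr (fun i => coproj w (A i))) //.
apply: eq_bigr => i _.
by rewrite (chain_step chain) coprojD coprojZ coproj_cis addrAC subrr add0r.
Qed.

Let term w i := l i * `|sin (w - th i)|.

Let term_period w i : term w (i + n)%N = term w i.
Proof.
rewrite /term (chain_length_period chain) (chain_angle_period chain); congr (_ * `|_|).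
rewrite -[in RHS](sinDk2pi (w - th i) (-1)); congr sin.
by rewrite mulN1r opprD addrA.
Qed.

Let term_sum w j : \sum_(j <= i < j + n) term w i = 2 * width w.
Proof. by rewrite (sum_period _ (term_period w)) /width mulrC divfK. Qed.

(** Along w, the edges from j to a climb and the edges from a to j + n descend, by the same
    total amount: half of the total variation. *)
Lemma chain_width w j a : (j <= a <= j + n)%N ->
  (forall i, (j <= i < a)%N -> 0 <= th i - w <= pi) ->
  (forall i, (a <= i < j + n)%N -> pi <= th i - w <= 2 * pi) ->
  coproj w (A a) - coproj w (A j) = width w.
Proof.
move=> /andP[ja an] hpos hneg.
suff : (coproj w (A a) - coproj w (A j)) - (coproj w (A (j + n)%N) - coproj w (A a)) = 2 * width w.
  by rewrite (chain_period chain); lra.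
rewrite !chain_coproj // -(term_sum w j) (big_cat_nat ja an) /= -sumrN; congr (_ + _).
  apply: eq_big_nat => i /hpos h; rewrite /term; congr (_ * _).
  by rewrite -(opprB (th i)) sinN normrN ger0_norm // sin_ge0_pi.
apply: eq_big_nat => i /hneg h; rewrite /term -mulrN; congr (_ * _).
rewrite -(opprB (th i)) sinN normrN ler0_norm //.
rewrite -(subrK pi (th i - w)).
by rewrite sinDpi oppr_le0 sin_ge0_pi //; move: h; lra.
Qed.

Let chain_le_ordered w a b : (a <= b <= a + n)%N ->
  coproj w (A a) - coproj w (A b) <= width w /\ coproj w (A b) - coproj w (A a) <= width w.
Proof.
move=> /andP[ab ban].
have t1 := chain_coproj w ab; have t2 := chain_coproj w ban.
rewrite (chain_period chain) in t2.
have bound i j : `|\sum_(i <= k < j) l k * sin (th k - w)| <= \sum_(i <= k < j) term w k.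
  apply: le_trans (ler_norm_sum _ _ _) _; rewrite big_seq [leRHS]big_seq.
  apply: ler_sum => k _; rewrite normrM ger0_norm ?(ltW (chain_length_gt0 chain k)) //.
  by rewrite /term -(opprB (th k)) sinN normrN.
have b1 := bound a b; have b2 := bound b (a + n)%N.
have := term_sum w a; rewrite (big_cat_nat ab ban) /=.
move: b1 b2; rewrite -t1 -t2 !ler_norml => /andP[? ?] /andP[? ?]; split; lra.
Qed.

(** The two paths between a and b both have a variation of at least the difference of the
    heights, and together they have the variation 2 * width. *)
Lemma chain_le w a b : coproj w (A a) - coproj w (A b) <= width w.
Proof.
have Amod i : A i = A (i %% n)%N by rewrite {1}(divn_eq i n) addnC chain_periodM.
rewrite (Amod a) (Amod b); have := ltn_pmod a n_gt0; have := ltn_pmod b n_gt0.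
move: (a %% n)%N (b %% n)%N => {}a {}b bn an.
have [ab|ba] := leqP a b.
  by apply: (chain_le_ordered w _).1; rewrite ab; lia.
by apply: (chain_le_ordered w _).2; rewrite (ltnW ba); lia.
Qed.

(** The climb begins at the first edge whose angle reaches w modulo 2 * pi, and ends at the
    first edge whose angle exceeds this by pi. *)
Lemma chain_exists w : exists j a, coproj w (A a) - coproj w (A j) = width w.
Proof.
have twopi := twopi_gt0 R.
have [k /andP[k1 k2]] : exists k : int, th 0%N < w + k%:~R * (2 * pi) <= th 0%N + 2 * pi.
  exists (- (Num.ceil ((w - th 0%N) / (2 * pi)) - 1)).
  have /andP[h1 h2] := ceil_itv ((w - th 0%N) / (2 * pi)).
  rewrite ler_pdivrMr // in h2; rewrite intrD ltr_pdivlMr // in h1.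
  by rewrite rmorphN rmorphB /= mulNr; apply/andP; split; lra.
set w' := w + k%:~R * (2 * pi) in k1 k2.
have cE z : coproj w z = coproj w' z.
  by rewrite /coproj /w' opprD -mulNr -rmorphN cisDk2pi.
have wE : width w = width w'.
  rewrite /width /w'; congr (_ / 2); apply: eq_bigr => i _.
  by rewrite addrAC sinDk2pi.
rewrite wE.
have ex1 : exists i, w' <= th i.
  by exists n; rewrite -(add0n n) (chain_angle_period chain).
pose j := ex_minn ex1.
have [jw jmin] : w' <= th j /\ forall i, w' <= th i -> (j <= i)%N.
  by rewrite /j; case: ex_minnP.
have ex2 : exists i, w' + pi <= th i.
  exists (j + n)%N; rewrite (chain_angle_period chain).
  by have := pi_gt0 R; lra.
pose a := ex_minn ex2.
have [aw amin] : w' + pi <= th a /\ forall i, w' + pi <= th i -> (a <= i)%N.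
  by rewrite /a; case: ex_minnP.
exists j, a; rewrite !cE; apply: chain_width.
- apply/andP; split; first by apply: jmin; have := pi_gt0 R; lra.
  by apply: amin; rewrite (chain_angle_period chain); have := pi_gt0 R; lra.
- move=> i /andP[ji ia]; apply/andP; split; first by have := chain_mono ji; lra.
  by rewrite leNgt; apply/negP => lt; have := amin i; rewrite leqNgt ia /= ; lra.
- move=> i /andP[ai ijn]; apply/andP; split; first by have := chain_mono ai; lra.
  have [i0 | i0] := leqP n i; last first.
    have := chain_mono (ltnW i0); rewrite -(add0n n) (chain_angle_period chain); lra.
  rewrite -(subnK i0) (chain_angle_period chain).
  have lt : th (i - n)%N < w'.
    by rewrite ltNge; apply/negP => /jmin; lia.
  lra.
Qed.

Lemma chain_proj_length w :
  proj_length (convex_hull (range A)) w = width w.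
Proof.
have [j [a e]] := chain_exists w.
rewrite -e; apply: proj_length_hull; [by exists a|by exists j|].
move=> _ [i _ <-]; have := chain_le w i j; have := chain_le w a i.
by move=> ? ?; apply/andP; split; lra.
Qed.

End Chain.

End ClosedChains.

(** * Minimizing polygons *)

Section Polygons.
Variable R : realType.
Variable n : nat.
Hypothesis n_gt1 : (1 < n)%N.

Let n_gt0 : (0 < n)%N. Proof. exact: ltn_trans n_gt1. Qed.

Definition chain_of (alpha : 'I_n -> R[i]) (A : nat -> R[i]) (th l : nat -> R) : Prop :=
  closed_chain n A th l /\ forall j : 'I_n, A j = alpha j.

Lemma chain_of_range alpha A th l : chain_of alpha A th l -> range A = range alpha.
Proof.
move=> [ch Aa]; apply/seteqP; split=> [_ [i _ <-]|_ [j _ <-]].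
  exists (Ordinal (ltn_pmod i n_gt0)) => //.
  by rewrite -Aa /= {2}(divn_eq i n) addnC (chain_periodM ch).
by exists j => //; rewrite Aa.
Qed.

Lemma chain_of_edge alpha A th l (j : 'I_n) : chain_of alpha A th l ->
  edge alpha j = (l j)%:C * cis (th j).
Proof.
move=> [ch Aa]; rewrite /edge -!Aa /=.
have -> : A (j.+1 %% n)%N = A j.+1.
  by rewrite [in RHS](divn_eq j.+1 n) addnC (chain_periodM ch).
by rewrite (chain_step ch) addrAC subrr add0r.
Qed.

Lemma norm_cis (t : R) : `|cis t| = 1.
Proof. by rewrite norm_sqn sqn_cis sqrtr1. Qed.

Lemma chain_of_edge_norm alpha A th l (j : 'I_n) : chain_of alpha A th l ->
  `|edge alpha j| = (l j)%:C.
Proof.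
move=> ch; rewrite (chain_of_edge j ch) normrM norm_cis mulr1.
by rewrite norm_sqn /sqn /= expr0n addr0 sqrtr_sqr gtr0_norm // (chain_length_gt0 ch.1).
Qed.

(** The given arguments th0 of the edges are extended by 2 * pi for each further turn. *)
Lemma polygon_chain alpha T : polygon_on alpha T ->
  exists A th l, chain_of alpha A th l.
Proof.
move=> [alpha_inj [th0 [edgeE th_mono th_wrap]] _].
pose o i := Ordinal (ltn_pmod i n_gt0).
have oD i : o (i + n)%N = o i by apply: val_inj; rewrite /= modnDr.
have oS i : o i.+1 = ordS (o i).
  by apply: val_inj; rewrite /= -[in LHS]addn1 -[in RHS]addn1 modnDml.
pose len j := Num.sqrt (sqn (edge alpha j)).
exists (alpha \o o), (fun i => th0 (i %% n)%N + (i %/ n)%:R * (2 * pi)), (len \o o).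
split; last by move=> j; congr alpha; apply: val_inj; rewrite /= modn_small.
split=> i /=.
- by rewrite oD.
- by rewrite oD.
- by rewrite modnDr divnDr ?dvdnn // divnn n_gt0 /= natrD mulrDl mul1r addrA.
- have lt := ltn_pmod i n_gt0.
  have [lt1|ge1] := ltnP (i %% n).+1 n.
    have e : i.+1 = (i %/ n * n + (i %% n).+1)%N by rewrite addnS -divn_eq.
    rewrite e modnMDl divnMDl // (modn_small lt1) (divn_small lt1) addn0 lerD2r.
    exact: th_mono.
  have ei : (i %% n)%N = n.-1 by lia.
  have e : i.+1 = ((i %/ n).+1 * n + 0)%N.
    by rewrite {1}(divn_eq i n) ei addn0 mulSn -addnS prednK // addnC.
  rewrite e modnMDl divnMDl // mod0n div0n addn0 ei -natr1.
  by have := th_wrap; lra.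
- rewrite sqrtr_gt0 lt_neqAle sqn_ge0 andbT eq_sym; apply/negP => /eqP/sqn_eq0.
  rewrite /edge => /eqP; rewrite subr_eq0 => /eqP/alpha_inj/(congr1 val)/=.
  have := ltn_pmod i n_gt0.
  move: (i %% n)%N => k kn.
  have [k1|k1] := ltnP k.+1 n; first by rewrite modn_small //; lia.
  have -> : k.+1 = n by lia.
  by rewrite modnn; lia.
- have e : `|edge alpha (o i)| = (len (o i))%:C by rewrite norm_sqn.
  have := edgeE (o i); rewrite e /= cisDk2pi_nat => <-.
  by rewrite oS /edge addrCA subrr addr0.
Qed.

Lemma chain_of_proj_length alpha A th l T : polygon_on alpha T ->
  chain_of alpha A th l ->
  proj_length T = dirsum (fun j : 'I_n => th j) (fun j => l j).
Proof.
move=> [_ _ ->] ch; apply/funext => w.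
by rewrite -(chain_of_range ch) (chain_proj_length n_gt0 ch.1).
Qed.

Definition equispaced_equilateral (th l : nat -> R) : Prop :=
  equispaced (fun j : 'I_n => th j) /\ forall i j : 'I_n, l i = l j.

Lemma equispaced_minimizes alpha A th l T : polygon_on alpha T ->
  chain_of alpha A th l -> equispaced_equilateral th l -> minimizes_delta n T.
Proof.
move=> pT ch [eq leq]; split; first by exists alpha.
move=> S [beta pS]; have [B [th' [l' ch']]] := polygon_chain pS.
have l0 (j : 'I_n) : 0 < l j by apply: chain_length_gt0 ch.1 j.
have l0' (j : 'I_n) : 0 < l' j by apply: chain_length_gt0 ch'.1 j.
rewrite (chain_of_proj_length pT ch) (chain_of_proj_length pS ch').
apply: (@delta_le _ _ _ (kappa R n)).
- exact: expect_dirsum_gt0.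
- exact: expect_dirsum_gt0.
- exact: equispaced_dirsum_second_moment.
- exact: dirsum_second_moment_ge.
Qed.

(** The polygon T0 shows that the bound [kappa] is attained, so that a minimizing polygon has
    to attain it, and [second_moment_eq] applies. *)
Lemma minimizes_equispaced T0 alpha0 A0 th0 l0 : polygon_on alpha0 T0 ->
  chain_of alpha0 A0 th0 l0 -> equispaced_equilateral th0 l0 ->
  forall T alpha A th l, polygon_on alpha T -> chain_of alpha A th l ->
  minimizes_delta n T -> equispaced_equilateral th l.
Proof.
move=> pT0 ch0 [eq0 leq0] T alpha A th l pT ch [_ min].
have := min T0 (ex_intro _ alpha0 pT0).
have lp (j : 'I_n) : 0 < l j by apply: chain_length_gt0 ch.1 j.
have lp0 (j : 'I_n) : 0 < l0 j by apply: chain_length_gt0 ch0.1 j.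
rewrite (chain_of_proj_length pT ch) (chain_of_proj_length pT0 ch0) => le.
apply: dirsum_second_moment_eq => //.
apply/eqP; rewrite eq_le; apply/andP; split; last exact: dirsum_second_moment_ge.
apply: delta_le_inv le; [exact: kappa_ge1|exact: expect_dirsum_gt0|
  exact: expect_dirsum_gt0|exact: equispaced_dirsum_second_moment].
Qed.

End Polygons.

(** * Intersections of discs *)

Section ComplexTopology.
Variable R : realType.
Implicit Types (K : set R[i]^o) (z p : R[i]).

Lemma closureCP K z : closure K z <->
  forall e : R, 0 < e -> exists y : R[i], K y /\ sqn (y - z) < e ^+ 2.
Proof.
split=> [cl e e0|h U].
  have : nbhs (z : R[i]^o) [set y : R[i] | sqn (y - z) < e ^+ 2].
    by apply/nbhsCP; exists e.
  by move=> /cl [y [Ky hy]]; exists y.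
by move=> /nbhsCP [e [e0 sub]]; have [y [Ky /sub Uy]] := h e e0; exists y.
Qed.

Lemma sqn_add_le z p (a b : R) : 0 <= a -> 0 <= b ->
  sqn z <= a ^+ 2 -> sqn p <= b ^+ 2 -> sqn (z + p) <= (a + b) ^+ 2.
Proof.
move=> a0 b0 hz hp; apply: sqn_le_dot; first exact: addr_ge0.
by move=> v; rewrite dotD lerD // dot_le.
Qed.

Lemma sqn_le_approx z (r : R) : 0 <= r ->
  (forall e : R, 0 < e -> sqn z <= (r + e) ^+ 2) -> sqn z <= r ^+ 2.
Proof.
move=> r0 h; apply: sqn_le_dot => // v; apply/ler_addgt0Pr => e e0.
by apply: dot_le (h e e0); rewrite addr_ge0 // ltW.
Qed.

Lemma bounded_closed_compactC K (M : R) :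
  (forall z, K z -> `|complex.Re z| <= M /\ `|complex.Im z| <= M) ->
  closed K -> compact K.
Proof.
move=> bd cl.
pose f : R * R -> R[i]^o := fun q => q.1 +i* q.2.
have cf : continuous f.
  move=> [a b] U /nbhsCP [e [e0 sub]].
  exists (ball a (e / 2), ball b (e / 2)) => /=.
    by split; apply: nbhsx_ballx; rewrite divr_gt0.
  move=> [x y] [/= hx hy]; apply: sub.
  move: hx hy; rewrite -!ball_normE /= /sqn /= => hx hy.
  have hx2 : (x - a) ^+ 2 < (e / 2) ^+ 2.
    by rewrite -real_normK ?num_real // distrC ltr_sqr ?nnegrE // divr_ge0 // ltW.
  have hy2 : (y - b) ^+ 2 < (e / 2) ^+ 2.
    by rewrite -real_normK ?num_real // distrC ltr_sqr ?nnegrE // divr_ge0 // ltW.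
  have : 0 < e ^+ 2 by rewrite exprn_gt0.
  move: hx2 hy2; rewrite expr_div_n; lra.
have cS : compact (f @` (`[- M, M] `*` `[- M, M])).
  apply: continuous_compact; first exact: continuous_subspaceT.
  by apply: compact_setX; exact: segment_compact.
apply: (subclosed_compact cl cS).
move=> z Kz; have [h1 h2] := bd z Kz; exists (complex.Re z, complex.Im z).
  by split; rewrite /= in_itv /= -ler_norml.
by rewrite /f /=; case: z {Kz h1 h2}.
Qed.

Lemma closure_disc_intersection (S : set R[i]) (r : R) : 0 <= r ->
  closure ([set z : R[i] | forall b, S b -> sqn (z - b) <= r ^+ 2] : set R[i]^o)
  `<=` [set z : R[i] | forall b, S b -> sqn (z - b) <= r ^+ 2].
Proof.
move=> r0 z /closureCP cl b Sb; apply: sqn_le_approx => // e e0.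
have [y [/= /(_ b Sb) hy hyz]] := cl e e0.
have -> : z - b = (y - b) + (z - y) by ring.
by apply: sqn_add_le => //; rewrite ?ltW // sqnC.
Qed.

Lemma compact_disc_intersection (S : set R[i]) (r : R) : 0 <= r -> S !=set0 ->
  compact ([set z : R[i] | forall b, S b -> sqn (z - b) <= r ^+ 2] : set R[i]^o).
Proof.
move=> r0 [b0 Sb0].
apply: (@bounded_closed_compactC _ (r + Num.sqrt (sqn b0))).
  have s0 := sqrtr_ge0 (sqn b0).
  move=> z /(_ b0 Sb0) hz.
  have hz' : sqn z <= (r + Num.sqrt (sqn b0)) ^+ 2.
    rewrite -{1}(subrK b0 z); apply: sqn_add_le => //.
    by rewrite sqr_sqrtr // sqn_ge0.
  have b x y : x ^+ 2 + y ^+ 2 <= (r + Num.sqrt (sqn b0)) ^+ 2 ->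
      `|x| <= r + Num.sqrt (sqn b0).
    move=> h; rewrite -ler_sqr ?nnegrE ?addr_ge0 //.
    by rewrite real_normK ?num_real //; have := sqr_ge0 y; lra.
  by split; [apply: b hz'|move: hz'; rewrite /sqn addrC; apply: b].
exact: closure_disc_intersection.
Qed.

Lemma continuous_Re : continuous (@complex.Re R : R[i]^o -> R).
Proof.
move=> z U /nbhs_ballP [e /= e0 sub]; apply/nbhsCP; exists e; split=> // y.
rewrite /sqn /= => hy; apply: sub; rewrite -ball_normE /= -ltr_sqr ?nnegrE ?(ltW e0) //.
rewrite real_normK ?num_real // -sqrrN opprB.
case: y z hy => [a b] [c d] /= hy; have := sqr_ge0 (b - d); lra.
Qed.

Lemma continuous_Im : continuous (@complex.Im R : R[i]^o -> R).
Proof.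
move=> z U /nbhs_ballP [e /= e0 sub]; apply/nbhsCP; exists e; split=> // y.
rewrite /sqn /= => hy; apply: sub; rewrite -ball_normE /= -ltr_sqr ?nnegrE ?(ltW e0) //.
rewrite real_normK ?num_real // -sqrrN opprB.
case: y z hy => [a b] [c d] /= hy; have := sqr_ge0 (a - c); lra.
Qed.

Lemma continuous_dot v : continuous (dot v : R[i]^o -> R).
Proof.
have cM (f : R[i]^o -> R) (c : R) : continuous f -> continuous (fun z : R[i]^o => f z * c).
  by move=> cf z; apply: continuousM; [exact: cf|exact: cst_continuous].
have cR := cM _ (cos v) continuous_Re; have cI := cM _ (sin v) continuous_Im.
by move=> z; exact: (@continuousD _ _ R[i]^o _ _ z (cR z) (cI z)).
Qed.

Lemma continuous_sqn p : continuous (fun z : R[i]^o => sqn (p - z)).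
Proof.
have -> : (fun z : R[i]^o => sqn (p - z)) = (fun z : R[i]^o =>
    (complex.Re p - complex.Re z) * (complex.Re p - complex.Re z)
    + (complex.Im p - complex.Im z) * (complex.Im p - complex.Im z)).
  by apply/funext => -[a b]; case: p => c d; rewrite /sqn /= !expr2.
have cR : continuous (fun z : R[i]^o => complex.Re p - complex.Re z).
  by move=> z; apply: continuousB; [exact: cst_continuous|exact: continuous_Re].
have cI : continuous (fun z : R[i]^o => complex.Im p - complex.Im z).
  by move=> z; apply: continuousB; [exact: cst_continuous|exact: continuous_Im].
by move=> z; exact: (@continuousD _ _ R[i]^o _ _ z
  (continuousM (cR z) (cR z)) (continuousM (cI z) (cI z))).
Qed.

(** The uniform margin r - rho matters, since S may be infinite. *)
Lemma disc_intersection_interior (S : set R[i]) (r rho : R) z : 0 <= rho -> rho < r ->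
  (forall b, S b -> sqn (z - b) <= rho ^+ 2) ->
  interior ([set z : R[i] | forall b, S b -> sqn (z - b) <= r ^+ 2] : set R[i]^o) z.
Proof.
move=> rho0 rhor h; apply/interiorCP; exists (r - rho); split; first by rewrite subr_gt0.
move=> y hy b Sb /=; have -> : y - b = (y - z) + (z - b) by ring.
have -> : r = (r - rho) + rho by ring.
apply: sqn_add_le => //; [by rewrite subr_ge0 ltW|exact: ltW|exact: h].
Qed.

(** Discs are uniformly strictly convex: by [sqn_convex] the point z stays away from all the
    circles of radius r by a margin which depends on x, y and t only. *)
Lemma chord_interior (S : set R[i]) (x y z : R[i]) (r t : R) : S !=set0 ->
  (forall b, S b -> sqn (x - b) <= r ^+ 2) ->
  (forall b, S b -> sqn (y - b) <= r ^+ 2) ->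
  0 <= r -> x <> y -> 0 < t < 1 -> z = t%:C * x + (1 - t)%:C * y ->
  interior ([set z : R[i] | forall b, S b -> sqn (z - b) <= r ^+ 2] : set R[i]^o) z.
Proof.
move=> [b0 Sb0] hx hy r0 xy /andP[t0 t1] ze.
have d0 : 0 < sqn (x - y).
  rewrite lt_neqAle sqn_ge0 andbT eq_sym; apply/negP => /eqP/sqn_eq0/eqP.
  by rewrite subr_eq0 => /eqP.
pose g := t * (1 - t) * sqn (x - y).
have g0 : 0 < g by rewrite /g mulr_gt0 // mulr_gt0 // subr_gt0.
have hz b : S b -> sqn (z - b) <= r ^+ 2 - g.
  move=> Sb; rewrite ze sqn_convex -/g.
  have h1 : t * sqn (x - b) <= t * r ^+ 2 by rewrite ler_wpM2l ?hx // ltW.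
  have h2 : (1 - t) * sqn (y - b) <= (1 - t) * r ^+ 2.
    by rewrite ler_wpM2l ?hy // subr_ge0 ltW.
  lra.
have m0 : 0 <= r ^+ 2 - g by apply: le_trans (hz b0 Sb0); exact: sqn_ge0.
apply: (@disc_intersection_interior _ _ (Num.sqrt (r ^+ 2 - g))).
- exact: sqrtr_ge0.
- rewrite -ltr_sqr ?nnegrE ?sqrtr_ge0 // sqr_sqrtr //; lra.
- by move=> b Sb; rewrite sqr_sqrtr //; exact: hz.
Qed.

End ComplexTopology.

(** On a circular arc, a linear function of direction t is locally maximal only at points
    whose radius is parallel to t. *)
Lemma cos_local_max (R : realType) (s t a b : R) : a < s < b ->
  (forall s', a < s' < b -> cos (s' - t) <= cos (s - t)) -> sin (s - t) = 0.
Proof.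
move=> /andP[sa sb] h.
have d (u : R) := is_derive_cos_shift t u.
have [_ e1] : is_derive s 1 (fun u => cos (u - t)) 0.
  apply: (@derive1_at_max _ (fun u => cos (u - t)) a b s) => [|u _||u].
  - by apply: ltW; exact: lt_trans sb.
  - by case: (d u).
  - by rewrite in_itv /= sa.
  - by rewrite in_itv /=; exact: h.
by have [_ e2] := d s; apply/eqP; rewrite -oppr_eq0 -e2 e1.
Qed.

(** * The Reuleaux body of a family of arcs *)

Section ReuleauxConstruction.
Variable R : realType.
Variables (n : nat) (alpha c : 'I_n -> R[i]) (v : 'I_n -> R) (d r : R).
Hypothesis n_gt0 : (0 < n)%N.
Hypothesis r_gt0 : 0 < r.
Hypothesis d_gt0 : 0 < d.
Hypothesis d_le : 4 * d <= pi.
Hypothesis alpha_start : forall j, alpha j = c j + r%:C * cis (v j - d).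
Hypothesis alpha_end : forall j, alpha (ordS j) = c j + r%:C * cis (v j + d).
Hypothesis c_vertex : forall j, exists k, c j = alpha k.
Hypothesis alpha_diam : forall j k, sqn (alpha j - alpha k) <= r ^+ 2.
Hypothesis normals_cover : forall x : R, exists j (m : int), v j - d <= x + m%:~R * pi <= v j + d.
Hypothesis normals_disjoint : forall j k, j <> k ->
  exists q : int, 2 * d <= v k - v j - q%:~R * pi <= pi - 2 * d.

Let pt j t : R[i] := c j + r%:C * cis t.
(** The arc j has its center at the vertex c j, the radius r, and the directions of its radii
    are those of [v j - d, v j + d]; it joins the vertices j and j + 1. The hypotheses on the
    normals say that each direction modulo pi occurs exactly once, up to endpoints. For a
    direction x on the arc j, all the arcs lie in the strip of width r between the two lines
    orthogonal to x through c j and through c j + r * cis x. So this union has diameter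
    r, and it is the boundary of the body of constant width formed by the points at distance
    at most r from all of it. *)
Definition arcs_union : set R[i] :=
  [set z | exists j t, v j - d <= t <= v j + d /\ z = c j + r%:C * cis t].
Let U := arcs_union.
Definition arcs_body : set R[i] := [set z | forall b, arcs_union b -> sqn (z - b) <= r ^+ 2].
Let B := arcs_body.

Let in_arc j t : v j - d <= t <= v j + d -> U (pt j t).
Proof. by move=> h; exists j, t. Qed.

Lemma alpha_arcs j : U (alpha j).
Proof. by exists j, (v j - d); split=> //; apply/andP; split; move: d_gt0; lra. Qed.

Let c_arcs j : U (c j).
Proof. by have [k ->] := c_vertex j; exact: alpha_arcs. Qed.

Let sin2d : 0 < sin (2 * d).
Proof. by apply: sin_gt0_pi; apply/andP; move: d_gt0 d_le (pi_gt0 R) => ? ? ?; split; lra. Qed.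

(** For x between the two extreme normals of the arc j both coefficients are nonnegative, so
    that an inequality in these two directions extends to the whole interval of normals. *)
Let normal_combination j x z :
  sin (2 * d) * dot x z
  = sin (v j + d - x) * dot (v j - d) z + sin (x - v j + d) * dot (v j + d) z.
Proof.
rewrite (_ : x - v j + d = x - (v j - d)); last by ring.
rewrite (_ : 2 * d = (v j + d) - (v j - d)); last by ring.
move: (v j + d) (v j - d) => p q; rewrite /dot !sinB.
by case: z => a b /=; ring.
Qed.

(** In the directions v j - d and v j + d, the vertices alpha j and alpha (j + 1) are at the
    height r above c j, and no vertex is more than r below them. *)
Let vertex_above_center j x k : v j - d <= x <= v j + d -> 0 <= dot x (alpha k - c j).
Proof.
move=> /andP[h1 h2]; have lo : 0 <= dot (v j - d) (alpha k - c j).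
  have := dot_le (v j - d) (ltW r_gt0) (alpha_diam j k).
  by rewrite alpha_start dotB dotD dotZ dot_cis subrr cos0 mulr1 dotB; lra.
have hi : 0 <= dot (v j + d) (alpha k - c j).
  have := dot_le (v j + d) (ltW r_gt0) (alpha_diam (ordS j) k).
  by rewrite alpha_end dotB dotD dotZ dot_cis subrr cos0 mulr1 dotB; lra.
rewrite -(pmulr_rge0 _ sin2d) (normal_combination j); move: d_le d_gt0 => ? ?.
by apply: addr_ge0; apply: mulr_ge0 => //; apply: sin_ge0_pi; apply/andP; split; lra.
Qed.

Let center_diam j k : sqn (alpha k - c j) <= r ^+ 2.
Proof. by have [i ->] := c_vertex j. Qed.

Let arc_strip j x b : v j - d <= x <= v j + d -> U b -> 0 <= dot x (b - c j) <= r.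
Proof.
move=> xj [k [t [tk ->]]]; have /andP[x1 x2] := xj; have /andP[t1 t2] := tk.
have vert i : 0 <= dot x (alpha i - c j) <= r.
  by rewrite vertex_above_center //= dot_le // ltW.
have [jk|jk] := pselect (j = k).
  subst k; rewrite addrAC subrr add0r dotZ dot_cis; move: d_gt0 d_le => ? ?.
  have c0 : 0 <= cos (t - x) by apply: cos_ge0_pihalf; apply/andP; split; lra.
  by rewrite mulr_ge0 ?(ltW r_gt0) //= ger_pMr // cos_le1.
have [q /andP[q1 q2]] := normals_disjoint jk.
have sgn y : v k - d <= y <= v k + d -> 0 <= sin (y - x - q%:~R * pi).
  by move=> /andP[? ?]; apply: sin_ge0_pi; apply/andP; split; lra.
have /andP[a1 a2] := vert k; have /andP[b1 b2] := vert (ordS k).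
rewrite alpha_start in a1 a2; rewrite alpha_end in b1 b2.
move: a1 a2 b1 b2; rewrite ![_ + _ - c j]addrAC !dotD !dotZ !dot_cis.
(* The directions of the arc k differ from x by an angle in [q * pi, (q + 1) * pi], where cos is
   monotone; so the values of [dot x] on the arc k lie between those at its endpoints. *)
have diff1 : cos (t - x) - cos (v k - d - x) =
  - 2 * sin ((t + (v k - d)) / 2 - x) * sin ((t - (v k - d)) / 2).
  rewrite (_ : t - x = ((t + (v k - d)) / 2 - x) + (t - (v k - d)) / 2); last by lra.
  rewrite (_ : v k - d - x = ((t + (v k - d)) / 2 - x) - (t - (v k - d)) / 2); last by lra.
  by move: (_ - x) => y; rewrite cosB cosD; ring.
have diff2 : cos (v k + d - x) - cos (t - x) =
  - 2 * sin ((t + (v k + d)) / 2 - x) * sin ((v k + d - t) / 2).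
  rewrite (_ : t - x = ((t + (v k + d)) / 2 - x) - (v k + d - t) / 2); last by lra.
  rewrite (_ : v k + d - x = ((t + (v k + d)) / 2 - x) + (v k + d - t) / 2); last by lra.
  by move: (_ - x) => y; rewrite cosB cosD; ring.
have s1 : 0 <= sin ((t - (v k - d)) / 2).
  by apply: sin_ge0_pi; move: d_gt0 d_le => ? ?; apply/andP; split; lra.
have s2 : 0 <= sin ((v k + d - t) / 2).
  by apply: sin_ge0_pi; move: d_gt0 d_le => ? ?; apply/andP; split; lra.
have g1 : 0 <= sin ((t + (v k - d)) / 2 - x - q%:~R * pi).
  by apply: sgn; apply/andP; split; lra.
have g2 : 0 <= sin ((t + (v k + d)) / 2 - x - q%:~R * pi).
  by apply: sgn; apply/andP; split; lra.
have sq (y : R) : sin y = (-1) ^+ `|q|%N * sin (y - q%:~R * pi).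
  by rewrite -{1}(subrK (q%:~R * pi) y) sinDkpi.
rewrite (sq ((t + (v k - d)) / 2 - x)) in diff1.
rewrite (sq ((t + (v k + d)) / 2 - x)) in diff2.
rewrite -signr_odd in diff1 diff2.
move: diff1 diff2; case: (odd _); rewrite ?expr1 ?expr0 => diff1 diff2 a1 a2 b1 b2.
  have le1 : cos (v k - d - x) <= cos (t - x) by rewrite -subr_ge0 diff1; nra.
  have le2 : cos (t - x) <= cos (v k + d - x) by rewrite -subr_ge0 diff2; nra.
  by apply/andP; split; nra.
have le1 : cos (t - x) <= cos (v k - d - x) by rewrite -subr_le0 diff1; nra.
have le2 : cos (v k + d - x) <= cos (t - x) by rewrite -subr_le0 diff2; nra.
by apply/andP; split; nra.
Qed.

Let arcs_diam a b : U a -> U b -> sqn (a - b) <= r ^+ 2.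
Proof.
move=> Ua Ub; apply: sqn_le_dot; first exact: ltW.
move=> x; have [j [m xj]] := normals_cover x.
have /andP[a1 a2] := arc_strip xj Ua; have /andP[b1 b2] := arc_strip xj Ub.
move: a1 a2 b1 b2; rewrite !dotDkpi !dotB -signr_odd.
by case: (odd _); rewrite ?expr1 ?expr0; lra.
Qed.

Let arcs_sub_body : U `<=` B.
Proof. by move=> a Ua b Ub; exact: arcs_diam. Qed.

Let body_strip j x z : v j - d <= x <= v j + d -> B z -> 0 <= dot x (z - c j) <= r.
Proof.
move=> xj Bz; apply/andP; split; last by apply: dot_le; [exact: ltW|exact/Bz/c_arcs].
have := dot_le (x + pi) (ltW r_gt0) (Bz _ (in_arc xj)).
by rewrite dotDpi /pt !dotB dotD dotZ dot_cis subrr cos0 mulr1; lra.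
Qed.

Lemma arcs_body_width w : proj_length B w = r.
Proof.
have [j [m xj]] := normals_cover (w + pi / 2).
set x := w + pi / 2 + m%:~R * pi in xj.
have E z : dot x z = (-1) ^+ odd `|m|%N * coproj w z.
  by rewrite signr_odd dotDkpi coprojE.
have Bc : B (c j) by apply/arcs_sub_body/c_arcs.
have Bq : B (pt j x) by apply/arcs_sub_body/in_arc.
have Eq : dot x (pt j x) = dot x (c j) + r by rewrite /pt dotD dotZ dot_cis subrr cos0 mulr1.
have strip z : B z -> (-1) ^+ odd `|m|%N * coproj w (c j) <= (-1) ^+ odd `|m|%N * coproj w z
    <= (-1) ^+ odd `|m|%N * coproj w (c j) + r.
  by move=> /(body_strip xj); rewrite dotB -!E; lra.
move: strip Eq; rewrite !E; case: (odd _); rewrite ?expr1 ?expr0 => strip Eq.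
  rewrite (@proj_length_attained _ B w (c j) (pt j x)) //; first by lra.
  by move=> z /strip; lra.
rewrite (@proj_length_attained _ B w (pt j x) (c j)) //; first by lra.
by move=> z /strip; lra.
Qed.

Let B_convex : convex B.
Proof.
apply/convexCP => x y t Bx By t01 b Ub.
have /convexCP cD := @convex_disc R b r.
by apply: cD => //; [exact: Bx|exact: By].
Qed.

Let j0 : 'I_n := Ordinal n_gt0.

Let U_nonempty : U !=set0.
Proof. by exists (alpha j0); exact: alpha_arcs. Qed.

Let B_compact : compact (B : set R[i]^o).
Proof. by apply: compact_disc_intersection; [exact: ltW|exact: U_nonempty]. Qed.

Let alpha_neq_c : alpha j0 <> c j0.
Proof.
rewrite alpha_start => e; have : sqn (c j0 + r%:C * cis (v j0 - d) - c j0) = 0.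
  by rewrite e subrr sqn0.
rewrite addrAC subrr add0r sqnZ sqn_cis mulr1 => /eqP.
by rewrite sqrf_eq0 gt_eqF.
Qed.

Let B_interior : interior (B : set R[i]^o) !=set0.
Proof.
exists ((2^-1)%:C * alpha j0 + (1 - 2^-1)%:C * c j0).
apply: (@chord_interior R U (alpha j0) (c j0) _ r (2^-1)) => //.
- by move=> b; apply/arcs_sub_body/alpha_arcs.
- by move=> b; apply/arcs_sub_body/c_arcs.
- exact: ltW.
- by apply/andP; split; lra.
Qed.

Let B_convex_body : convex_body B.
Proof. by split; [exact: B_compact|exact: B_convex|exact: B_interior]. Qed.

(** Compactness of an arc. *)
Let farthest_on_arc j z : exists t, v j - d <= t <= v j + d /\
  forall u, v j - d <= u <= v j + d -> sqn (z - pt j u) <= sqn (z - pt j t).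
Proof.
have dd : v j - d <= v j + d by move: d_gt0; lra.
pose f u := sqn (z - c j) + r ^+ 2 - 2 * r * dot u (z - c j).
have fE u : sqn (z - pt j u) = f u.
  rewrite /f /pt opprD addrA; case: (z - c j) => a b.
  rewrite /sqn /dot /=; have := cos2Dsin2 u; move: (cos u) (sin u) => C S e.
  transitivity (a ^+ 2 + b ^+ 2 + r ^+ 2 * (C ^+ 2 + S ^+ 2) - 2 * r * (a * C + b * S)).
    ring.
  by rewrite e mulr1.
have df (u : R) : derivable f u 1.
  have di : is_derive u 1 f (0 - 2 * r * (complex.Re (z - c j) * - sin u
     + complex.Im (z - c j) * cos u)).
    by rewrite /f /dot; apply: is_derive_eq; rewrite /GRing.scale /=; ring.
  by case: di.
have cf : {within `[v j - d, v j + d], continuous f}.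
  by apply: derivable_within_continuous => u _; exact: df.
have [t + tmax] := EVT_max dd cf; rewrite in_itv /= => tj.
by exists t; split=> // u uj; rewrite !fE; apply: tmax; rewrite in_itv.
Qed.

(** If all the distances from z to the arcs were less than r, compactness would leave a
    margin and z would be an interior point. A point b of the arcs at distance r from z has
    a strip of width r in the direction of b - z, with z and b on its two edges, where the
    strip meets the body in c j and in one point of the arc j only. *)
Let boundary_sub z : B z -> ~ interior (B : set R[i]^o) z -> U z.
Proof.
move=> Bz nint.
have [b [Ub /eqP]] : exists b, U b /\ sqn (z - b) = r ^+ 2.
  apply: contrapT => none; apply: nint.
  have lt b : U b -> sqn (z - b) < r ^+ 2.
    move=> Ub; rewrite lt_neqAle Bz // andbT; apply/negP => /eqP e.
    by apply: none; exists b.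
  have /choice[t tP] : forall j, exists t, v j - d <= t <= v j + d /\
    forall u, v j - d <= u <= v j + d -> sqn (z - pt j u) <= sqn (z - pt j t).
    by move=> j; exact: farthest_on_arc.
  have [jm _ jmax] := @arg_maxP _ _ _ j0 xpredT (fun j => sqn (z - pt j (t j))) isT.
  apply: (@disc_intersection_interior _ _ _ (Num.sqrt (sqn (z - pt jm (t jm))))).
  - exact: sqrtr_ge0.
  - rewrite -ltr_sqr ?nnegrE ?sqrtr_ge0 ?(ltW r_gt0) // sqr_sqrtr ?sqn_ge0 //.
    by apply/lt/in_arc; exact: (tP jm).1.
  - move=> b [j [u [uj ->]]]; rewrite sqr_sqrtr ?sqn_ge0 //.
    by apply: le_trans ((tP j).2 u uj) _; exact: jmax.
move=> /eqP sqE; have [x zbE] := sqn_polar (ltW r_gt0) sqE.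
have [j [m xj]] := normals_cover x; set x' := x + m%:~R * pi in xj.
have dE : dot x' (z - b) = (-1) ^+ `|m|%N * r.
  by rewrite dotDkpi zbE dotZ dot_cis subrr cos0 mulr1.
have /andP[b0 _] := arc_strip xj Ub; have /andP[z0 _] := body_strip xj Bz.
move: dE b0 z0; rewrite -signr_odd; case: (odd _);
  rewrite ?expr1 ?expr0 ?mul1r ?mulN1r !dotB => dE b0 z0.
  have bc : b - c j = r%:C * cis x'.
    by apply: dot_eq; [exact: ltW|exact/arcs_diam/c_arcs|rewrite dotB; lra].
  have bz : b - z = r%:C * cis x'.
    by apply: dot_eq; [exact: ltW|rewrite sqnC sqE|rewrite dotB; lra].
  have -> : z = c j by apply/eqP; rewrite -(inj_eq (subrI b)) bz bc.
  exact: c_arcs.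
have zc : z - c j = r%:C * cis x'.
  by apply: dot_eq; [exact: ltW|exact/Bz/c_arcs|rewrite dotB; lra].
have -> : z = pt j x' by rewrite /pt -zc addrC subrK.
exact: in_arc.
Qed.

(** Moving outward from a point of an arc increases its distance to the center beyond r. *)
Let arcs_not_interior z : U z -> ~ interior (B : set R[i]^o) z.
Proof.
move=> [j [t [tj ->]]] /interiorCP [e [e0 h]].
have := h (c j + (r + e / 2)%:C * cis t).
have -> : c j + (r + e / 2)%:C * cis t - (c j + r%:C * cis t) = (e / 2)%:C * cis t.
  by rewrite rmorphD /=; ring.
rewrite sqnZ sqn_cis mulr1 => /(_ _) /(_ (c j) (c_arcs j)).
rewrite addrAC subrr add0r sqnZ sqn_cis mulr1.
rewrite leNgt => H; apply: (negP (H _)); last first.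
  by rewrite ltr_sqr ?nnegrE; move: r_gt0; lra.
by rewrite ltr_sqr ?nnegrE; lra.
Qed.

Lemma arcs_boundary : boundary (B : set R[i]^o) = U.
Proof.
apply/seteqP; split=> [z [cl nint]|z Uz].
  by apply: boundary_sub => //; exact: (closure_disc_intersection (ltW r_gt0)).
by split; [exact/subset_closure/arcs_sub_body|exact: arcs_not_interior].
Qed.

Let arc_lt j : v j - d < v j + d.
Proof. by move: d_gt0; lra. Qed.

Let arc_turn j : v j + d <= v j - d + 2 * pi.
Proof. by move: d_gt0 d_le; lra. Qed.

Definition arc_of j : circle_arc R := CircleArc (c j) (arc_lt j) (arc_turn j).

Let B_boundary : boundary B = \bigcup_(k in setT) arc_set r (arc_of k).
Proof.
rewrite arcs_boundary; apply/seteqP; split=> [z [j [t [tj ->]]]|z [j _ [t]]].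
  by exists j => //; exists t => //=; rewrite in_itv.
by rewrite /= in_itv /= => tj <-; exact: in_arc.
Qed.

Let B_centers k : boundary B (arc_center (arc_of k)).
Proof. by rewrite arcs_boundary; exact: c_arcs. Qed.

Let B_chain k : arc_end r (arc_of k) = arc_start r (arc_of (ordS k)).
Proof. by rewrite /arc_end /arc_start /arc_point /= -alpha_end -alpha_start. Qed.

Let B_non_overlapping j k : j != k ->
  arc_relint r (arc_of j) `&` arc_relint r (arc_of k) = set0.
Proof.
move=> /eqP jk; apply/seteqP; split=> // z [[s + sE] [t + tE]].
rewrite /= !in_itv /= => /andP[s1 s2] /andP[t1 t2].
have tk : v k - d <= t <= v k + d by rewrite !ltW.
have sin0 : sin (s - t) = 0.
  apply: (@cos_local_max R s t (v j - d) (v j + d)) => [|s' /andP[h1 h2]]; first by rewrite s1.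
  have /andP[_] := arc_strip tk (@in_arc j s' ltac:(rewrite !ltW //)).
  have : dot t (z - c k) = r by rewrite -tE /arc_point addrAC subrr add0r dotZ dot_cis subrr cos0 mulr1.
  rewrite -sE /arc_point /pt /= !dotB !dotD !dotZ !dot_cis => e1 e2.
  by rewrite -(ler_pM2l r_gt0); lra.
have [q /andP[q1 q2]] := normals_disjoint jk.
have : 0 < sin (t - s - q%:~R * pi) by apply: sin_gt0_pi; apply/andP; split; lra.
suff -> : sin (t - s - q%:~R * pi) = 0 by rewrite ltxx.
by rewrite -mulNr -rmorphN sinDkpi -opprB sinN sin0 oppr0 mulr0.
Qed.

Definition arcs_reuleaux : reuleaux_body R :=
  ReuleauxBody B_convex_body arcs_body_width B_boundary B_centers B_chain B_non_overlapping.

Lemma arcs_reuleaux_spec : range alpha `<=` boundary arcs_reuleaux /\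
  essential_endpoints arcs_reuleaux `<=` range alpha.
Proof.
split=> [_ [j _ <-]|_ [k _ <-]].
  by rewrite /= arcs_boundary; exact: alpha_arcs.
by rewrite /arc_end /arc_point /= -alpha_end; exists (ordS k).
Qed.

End ReuleauxConstruction.

(** * Equispaced polygons are Reinhardt polygons *)

Lemma modn_window (n i j : nat) : (j < n)%N -> (j <= i < j + n)%N -> (i %% n)%N = j -> i = j.
Proof.
move=> jn /andP[ji ijn]; have [lt_in|ge_in] := ltnP i n; first by rewrite modn_small.
by rewrite -(subnK ge_in) modnDr modn_small; lia.
Qed.

Lemma residue_unique (n x y : nat) (z : int) : (x < n)%N -> (y < n)%N ->
  x%:Z = y%:Z + z * n%:Z -> x = y.
Proof.
move=> xn yn e.
have [z0|z0|z0] := ltgtP z 0; last by rewrite z0 in e; lia.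
  have : (z + 1) * n%:Z <= 0 by rewrite mulr_le0_ge0; lia.
  by rewrite mulrDl mul1r; lia.
have : 0 <= (z - 1) * n%:Z by rewrite mulr_ge0; lia.
by rewrite mulrBl mul1r; lia.
Qed.

Section EquispacedIsReinhardt.
Variable R : realType.
Variables (n : nat) (alpha : 'I_n -> R[i]) (A : nat -> R[i]) (th l : nat -> R).
Variable T : set R[i].
Hypothesis n_gt1 : (1 < n)%N.
Hypothesis pT : polygon_on alpha T.
Hypothesis ch : chain_of alpha A th l.
Variables (a : R) (p : 'I_n -> 'I_n) (k : 'I_n -> int).
Hypothesis p_inj : injective p.
Hypothesis thE : forall j : 'I_n, th j = a + (p j)%:R * (pi / n%:R) + (k j)%:~R * pi.
Hypothesis l_eq : forall i j : 'I_n, l i = l j.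

Let h0 : R := pi / n%:R.
Let d : R := h0 / 2.
Let n_gt0 : (0 < n)%N. Proof. exact: ltn_trans n_gt1. Qed.
Let l0 : R := l (Ordinal n_gt0).
Let r : R := l0 / (2 * sin d).
Let nR_gt0 : 0 < n%:R :> R. Proof. by rewrite ltr0n. Qed.
Let h0_gt0 : 0 < h0. Proof. by rewrite divr_gt0 ?pi_gt0. Qed.
Let nh0 : n%:R * h0 = pi. Proof. by rewrite mulrC divfK // lt0r_neq0. Qed.
Let h0_le : 2 * h0 <= pi.
Proof. by rewrite -nh0 ler_wpM2r ?(ltW h0_gt0) // (ler_nat R 2 n). Qed.
Let d_gt0 : 0 < d. Proof. by rewrite /d; move: h0_gt0; lra. Qed.
Let d_le : 4 * d <= pi. Proof. by rewrite /d; move: h0_le; lra. Qed.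
Let sind_gt0 : 0 < sin d.
Proof. by apply: sin_gt0_pi; move: d_gt0 d_le => ? ?; apply/andP; split; lra. Qed.
Let l0_gt0 : 0 < l0. Proof. exact: chain_length_gt0 ch.1 _. Qed.
Let r_gt0 : 0 < r. Proof. by rewrite divr_gt0 // mulr_gt0. Qed.
Let rE : r * (2 * sin d) = l0. Proof. by rewrite divfK // lt0r_neq0 // mulr_gt0. Qed.

Let s m := a + m%:R * h0.
Let equi m : (m < n)%N -> s m = s 0%N + m%:R * h0 /\ (fun=> l0) m = (fun=> l0) 0%N.
Proof. by rewrite /s mul0r addr0. Qed.

Let width w := (\sum_(i < n) l i * `|sin (w - th i)|) / 2.

Let widthE : width = sinsum n s (fun=> l0).
Proof. by apply: (equispaced_dirsumE p_inj thE) => j; exact: l_eq. Qed.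

Let width_le w : width w <= r.
Proof. by rewrite widthE; apply: (equispaced_sinsum_le n_gt1 equi); exact: ltW. Qed.

Let o i := Ordinal (ltn_pmod i n_gt0).
Let Ao i : A i = alpha (o i).
Proof. by rewrite -ch.2 {1}(divn_eq i n) addnC (chain_periodM ch.1). Qed.

Let diamA i j : sqn (A i - A j) <= r ^+ 2.
Proof.
apply: sqn_le_dot => [|x]; first exact: ltW.
rewrite coproj_dot coprojB; apply: le_trans (width_le (x - pi / 2)).
exact: (chain_le n_gt0 ch.1).
Qed.

Let alpha_diam i j : sqn (alpha i - alpha j) <= r ^+ 2.
Proof. by rewrite -!ch.2; exact: diamA. Qed.

Let lattice i : exists K : int, th i = a + (p (o i))%:R * h0 + K%:~R * pi.
Proof.
exists (k (o i) + 2%:Z * (i %/ n)%:Z).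
have -> : th i = th (o i) + (i %/ n)%:R * (2 * pi).
  rewrite {1}(divn_eq i n) /= addnC; move: (i %% n)%N (i %/ n)%N => x y.
  elim: y => [|y IH]; first by rewrite mul0n addn0 mul0r addr0.
  by rewrite mulSn addnCA addnC (chain_angle_period ch.1) IH -natr1; ring.
by rewrite thE intrD intrM -/h0 /=; ring.
Qed.

(** All the angles lie on a coset of the multiples of h0, so that strict inequalities between
    them leave a margin of h0. *)
Let mesh i : exists N : int, th i = a + N%:~R * h0.
Proof.
have [K ->] := lattice i; exists ((p (o i))%:Z + K * n%:Z).
by rewrite intrD intrM /= -nh0; ring.
Qed.

Let mesh_lt (M : int) i j : th i < th j + M%:~R * pi -> th i <= th j + M%:~R * pi - h0.
Proof.
have [N ->] := mesh i; have [N' ->] := mesh j.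
have -> : a + N'%:~R * h0 + M%:~R * pi = a + (N' + M * n%:Z)%:~R * h0.
  by rewrite intrD intrM /= -nh0; ring.
rewrite -addrA -[X in _ <= _ + (_ - X)]mul1r -mulrBl !(ltrD2l, lerD2l).
rewrite ltr_pM2r // ler_pM2r // ltr_int => lt.
have -> : (N' + M * n%:Z)%:~R - 1 = (N' + M * n%:Z - 1)%:~R :> R by rewrite [RHS]intrB.
rewrite ler_int; lia.
Qed.

Let mesh_inj i j (K : int) : th i = th j + K%:~R * pi -> o i = o j.
Proof.
have [K1 ->] := lattice i; have [K2 ->] := lattice j => e.
have {}e : (p (o i))%:R * h0 = ((p (o j))%:Z + (K2 + K - K1) * n%:Z)%:~R * h0.
  have -> : ((p (o j))%:Z + (K2 + K - K1) * n%:Z)%:~R * h0 =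
      (p (o j))%:R * h0 + (K2 + K - K1)%:~R * pi.
    by rewrite intrD intrM /= -nh0; ring.
  by rewrite intrB intrD; lra.
have {}e : (p (o i))%:Z = (p (o j))%:Z + (K2 + K - K1) * n%:Z.
  by apply/(@intr_inj R); apply: (mulIf (lt0r_neq0 h0_gt0)); rewrite -e.
apply: p_inj; apply: val_inj => /=.
exact: residue_unique e.
Qed.

(** Modulo pi, th j - d is the midpoint of a piece of the width function, where the sinusoid
    has its maximum r. *)
Let width_mid (j : 'I_n) : width (th j - d) = r.
Proof.
have [i [q [ltin e]]] : exists i (q : int), (i < n)%N /\
    th j - d = (s 0%N + i%:R * h0 + h0 / 2) + q%:~R * pi.
  have [p0|p0] := posnP (p j).
    exists n.-1, (k j - 1); split; first by rewrite prednK.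
    by rewrite thE p0 /s /d intrB -subn1 natrB // [in RHS]mulrBl nh0 -/h0; lra.
  exists (p j).-1, (k j); split; first by apply: leq_ltn_trans (leq_pred _) (ltn_ord _).
  by rewrite thE /s /d -subn1 natrB // -/h0; lra.
have -> : width (th j - d) = width (s 0%N + i%:R * h0 + h0 / 2).
  rewrite /width e; congr (_ / 2); apply: eq_bigr => m _.
  by rewrite addrAC normr_sinDkpi.
rewrite widthE (equispaced_sinsum n_gt1 equi ltin); last first.
  by rewrite -/h0 -(natr1 i); move: h0_gt0 => ?; apply/andP; split; lra.
by rewrite -/h0 subrr cos0 mulr1.
Qed.

Definition opposite_center (j : 'I_n) : R[i] := alpha j - r%:C * cis (th j - pi / 2 - d).
Let c := opposite_center.
Let v (j : 'I_n) := th j - pi / 2.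

Let alpha_start j : alpha j = c j + r%:C * cis (v j - d).
Proof. by rewrite subrK. Qed.

(** The edge j is a chord of length 2 * r * sin d, by the choice of r. *)
Let alpha_end j : alpha (ordS j) = c j + r%:C * cis (v j + d).
Proof.
have -> : alpha (ordS j) = alpha j + edge alpha j by rewrite addrC subrK.
rewrite (chain_of_edge j ch) (l_eq j (Ordinal n_gt0)) -/l0 -rE.
rewrite (alpha_start j) -addrA; congr (_ + _).
have -> : th j = v j + pi / 2 by rewrite subrK.
move: (v j) => x; apply/eqP; rewrite eq_complex /= cosDpihalf sinDpihalf.
by rewrite !(cosB, sinB, cosD, sinD) !mul0r; apply/andP; split; apply/eqP; ring.
Qed.

(** By [width_mid] some vertex lies at the height r above the vertex j, along the axis
    orthogonal to the direction th j - d; as the diameter is r, it can only be the point c j. *)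
Let c_vertex j : exists i, c j = alpha i.
Proof.
have ex : exists i, th j + pi <= th i.
  exists (j + n)%N; rewrite (chain_angle_period ch.1); have := pi_gt0 R; lra.
pose e := ex_minn ex.
have [eP emin] : th j + pi <= th e /\ forall i, th j + pi <= th i -> (e <= i)%N.
  by rewrite /e; case: ex_minnP.
have je : (j <= e)%N.
  rewrite leqNgt; apply/negP => /ltnW/(chain_mono ch.1).
  by have := pi_gt0 R; lra.
have ejn : (e <= j + n)%N by apply: emin; rewrite (chain_angle_period ch.1); have := pi_gt0 R; lra.
have W : coproj (th j - d) (A e) - coproj (th j - d) (A j) = r.
  rewrite -(width_mid j); apply: (chain_width ch.1); first by rewrite je.
    move=> i /andP[ji ie]; have m := chain_mono ch.1 ji.
    have lt : th i < th j + pi by rewrite ltNge; apply/negP => /emin; rewrite leqNgt ie.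
    have := @mesh_lt 1 i j; rewrite mul1r => /(_ lt) le.
    by move: d_gt0; rewrite /d => ?; apply/andP; split; lra.
  move=> i /andP[ei ijn]; have m := chain_mono ch.1 ei.
  have m' := chain_mono ch.1 (ltnW ijn); rewrite (chain_angle_period ch.1) in m'.
  have lt : th i < th j + 2 * pi.
    rewrite lt_neqAle m' andbT; apply/negP => /eqP thi.
    have /(congr1 val)/= := @mesh_inj i j 2 thi; rewrite [RHS]modn_small // => ij.
    have ie : i = j :> nat.
      by apply: (modn_window (ltn_ord j)); rewrite // (leq_trans je ei).
    by move: eP m; rewrite ie; have := pi_gt0 R; lra.
  have := @mesh_lt 2 i j lt => le.
  by move: d_gt0; rewrite /d => ?; apply/andP; split; lra.
exists (o e); rewrite -Ao.
have E : A e - A j = r%:C * cis (th j - d + pi / 2).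
  apply: dot_eq; [exact: ltW|exact: diamA|].
  by rewrite -W -coprojB coprojE.
rewrite /c /opposite_center -ch.2 -[A e](subrK (A j)) E [RHS]addrC; congr (_ + _).
have -> : th j - d + pi / 2 = (th j - pi / 2 - d) + pi by lra.
by rewrite (cisD _ pi) cispi mulrN1 mulrN.
Qed.

Let normals_cover (x : R) : exists j (m : int), v j - d <= x + m%:~R * pi <= v j + d.
Proof.
pose u := (x - (a - pi / 2)) / h0 + 2^-1.
have /andP[f1 f2] := floor_itv u.
set N := Num.floor u in f1 f2.
have nz : n%:Z != 0 by rewrite eqz_nat -lt0n.
have m0 := modz_ge0 N nz; have mlt := ltz_pmod N (n_gt0 : 0 < n%:Z).
have [i [q [ltin NE]]] : exists i (q : int), (i < n)%N /\ N = i%:Z + q * n%:Z.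
  exists `|(N %% n)%Z|%N, (N %/ n)%Z; split; first by lia.
  by rewrite gez0_abs // addrC -divz_eq.
pose j := invF p_inj (Ordinal ltin).
have pj : p j = i :> nat by rewrite /j f_invF.
exists j, (k j - q).
have xe : x = a - pi / 2 + (u - 2^-1) * h0 by rewrite /u addrK divfK ?lt0r_neq0 // addrC subrK.
have vE : v j = a - pi / 2 + (N%:~R - q%:~R * n%:R) * h0 + (k j)%:~R * pi.
  by rewrite /v thE pj NE intrD intrM /= -/h0; ring.
have qn : q%:~R * n%:R * h0 = q%:~R * pi by rewrite -mulrA nh0.
have g1 : N%:~R * h0 <= u * h0 by rewrite ler_pM2r.
have g2 : u * h0 <= (N%:~R + 1) * h0 by rewrite ler_pM2r // ltW // -(intrD _ N 1).
by rewrite vE xe /d intrB; apply/andP; split; lra.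
Qed.

Let normals_disjoint (i j : 'I_n) : i <> j ->
  exists q : int, 2 * d <= v j - v i - q%:~R * pi <= pi - 2 * d.
Proof.
move=> ij; have pij : p i != p j :> nat.
  by apply/negP => /eqP/val_inj/p_inj.
have le_mesh (x : nat) : (0 < x < n)%N -> 2 * d <= x%:R * h0 <= pi - 2 * d.
  move=> /andP[x0 xn]; rewrite /d -nh0.
  have g1 : 1 * h0 <= x%:R * h0 by rewrite ler_pM2r // ler1n.
  have g2 : (x%:R + 1) * h0 <= n%:R * h0 by rewrite ler_pM2r // natr1 ler_nat.
  by apply/andP; split; lra.
have [lt|ge] := ltnP (p i) (p j).
  exists (k j - k i).
  have /le_mesh : (0 < p j - p i < n)%N by have := ltn_ord (p j); lia.
  by rewrite natrB ?(ltnW lt) // /v !thE -/h0 intrB; lra.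
exists (k j - k i - 1).
have /le_mesh : (0 < n + p j - p i < n)%N by have := ltn_ord (p i); lia.
rewrite natrB; last by have := ltn_ord (p i); lia.
by rewrite natrD /v !thE -/h0 !intrB -nh0; lra.
Qed.

(** The vertices are extreme since each of them lies on a circle of radius r whose disc
    contains the polygon. *)
Lemma equispaced_reinhardt : reinhardt n T.
Proof.
exists alpha; split=> //.
- move=> j; have [_ _ TE] := pT.
  have Tdisc z : T z -> sqn (z - c j) <= r ^+ 2.
    rewrite TE; have sub : convex_hull (range alpha) `<=` [set z | sqn (z - c j) <= r ^+ 2].
      apply: convex_hull_sub; first exact: convex_disc.
      by move=> _ [i _ <-] /=; have [m ->] := c_vertex j; exact: alpha_diam.
    exact: sub.
  split; first by rewrite TE; apply: sub_convex_hull; exists j.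
  move=> x y t Tx Ty /andP[t0 t1] ze.
  have sz : sqn (alpha j - c j) = r ^+ 2.
    by rewrite {1}(alpha_start j) addrAC subrr add0r sqnZ sqn_cis mulr1.
  have xy : x = y.
    apply/eqP; rewrite -subr_eq0; apply/eqP/sqn_eq0/eqP.
    rewrite eq_le sqn_ge0 andbT.
    have := sqn_convex x y (c j) t; rewrite -ze sz.
    have h1 : t * sqn (x - c j) <= t * r ^+ 2 by rewrite ler_wpM2l ?Tdisc // ltW.
    have h2 : (1 - t) * sqn (y - c j) <= (1 - t) * r ^+ 2.
      by rewrite ler_wpM2l ?Tdisc // subr_ge0 ltW.
    move=> e; rewrite -(pmulr_rle0 _ (_ : 0 < t * (1 - t))); first by lra.
    by rewrite mulr_gt0 // subr_gt0.
  have zy : alpha j = y by rewrite ze xy -mulrDl -rmorphD addrC subrK mul1r.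
  by rewrite xy zy.
- by move=> i j; rewrite !(chain_of_edge_norm _ ch) (l_eq i j).
- exists (arcs_reuleaux n_gt0 r_gt0 d_gt0 d_le alpha_start alpha_end c_vertex
    alpha_diam normals_cover normals_disjoint).
  exact: arcs_reuleaux_spec.
Qed.

End EquispacedIsReinhardt.

(** * Signed sums of powers of a root of -1 *)

Section PowersOfTwo.
Variable F : numFieldType.

Definition eval_int (P : {poly int}) (z : F) : F := (map_poly intr P).[z].

Let evalM (P Q : {poly int}) (x : F) : eval_int (P * Q) x = eval_int P x * eval_int Q x.
Proof. by rewrite /eval_int rmorphM hornerM. Qed.

Let evalB (P Q : {poly int}) (x : F) : eval_int (P - Q) x = eval_int P x - eval_int Q x.
Proof. by rewrite /eval_int rmorphB hornerD hornerN. Qed.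

Let evalX (x : F) : eval_int 'X x = x.
Proof. by rewrite /eval_int map_polyX hornerX. Qed.

Let eval1 (x : F) : eval_int 1 x = 1.
Proof. by rewrite /eval_int rmorph1 hornerC. Qed.

Let evalXn m (x : F) : eval_int 'X^m x = x ^+ m.
Proof. by rewrite /eval_int map_polyXn hornerXn. Qed.

Let evalC (c : int) (x : F) : eval_int c%:P x = c%:~R.
Proof. by rewrite /eval_int map_polyC hornerC. Qed.

Let even_odd_eval (P : {poly int}) (x : F) : eval_int P x
  = eval_int (even_poly P) (x ^+ 2) + eval_int (odd_poly P) (x ^+ 2) * x.
Proof.
rewrite /eval_int -{1}(poly_even_odd P) rmorphD rmorphM /= !map_comp_poly map_polyXn map_polyX.
by rewrite !hornerE !horner_comp !hornerE.
Qed.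

Let even_odd_eval1 (P : {poly int}) : P.[1] = (even_poly P).[1] + (odd_poly P).[1].
Proof. by rewrite -{1}(poly_even_odd P) !hornerE !horner_comp !hornerE expr1n. Qed.

(** Descent on k. If P vanishes at z, with E and O the even and odd parts of P, then
    E ^+ 2 - 'X * O ^+ 2, the polynomial of P(x) * P(-x) in terms of x ^+ 2, vanishes at z ^+ 2; its value
    at 1 has the parity of P.[1]. For k = 0, z = -1 and P.[1] has the parity of P.[-1] = 0. *)
Lemma eval_int_parity (k : nat) (z : F) (P : {poly int}) :
  z ^+ (2 ^ k) = -1 -> eval_int P z = 0 -> exists w : int, P.[1] = 2 * w.
Proof.
elim: k z P => [|k IH] z P zk; rewrite even_odd_eval even_odd_eval1;
  set E := even_poly P; set O := odd_poly P => P0.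
  move: P0; rewrite -[z]expr1 zk sqrrN expr1n mulrN1.
  have ev1 Q : eval_int Q 1 = (Q.[1])%:~R.
    by rewrite /eval_int -[X in _.[X]](rmorph1 intr) horner_map.
  rewrite !ev1 => /eqP; rewrite subr_eq0 => /eqP/intr_inj eo.
  by exists O.[1]; rewrite eo; ring.
have [||w] := IH (z ^+ 2) (E ^+ 2 - 'X * O ^+ 2).
- by rewrite -exprM -expnS.
- rewrite !expr2 evalB !evalM evalX -expr2.
  have : eval_int E (z ^+ 2) = - (eval_int O (z ^+ 2) * z).
    by apply/eqP; rewrite -addr_eq0 P0.
  by move=> ->; ring.
rewrite !hornerE; move: E.[1] O.[1] => x y e.
have e2 : (x + y) ^+ 2 = 2 * (w + (x + y) * y) by rewrite mulrDr -e; ring.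
exists ((x + y) %/ 2)%Z; have := divz_eq (x + y) 2.
have := modz_ge0 (x + y) (isT : 2 != 0 :> int); have := ltz_pmod (x + y) (isT : 0 < 2 :> int).
move: e2; move: (x + y) (_ %/ 2)%Z (_ %% 2)%Z => s u t e2 t2 t0 st.
have [t00|t1] : t = 0 \/ t = 1 by lia.
  by rewrite st t00; ring.
exfalso; move: e2; rewrite st t1 => e2.
have : 1 = 2 * (w + (u * 2 + 1) * y - 2 * u * u - 2 * u) by rewrite mulrBr mulrBr -e2; ring.
move: (w + _ - _ - _) => ?; lia.
Qed.

(** Write the signs as 1 - 2 * b m. As (1 - z) times the sum of the z ^+ m is 2, the vanishing of
    the signed sum would make the integer polynomial 1 - (1 - 'X) * B, where B is the sum of
    the 'X^m with b m true, vanish at z; but its value at 1 is odd. *)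
Lemma signed_power_sum_neq0 (k : nat) (z : F) (b : nat -> bool) :
  z ^+ (2 ^ k) = -1 -> \sum_(m < 2 ^ k) (-1) ^+ b m * z ^+ m != 0.
Proof.
move=> zk; apply/negP => /eqP s0.
pose B : {poly int} := \sum_(m < 2 ^ k) (b m)%:R *: 'X^m.
pose P : {poly int} := 1 - (1 - 'X) * B.
have BE : eval_int B z = \sum_(m < 2 ^ k) (b m)%:R * z ^+ m.
  rewrite /eval_int rmorph_sum horner_sum; apply: eq_bigr => m _.
  by rewrite -mul_polyC -/(eval_int _ _) evalM evalXn evalC; case: (b m).
have geom : (1 - z) * \sum_(m < 2 ^ k) z ^+ m = 2.
  by rewrite -[LHS]opprK -mulNr opprB -subrX1 zk; ring.
have PE : eval_int P z = 1 - (1 - z) * eval_int B z.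
  by rewrite /P evalB evalM evalB evalX eval1.
have half : \sum_(m < 2 ^ k) (-1) ^+ b m * z ^+ m
    = \sum_(m < 2 ^ k) z ^+ m - 2 * eval_int B z.
  rewrite BE mulr_sumr -sumrB; apply: eq_bigr => m _.
  by case: (b m) => /=; rewrite ?expr1 ?expr0; ring.
have P0 : eval_int P z = 0.
  rewrite PE; apply/eqP; rewrite -(mulrI_eq0 _ (mulfI (_ : 2 != 0 :> F))) ?pnatr_eq0 //.
  rewrite mulrBr mulr1 mulrCA -{1}geom -mulrBr -half s0 mulr0 //.
have [w] := eval_int_parity zk P0.
rewrite /P hornerD hornerN hornerM hornerD hornerN hornerC hornerX subrr mul0r subr0; lia.
Qed.

End PowersOfTwo.

(** * Equispaced polygons and powers of two *)

Section SignConditions.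
Variable R : realType.

Lemma cisX (x : R) m : cis x ^+ m = cis (m%:R * x).
Proof.
elim: m => [|m IH]; first by rewrite mul0r cis0.
by rewrite exprS IH -cisD -natr1 mulrDl mul1r addrC.
Qed.

Lemma cisDkpi (x : R) (k : int) : cis (x + k%:~R * pi) = (-1) ^+ `|k|%N * cis x.
Proof.
rewrite /cis sinDkpi cosDkpi -signr_odd -[in RHS]signr_odd.
case: (odd _); rewrite [nat_of_bool _]/=; last by rewrite !expr0 !mul1r.
by rewrite !expr1 !mulN1r.
Qed.

(** A polygon closes up: its edges, all of the same length, add up to 0. Up to a rotation their
    directions are the powers z ^+ m, m < n, of z = cis (pi / n), with signs, and z ^+ n = -1. *)
Lemma equispaced_not_pow2 n (alpha : 'I_n -> R[i]) A th l : (1 < n)%N ->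
  chain_of alpha A th l -> equispaced_equilateral n th l -> ~ exists k, n = (2 ^ k)%N.
Proof.
move=> n_gt1 [ch _] [[a [p [k [p_inj thE]]]] l_eq] [K nK].
have n_gt0 : (0 < n)%N by exact: ltn_trans n_gt1.
pose l0 := l (Ordinal n_gt0).
have l0_neq0 : l0%:C != 0 by rewrite eq_complex /= eqxx andbT lt0r_neq0 // (chain_length_gt0 ch).
have closed : \sum_(j < n) (l j)%:C * cis (th j) = 0.
  have : \sum_(0 <= j < n) (A j.+1 - A j) = A n - A 0%N by rewrite telescope_sumr.
  rewrite -[n in A n]add0n (chain_period ch) subrr big_mkord => E; rewrite -[RHS]E.
  by apply: eq_bigr => j _; rewrite (chain_step ch) addrAC subrr add0r.
pose z : R[i] := cis (pi / n%:R).
have zn : z ^+ n = -1.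
  by rewrite /z cisX mulrC divfK ?cispi // pnatr_eq0 -lt0n.
pose b m := odd `|k (invF p_inj (Ordinal (ltn_pmod m n_gt0)))|%N.
have S0 : \sum_(m < n) (-1) ^+ b m * z ^+ m = 0.
  apply: (mulfI l0_neq0); rewrite mulr0.
  have a0 : cis a != 0.
    by apply/eqP => e; have := sqn_cis a; rewrite e sqn0 => /eqP; rewrite eq_sym oner_eq0.
  apply: (mulfI a0); rewrite mulr0 -[RHS]closed [in LHS](reindex_inj p_inj) /= !mulr_sumr.
  apply: eq_bigr => j _; rewrite thE (l_eq j (Ordinal n_gt0)) cisDkpi cisD -cisX -/z -/l0.
  have -> : b (p j) = odd `|k j|%N.
    congr (odd `|k _|%N); apply: (canLR (invF_f p_inj)).
    by apply: val_inj; rewrite /= modn_small.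
  by rewrite signr_odd; ring.
subst n; move: S0 => /eqP; apply/negP.
by have := signed_power_sum_neq0 b zn.
Qed.

End SignConditions.

(** * Construction of equispaced polygons *)

Section BlockPolygon.
Variable R : realType.
Variables (m q : nat).
Hypothesis m_odd : odd m.
Hypothesis m_gt1 : (1 < m)%N.
Hypothesis q_gt0 : (0 < q)%N.

Let n := (m * q)%N.
Let n_gt1 : (1 < n)%N. Proof. by rewrite /n; nia. Qed.
Let n_gt0 : (0 < n)%N. Proof. exact: ltn_trans n_gt1. Qed.
Let nR_gt0 : 0 < n%:R :> R. Proof. by rewrite ltr0n. Qed.
Let h0 : R := pi / n%:R.
Let h0_gt0 : 0 < h0. Proof. by rewrite divr_gt0 ?pi_gt0. Qed.
Let nh0 : n%:R * h0 = pi. Proof. by rewrite mulrC divfK // lt0r_neq0. Qed.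

(** The directions of the edges, in units of pi / n: each block of q consecutive directions is
    followed by a gap of q directions, so that q more edges turn the direction by 2 * q. The
    rotation by that angle permutes the edges, which forces their sum to vanish, and since
    m is odd the blocks of one half turn fall into the gaps of the other half, which makes
    the directions distinct modulo n. *)
Definition block_dir (i : nat) : nat := i + q * (i %/ q).
Let th (i : nat) : R := (block_dir i)%:R * h0.
Let A (i : nat) : R[i] := \sum_(0 <= j < i) cis (th j).

Let block_dirDq i : block_dir (i + q) = (block_dir i + 2 * q)%N.
Proof. by rewrite /block_dir divnDr // divnn q_gt0 mulnDr muln1; ring. Qed.

Let block_dirDn i : block_dir (i + n) = (block_dir i + 2 * n)%N.
Proof.
rewrite /n; elim: (m) i => [|k IH] i; first by rewrite mul0n muln0 !addn0.
by rewrite mulSn addnA IH block_dirDq; ring.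
Qed.

Let block_dir_lt i : (block_dir i < block_dir i.+1)%N.
Proof.
rewrite /block_dir addSn ltnS leq_add2l leq_mul2l; apply/orP; right.
exact: leq_div2r.
Qed.

Let th_period i : th (i + n)%N = th i + 2 * pi.
Proof. by rewrite /th block_dirDn natrD mulrDl natrM -mulrA nh0. Qed.

Let th_lt i : th i < th i.+1.
Proof. by rewrite /th ltr_pM2r // ltr_nat. Qed.

Let omega : R[i] := cis ((2 * q)%:R * h0).

Let omega_neq1 : omega != 1.
Proof.
rewrite eq_complex /= negb_and; apply/orP; right.
have qh : (2 * q)%:R * h0 = 2 / m%:R * pi.
  have q0 : q%:R != 0 :> R by rewrite pnatr_eq0 -lt0n.
  have m0 : m%:R != 0 :> R by rewrite pnatr_eq0 -lt0n ltnW.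
  rewrite /h0 /n !natrM; move: pi q%:R m%:R q0 m0 => x y z y0 z0; field; by rewrite y0 z0.
have m_ge3 : (3 <= m)%N by case: m m_odd m_gt1 => [|[|[|]]].
have m0 : 0 < m%:R :> R by rewrite ltr0n ltnW.
rewrite gt_eqF // sin_gt0_pi // qh mulr_gt0 ?divr_gt0 ?pi_gt0 //=.
by rewrite gtr_pMl ?pi_gt0 // ltr_pdivrMr // mul1r ltr_nat.
Qed.

(** The sum is invariant under the rotation omega, which differs from 1. *)
Let closed : \sum_(i < n) cis (th i) = 0.
Proof.
set S := \sum_(i < n) _.
have per i : cis (th (i + n)%N) = cis (th i).
  by rewrite th_period -[2 * pi]mul1r; exact: (cisDk2pi_nat (th i) 1).
have : omega * S = S.
  rewrite {2}/S -(@sum_period _ n (fun i => cis (th i)) q per) addnC -{1}[q]add0n big_addn addnK.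
  rewrite big_mkord mulr_sumr; apply: eq_bigr => i _.
  by rewrite /th block_dirDq natrD mulrDl cisD mulrC.
move/eqP; rewrite -subr_eq0 -{2}[S]mul1r -mulrBl mulf_eq0 subr_eq0 (negbTE omega_neq1) /=.
by move/eqP.
Qed.

Let chain : closed_chain n A th (fun=> 1).
Proof.
split=> // i.
- rewrite /A (big_cat_nat (n := i)) ?leq_addr //= addrC -[RHS]add0r; congr (_ + _).
  rewrite sum_period // => j; rewrite th_period -[2 * pi]mul1r.
  exact: (cisDk2pi_nat (th j) 1).
- exact: ltW.
- by rewrite /A big_nat_recr //= mul1r.
Qed.

Let th_mono_lt i j : (i < j)%N -> th i < th j.
Proof. by move=> ij; apply: lt_le_trans (th_lt i) (chain_mono chain ij). Qed.

(** The edges of a path turning by less than pi all have a positive component in the middle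
    direction. *)
Let A_neq i j : (i < j)%N -> th j.-1 - th i < pi -> A i <> A j.
Proof.
move=> ij lt e; pose w := (th i + th j.-1) / 2 - pi / 2.
have := chain_coproj chain w (ltnW ij); rewrite e subrr => /esym/eqP.
rewrite gt_eqF // big_ltn //; have j0 : j.-1.+1 = j by rewrite prednK //; apply: leq_trans ij.
have le_th k : (i <= k < j)%N -> 0 < sin (th k - w).
  move=> /andP[ik kj]; have m1 := chain_mono chain ik.
  have kj1 : (k <= j.-1)%N by rewrite -ltnS j0.
  have m2 := chain_mono chain kj1.
  by apply: sin_gt0_pi; rewrite /w; apply/andP; split; lra.
rewrite mul1r ltr_pwDl ?le_th ?leqnn // big_seq sumr_ge0 // => k.
rewrite mem_index_iota => /andP[ik kj]; rewrite mul1r ltW // le_th // kj ltnW //.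
Qed.

Let alpha (j : 'I_n) : R[i] := A j.

(** One of the two paths between two vertices turns by less than pi. *)
Let alpha_inj : injective alpha.
Proof.
move=> i j; wlog ij : i j / (i < j)%N.
  move=> wl e; apply: val_inj; have [lt|lt|//] := ltngtP i j.
    by have := wl i j lt e; move=> ->.
  by have := wl j i lt (esym e); move=> ->.
move=> e; exfalso.
have [lt|ge] := ltP (th j.-1 - th i) pi; first exact: (A_neq ij lt).
have jn : (j < i + n)%N by apply: leq_trans (ltn_ord j) _; exact: leq_addl.
apply: (A_neq jn); last by rewrite (chain_period chain).
have -> : (i + n).-1 = (i + n.-1)%N by rewrite -subn1 -[in RHS]subn1 addnBA.
have h1 : th (i + n.-1)%N < th i + 2 * pi.
  by rewrite -th_period; apply: th_mono_lt; rewrite ltn_add2l prednK.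
have h2 : th j.-1 < th j by apply: th_mono_lt; rewrite prednK //; apply: leq_trans ij.
lra.
Qed.

Let chain_of_alpha : chain_of alpha A th (fun=> 1). Proof. by split. Qed.

Let T := convex_hull (range alpha).

Let pT : polygon_on alpha T.
Proof.
split=> //; exists th; split=> [j|j _|].
- rewrite (chain_of_edge_norm j chain_of_alpha) (chain_of_edge j chain_of_alpha).
  by [].
- exact: ltW.
- by rewrite -th_period add0n; apply: (chain_mono chain); rewrite leq_pred.
Qed.

Let equi : equispaced_equilateral n th (fun=> 1).
Proof.
split=> //.
exists 0, (fun j => Ordinal (ltn_pmod (block_dir j) n_gt0)),
  (fun j => (block_dir j %/ n)%:Z); split; last first.
  move=> j /=; rewrite add0r /th {1}(divn_eq (block_dir j) n) natrD natrM mulrDl addrC.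
  by rewrite -mulrA nh0.
move=> i j /(congr1 val) /= e; apply: val_inj => /=.
have dirE x : block_dir x = (x %/ q * 2 * q + x %% q)%N.
  by rewrite /block_dir {1}(divn_eq x q); ring.
have er : (i %% q = j %% q)%N.
  have modq x : (block_dir x %% n %% q = x %% q)%N.
    by rewrite modn_dvdm ?dvdn_mull // dirE modnMDl modn_mod.
  by rewrite -modq e modq.
move/eqP: e; rewrite !dirE er eqn_modDr /n -!muln_modl eqn_pmul2r //.
have lt (x : 'I_n) : (x %/ q < m)%N by rewrite ltn_divLR // ltn_ord.
move: (lt i) (lt j) => li lj e.
suff es : (i %/ q = j %/ q)%N by rewrite (divn_eq i q) (divn_eq j q) er es.
move: e li lj; move: (i %/ q)%N (j %/ q)%N => x y.
wlog xy : x y / (x <= y)%N.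
  move=> wl e xm ym; have [le|/ltnW le] := leqP x y; first exact: wl.
  by apply/esym/wl => //; rewrite eq_sym.
move=> e xm ym; move: e; rewrite eq_sym eqn_mod_dvd ?leq_mul2r ?xy ?orbT //.
rewrite -mulnBl Gauss_dvdl ?coprimen2 // => /dvdnP[[|k] yx]; first by lia.
by nia.
Qed.

Lemma block_polygon : exists (alpha : 'I_(m * q) -> R[i]) (T : set R[i]) A th l,
  [/\ polygon_on alpha T, chain_of alpha A th l & equispaced_equilateral (m * q) th l].
Proof. by exists alpha, T, A, th, (fun=> 1); split; [exact: pT|exact: chain_of_alpha|exact: equi]. Qed.

End BlockPolygon.

Lemma odd_factor n : (0 < n)%N -> ~ (exists k, n = (2 ^ k)%N) ->
  exists m q, [/\ odd m, (1 < m)%N, (0 < q)%N & n = (m * q)%N].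
Proof.
move=> n0 np; exists (n`_2^')%N, (n`_2)%N; split.
- by rewrite odd_2'nat part_pnat.
- rewrite ltn_neqAle part_gt0 andbT eq_sym; apply/negP => /eqP e.
  by apply: np; exists (logn 2 n); rewrite -p_part -[LHS](partnC 2%N n0) e muln1.
- exact: part_gt0.
- by rewrite mulnC partnC.
Qed.

Lemma exists_equispaced (R : realType) n : (0 < n)%N -> ~ (exists k, n = (2 ^ k)%N) ->
  exists (alpha : 'I_n -> R[i]) (T : set R[i]) A th l,
  [/\ polygon_on alpha T, chain_of alpha A th l & equispaced_equilateral n th l].
Proof.
by move=> n0 /(odd_factor n0)[m [q [mo m1 q0 ->]]]; exact: block_polygon.
Qed.

(** * Bodies of constant width *)

Section ConstantWidth.
Variable R : realType.
Implicit Types (v w : R) (x y z p q a b : R[i]).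
Variables (K : set R[i]) (r : R).
Hypothesis K_body : convex_body K.
Hypothesis K_width : forall w, proj_length K w = r.

Let K_compact : compact (K : set R[i]^o). Proof. by case: K_body. Qed.
Let K_convex : convex K. Proof. by case: K_body. Qed.

Lemma body_nonempty : K !=set0.
Proof. by case: K_body => _ _ [z /interior_subset Kz]; exists z. Qed.

Lemma body_support v : exists a, K a /\ forall z, K z -> dot v z <= dot v a.
Proof.
have [||a Ka amax] := @compact_EVT_max R[i]^o R (dot v) (K : set R[i]^o) _ K_compact.
- exact: body_nonempty.
- exact/continuous_subspaceT/continuous_dot.
exists a; split; first by rewrite inE in Ka.
by move=> z Kz; apply: amax; rewrite inE.
Qed.

Lemma body_width v : exists a b, [/\ K a, K b, dot v a - dot v b = r &
  forall z, K z -> dot v b <= dot v z <= dot v a].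
Proof.
have [a [Ka amax]] := body_support v; have [b [Kb bmax]] := body_support (v + pi).
have bmin z : K z -> dot v b <= dot v z.
  by move=> /bmax; rewrite !dotDpi lerN2.
exists a, b; split=> //; last by move=> z Kz; rewrite bmin ?amax.
rewrite -(K_width (v - pi / 2)) !coproj_dot.
by apply/esym/proj_length_attained => // z Kz; rewrite -!coproj_dot bmin ?amax.
Qed.

Lemma width_ge0 : 0 <= r.
Proof.
by have [a [b [Ka Kb <- h]]] := body_width 0; have /andP[+ _] := h a Ka; rewrite subr_ge0.
Qed.

Lemma body_diam x y : K x -> K y -> sqn (x - y) <= r ^+ 2.
Proof.
move=> Kx Ky; apply: sqn_le_dot => [|v]; first exact: width_ge0.
have [a [b [Ka Kb <- h]]] := body_width v; rewrite dotB.
by have /andP[_ ?] := h x Kx; have /andP[? _] := h y Ky; lra.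
Qed.

Lemma width_gt0 : 0 < r.
Proof.
rewrite lt_neqAle width_ge0 andbT eq_sym; apply/negP => /eqP r0.
case: K_body => _ _ [z /interiorCP [e [e0 sub]]].
have Kz : K z by apply: sub; rewrite subrr sqn0 exprn_gt0.
have Kz' : K (z + (e / 2)%:C * cis 0).
  by apply: sub; rewrite addrAC subrr add0r sqnZ sqn_cis mulr1 ltr_sqr ?nnegrE; lra.
have := body_diam Kz' Kz; rewrite addrAC subrr add0r sqnZ sqn_cis mulr1 r0 expr0n /=.
by rewrite leNgt exprn_gt0 // divr_gt0.
Qed.

(** Let p be the point of K nearest to q, and v the direction from p to q. The line through p
    orthogonal to v supports K, so some point b of K lies at the depth r below p in the
    direction v; if q were not p, its distance to b would exceed r. *)
Lemma body_complete q : (forall b, K b -> sqn (q - b) <= r ^+ 2) -> K q.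
Proof.
move=> hq.
have [||p Kp' pmin] := @compact_EVT_min R[i]^o R (fun z : R[i]^o => sqn (q - z)) (K : set R[i]^o) _ K_compact.
- exact: body_nonempty.
- exact/continuous_subspaceT/continuous_sqn.
have Kp : K p by rewrite inE in Kp'.
have {}pmin z : K z -> sqn (q - p) <= sqn (q - z) by move=> Kz; apply: pmin; rewrite inE.
have [v qpE] := polar (q - p); set rho := Num.sqrt _ in qpE.
have rho0 : 0 <= rho by exact: sqrtr_ge0.
have [rho_eq0|rho_neq0] := eqVneq rho 0.
  by move: qpE; rewrite rho_eq0 mul0r => /eqP; rewrite subr_eq0 => /eqP ->.
have rho_gt0 : 0 < rho by rewrite lt_neqAle eq_sym rho_neq0.
have pmax z : K z -> dot v z <= dot v p.
  move=> Kz; rewrite leNgt; apply/negP => lt.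
  pose g := dot v (z - p); have g0 : 0 < g by rewrite /g dotB subr_gt0.
  pose S := sqn (z - p); have S0 : 0 <= S by exact: sqn_ge0.
  pose t := Num.min 1 (rho * g / (S + 1)).
  have t0 : 0 < t by rewrite lt_min ltr01 divr_gt0 ?mulr_gt0 //; lra.
  have t1 : t <= 1 by rewrite ge_min lexx.
  have tS : t * (S + 1) <= rho * g.
    by rewrite -ler_pdivlMr ?ge_min ?lexx ?orbT //; lra.
  have /convexCP cK := K_convex.
  have Ky : K (t%:C * z + (1 - t)%:C * p) by apply: cK => //; rewrite ltW.
  have := pmin _ Ky; rewrite leNgt => /negP; apply.
  have -> : q - (t%:C * z + (1 - t)%:C * p) = (q - p) - t%:C * (z - p).
    by rewrite rmorphB /=; ring.
  have -> : sqn (q - p - t%:C * (z - p))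
      = sqn (q - p) - 2 * t * (rho * g) + t ^+ 2 * S.
    rewrite qpE /g /S; case: (z - p) => a b.
    by rewrite /sqn /dot /=; ring.
  have : t * (t * (S + 1)) <= t * (rho * g) by rewrite ler_wpM2l // ltW.
  have : 0 < t * (rho * g) by rewrite !mulr_gt0.
  have : 0 <= t ^+ 2 by exact: sqr_ge0.
  lra.
have [a [b [Ka Kb ab h]]] := body_width v.
have := dot_le v width_ge0 (hq b Kb).
have -> : q - b = (q - p) + (p - b) by ring.
rewrite dotD {1}qpE dotZ dot_cis subrr cos0 mulr1 dotB.
by have := pmax a Ka; lra.
Qed.

Lemma body_disc_intersection : K = [set z | forall b, K b -> sqn (z - b) <= r ^+ 2].
Proof.
apply/seteqP; split=> [z Kz b Kb|z]; first exact: body_diam.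
exact: body_complete.
Qed.

Lemma boundary_sub_body z : boundary K z -> K z.
Proof.
move=> [cl _]; rewrite body_disc_intersection.
by apply: closure_disc_intersection; [exact: width_ge0|rewrite -body_disc_intersection].
Qed.

Lemma body_chord_interior x y z t : K x -> K y -> x <> y -> 0 < t < 1 ->
  z = t%:C * x + (1 - t)%:C * y -> ~ boundary K z.
Proof.
move=> Kx Ky xy t01 zE [_]; apply; rewrite body_disc_intersection.
apply: (chord_interior body_nonempty _ _ width_ge0 xy t01 zE) => b Kb;
  exact: body_diam.
Qed.

Lemma support_boundary v a : K a -> (forall z, K z -> dot v z <= dot v a) -> boundary K a.
Proof.
move=> Ka amax; split; first exact: subset_closure.
move=> /interiorCP [e [e0 sub]].
have := amax (a + (e / 2)%:C * cis v).
rewrite dotD dotZ dot_cis subrr cos0 mulr1 => /(_ _)/negP; rewrite gerDl => h.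
have : K (a + (e / 2)%:C * cis v).
  by apply: sub; rewrite addrAC subrr add0r sqnZ sqn_cis mulr1 ltr_sqr ?nnegrE; lra.
by move/amax; rewrite dotD dotZ dot_cis subrr cos0 mulr1; lra.
Qed.

(** Of three points of a line one lies between the two others, hence in the interior of the
    body by [body_chord_interior]. *)
Lemma boundary_line v (p q z : R[i]) : boundary K p -> boundary K q -> boundary K z -> p <> q ->
  dot v p = dot v z -> dot v q = dot v z -> z = p \/ z = q.
Proof.
pose y (u : R[i]) := dot (v + pi / 2) u.
have between (a b c : R[i]) : boundary K a -> boundary K b -> boundary K c ->
    dot v a = dot v b -> dot v c = dot v b -> y a < y b -> y b < y c -> False.
  move=> Ba Bb Bc ab cb yab ybc.
  pose t := (y c - y b) / (y c - y a).
  have ac : 0 < y c - y a by rewrite subr_gt0; exact: lt_trans ybc.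
  apply: (@body_chord_interior a c b t) => //; try exact: boundary_sub_body.
  - by move=> e; move: ac; rewrite e subrr ltxx.
  - apply/andP; split; first by rewrite divr_gt0 // subr_gt0.
    by rewrite /t ltr_pdivrMr // mul1r; lra.
  apply: (@dot_inj R v); rewrite dotD !dotZ; first by rewrite ab cb; ring.
  rewrite -/(y a) -/(y b) -/(y c) /t; field; exact: lt0r_neq0.
move=> Bp Bq Bz pq ep eq.
have [e1|n1] := eqVneq (y z) (y p); first by left; apply: (dot_inj (esym ep) e1).
have [e2|n2] := eqVneq (y z) (y q); first by right; apply: (dot_inj (esym eq) e2).
have n3 : y p != y q.
  by apply/eqP => e; apply: pq; apply: (@dot_inj R v) => //; rewrite ep eq.
exfalso; move: n1 n2 n3; rewrite !neq_lt => /orP[a1|a1] /orP[a2|a2] /orP[a3|a3].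
- by apply: (between z p q); rewrite // ?ep ?eq.
- by apply: (between z q p); rewrite // ?ep ?eq.
- by have := lt_trans a2 (lt_trans a1 a3); rewrite ltxx.
- by apply: (between q z p); rewrite // ?ep ?eq.
- by apply: (between p z q); rewrite // ?ep ?eq.
- by have := lt_trans a1 (lt_trans a2 a3); rewrite ltxx.
- by apply: (between p q z); rewrite // ?ep ?eq.
- by apply: (between q p z); rewrite // ?ep ?eq.
Qed.

End ConstantWidth.

(** * The arcs of a Reuleaux body *)

Section ReuleauxArcs.
Variable R : realType.
Variable B : reuleaux_body R.

Let K := rb_set B.
Let r := rb_width B.
Let m := rb_size B.
Let arc (k : 'I_m) := rb_arc k.
Let K_body : convex_body K := rb_convex_body B.
Let K_width : forall w, proj_length K w = r := rb_constant_width B.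
Let r_gt0 : 0 < r := width_gt0 K_body K_width.
Let ess := essential_endpoints B.

Definition on_arc (k : 'I_(rb_size B)) (t : R) : R[i] :=
  arc_point (rb_width B) (rb_arc k) t.

Let arc_boundary k t : arc_from (arc k) <= t <= arc_to (arc k) -> boundary K (on_arc k t).
Proof. by move=> h; rewrite /K rb_boundary; exists k => //; exists t => //=; rewrite in_itv. Qed.

Let arc_in_body k t : arc_from (arc k) <= t <= arc_to (arc k) -> K (on_arc k t).
Proof. by move/arc_boundary; apply: (boundary_sub_body K_body K_width). Qed.

Let above_center k t z : arc_from (arc k) <= t <= arc_to (arc k) -> K z ->
  0 <= dot t (z - arc_center (arc k)).
Proof.
move=> tk Kz; have := body_diam K_body K_width (arc_in_body tk) Kz.
move=> /(dot_le t (ltW r_gt0)).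
by rewrite /on_arc /arc_point -/(arc k) -/r !dotB dotD dotZ dot_cis subrr cos0 mulr1; lra.
Qed.

(** The body has a corner at the center of an arc, where all the directions opposite to those
    of the arc support it. On a circular arc passing through that point, each supporting
    direction would have to be orthogonal to the arc, which leaves only one line. *)
Lemma center_not_smooth k c' s a b : arc_center (arc k) = c' + r%:C * cis s ->
  a < s < b -> (forall u, a < u < b -> K (c' + r%:C * cis u)) -> False.
Proof.
move=> ck sab sub.
have sin0 t : arc_from (arc k) <= t <= arc_to (arc k) -> sin (s - t) = 0.
  move=> tk; apply/eqP; rewrite -oppr_eq0; apply/eqP.
  rewrite (_ : - sin (s - t) = sin (s - (t + pi))); last first.
    by rewrite opprD addrA (sinB _ pi) cospi sinpi; ring.
  apply: (@cos_local_max R s (t + pi) a b) => // u uab.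
  have := above_center tk (sub u uab).
  rewrite ck opprD addrACA subrr add0r dotB !dotZ !dot_cis -mulrBr pmulr_rge0 // subr_ge0.
  by rewrite (opprD t pi) !addrA (cosB (u - t) pi) (cosB (s - t) pi) cospi sinpi; lra.
have lt := arc_from_lt_to (arc k); have turn := arc_to_le_turn (arc k).
pose t1 := arc_from (arc k); pose t2 := t1 + (arc_to (arc k) - t1) / 3.
have s1 : sin (s - t1) = 0 by apply: sin0; rewrite lexx ltW.
have s2 : sin (s - t2) = 0 by apply: sin0; rewrite /t2 /t1; apply/andP; split; lra.
have : 0 < sin (t2 - t1).
  by apply: sin_gt0_pi; rewrite /t2 /t1; have := pi_gt0 R => ?; apply/andP; split; lra.
rewrite (_ : t2 - t1 = (s - t1) - (s - t2)); last by ring.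
by rewrite sinB s1 s2 mul0r mulr0 subrr ltxx.
Qed.

Let same_circle j k t : arc_center (arc j) = arc_center (arc k) ->
  on_arc j (arc_to (arc j)) = on_arc k (arc_from (arc k)) ->
  on_arc j (arc_to (arc j) + t) = on_arc k (arc_from (arc k) + t).
Proof.
rewrite /on_arc /arc_point -/(arc j) -/(arc k) => -> /addrI.
have r0 : (rb_width B)%:C != 0 by rewrite eq_complex /= eqxx andbT lt0r_neq0.
by move/(mulfI r0); rewrite !cisD => ->.
Qed.

Let arc_joint k : on_arc k (arc_to (arc k)) = on_arc (ordS k) (arc_from (arc (ordS k))).
Proof. exact: rb_chain. Qed.

Let center_essential_end j k : arc_center (arc k) = on_arc j (arc_to (arc j)) ->
  ess (arc_center (arc k)).
Proof.
move=> ckE; have [eqc|neqc] := pselect (arc_center (arc j) = arc_center (arc (ordS j))).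
  exfalso; have lt := arc_from_lt_to (arc j); have lt' := arc_from_lt_to (arc (ordS j)).
  apply: (@center_not_smooth k (arc_center (arc j)) (arc_to (arc j)) (arc_from (arc j))
    (arc_to (arc j) + (arc_to (arc (ordS j)) - arc_from (arc (ordS j))))) => //.
    by rewrite lt /= ltrDl subr_gt0.
  move=> u /andP[u1 u2]; have [le|/ltW le] := leP u (arc_to (arc j)).
    by apply: arc_in_body; rewrite ltW.
  have -> : arc_center (arc j) + r%:C * cis u = on_arc j (arc_to (arc j) + (u - arc_to (arc j))).
    by rewrite addrCA subrr addr0.
  rewrite (same_circle _ eqc (arc_joint j)); apply: arc_in_body.
  by apply/andP; split; lra.
by exists j.
Qed.

(** The center lies on the boundary, hence on some arc. By [center_not_smooth] it is neither
    inside that arc nor an endpoint at which the circle continues along the next arc. *)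
Lemma center_essential k : ess (arc_center (arc k)).
Proof.
have : (\bigcup_(j in setT) arc_set r (arc j)) (arc_center (arc k)).
  by rewrite -rb_boundary; exact: rb_centers.
move=> [j _ [s + sE]]; rewrite /= in_itv /= => /andP[s1 s2].
have [e2|n2] := eqVneq s (arc_to (arc j)).
  by apply: (@center_essential_end j); rewrite -sE e2.
have [e1|n1] := eqVneq s (arc_from (arc j)).
  apply: (@center_essential_end (ord_pred j)).
  by rewrite arc_joint ord_predK -sE e1.
exfalso; apply: (@center_not_smooth k (arc_center (arc j)) s (arc_from (arc j)) (arc_to (arc j))).
- by rewrite -sE.
- by rewrite !lt_neqAle s1 s2 n2 eq_sym n1.
- by move=> u /andP[u1 u2]; apply: arc_in_body; rewrite !ltW.
Qed.

Let iter_ordS (k k' : 'I_m) : exists i, iter i (@ordS m) k = k'.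
Proof.
have val_iter i : nat_of_ord (iter i (@ordS m) k) = ((k + i) %% m)%N.
  elim: i => [|i IH]; first by rewrite addn0 modn_small.
  by rewrite iterS /= IH -addn1 modnDml addn1 addnS.
exists (k' + m - k)%N; apply: val_inj; rewrite /= val_iter.
have := ltn_ord k; have := ltn_ord k' => h1 h2.
by rewrite addnBA ?addKn ?modnDr ?modn_small //; lia.
Qed.

Let iter_ord_pred (k k' : 'I_m) : exists i, iter i (@ord_pred m) k = k'.
Proof.
have [i <-] := iter_ordS k' k; exists i.
elim: i => [//|i IH]; rewrite iterSr iterS.
have -> : ord_pred (ordS (iter i (@ordS m) k')) = iter i (@ordS m) k' by exact: ordSK.
exact: IH.
Qed.

Let arc_forward k : exists b, arc_to (arc k) <= b /\ ess (on_arc k b) /\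
  forall s, arc_from (arc k) <= s <= b -> boundary K (on_arc k s).
Proof.
have [k0 k0N _] := center_essential k.
have [N] := iter_ordS k k0; elim: N k => [|N IH] k /=.
  move=> kE; exists (arc_to (arc k)); split=> //; split; first by exists k => //; rewrite kE.
  by move=> s; exact: arc_boundary.
rewrite -iterS iterSr => /IH [b [b1 [b2 b3]]].
have [eqc|neqc] := pselect (arc_center (arc k) = arc_center (arc (ordS k))); last first.
  exists (arc_to (arc k)); split=> //; split; first by exists k.
  by move=> s; exact: arc_boundary.
have sh t := same_circle t eqc (arc_joint k).
have lt := arc_from_lt_to (arc (ordS k)).
exists (arc_to (arc k) + (b - arc_from (arc (ordS k)))); split; first by lra.
split; first by rewrite sh addrCA subrr addr0.
move=> s /andP[s1 s2]; have [le|/ltW le] := leP s (arc_to (arc k)).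
  by apply: arc_boundary; rewrite s1.
have -> : s = arc_to (arc k) + (s - arc_to (arc k)) by ring.
by rewrite sh; apply: b3; apply/andP; split; lra.
Qed.

Let arc_backward k : exists a, a <= arc_from (arc k) /\ ess (on_arc k a) /\
  forall s, a <= s <= arc_to (arc k) -> boundary K (on_arc k s).
Proof.
have [k0 k0N _] := center_essential k.
have [N] := iter_ord_pred k (ordS k0); elim: N k => [|N IH] k /=.
  move=> kE; exists (arc_from (arc k)); split=> //; split.
    by exists k0 => //; rewrite kE; exact: arc_joint.
  by move=> s; exact: arc_boundary.
rewrite -iterS iterSr => /IH [a [a1 [a2 a3]]].
have joint := arc_joint (ord_pred k); rewrite ord_predK in joint.
have [eqc|neqc] := pselect (arc_center (arc (ord_pred k)) = arc_center (arc k)); last first.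
  exists (arc_from (arc k)); split=> //; split; last by move=> s; exact: arc_boundary.
  by exists (ord_pred k) => //=; rewrite ord_predK.
have sh t := same_circle t eqc joint.
have lt := arc_from_lt_to (arc (ord_pred k)).
exists (arc_from (arc k) + (a - arc_to (arc (ord_pred k)))); split; first by lra.
split; first by rewrite -sh addrCA subrr addr0.
move=> s /andP[s1 s2]; have [/ltW le|le] := ltP s (arc_from (arc k)); last first.
  by apply: arc_boundary; rewrite le.
have -> : s = arc_from (arc k) + (s - arc_from (arc k)) by ring.
by rewrite -sh; apply: a3; apply/andP; split; lra.
Qed.

(** Consecutive arcs with a common center are glued until the center changes, which happens
    sooner or later in both directions, since the center of any arc is an essential endpoint. *)
Lemma maximal_arc k t : arc_from (arc k) <= t <= arc_to (arc k) ->
  exists a b, [/\ a <= t <= b, ess (on_arc k a), ess (on_arc k b)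
    & forall s, a <= s <= b -> boundary K (on_arc k s)].
Proof.
move=> /andP[t1 t2]; have [a [a1 [a2 a3]]] := arc_backward k.
have [b [b1 [b2 b3]]] := arc_forward k.
exists a, b; split=> //; first by rewrite (le_trans a1 t1) (le_trans t2 b1).
move=> s /andP[s1 s2]; have [le|/ltW le] := leP s (arc_to (arc k)).
  by apply: a3; rewrite s1.
by apply: b3; rewrite s2 andbT (le_trans _ le) // ltW // arc_from_lt_to.
Qed.

End ReuleauxArcs.

(** * Centers seen from the edges *)

Section EdgeCenters.
Variable R : realType.
Variable B : reuleaux_body R.

Let K := rb_set B.
Let r := rb_width B.
Let K_body : convex_body K := rb_convex_body B.
Let K_width : forall w, proj_length K w = r := rb_constant_width B.
Let r_gt0 : 0 < r := width_gt0 K_body K_width.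

(** The boundary goes beyond the line pq, because the midpoint of pq is an interior point. A
    boundary point beyond that line lies on an arc whose maximal extension ends at essential
    endpoints, on the near side of the line; so the extended arc meets the line on both sides
    of that point, and a line has no boundary points besides p and q. *)
Lemma chord_center v (L : R) p q : boundary K p -> boundary K q -> p <> q ->
  dot v p = L -> dot v q = L ->
  (forall z, essential_endpoints B z -> dot v z <= L) ->
  exists c, [/\ essential_endpoints B c, sqn (p - c) = r ^+ 2 & sqn (q - c) = r ^+ 2].
Proof.
move=> Bp Bq pq pL qL essL.
have Kp := boundary_sub_body K_body K_width Bp.
have Kq := boundary_sub_body K_body K_width Bq.
pose M := (2^-1)%:C * p + (1 - 2^-1)%:C * q.
have half : 0 < (2^-1 : R) < 1 by apply/andP; split; lra.
have ML : dot v M = L by rewrite /M dotD !dotZ pL qL; lra.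
have : interior (K : set R[i]^o) M.
  rewrite (body_disc_intersection K_body K_width).
  apply: (chord_interior (body_nonempty K_body) _ _ (ltW r_gt0) pq half erefl) => b Kb;
    exact: (body_diam K_body K_width).
move=> /interiorCP [e [e0 sub]].
have [z0 [Kz0 z0max]] := body_support K_body v.
have z0L : L < dot v z0.
  have := z0max (M + (e / 2)%:C * cis v).
  rewrite dotD dotZ dot_cis subrr cos0 mulr1 ML => h; apply: lt_le_trans (h _); first by lra.
  by apply: sub; rewrite addrAC subrr add0r sqnZ sqn_cis mulr1 ltr_sqr ?nnegrE; lra.
have : boundary K z0 by exact: (support_boundary Kz0 z0max).
rewrite /K rb_boundary => -[k _ [t + tE]]; rewrite /= in_itv /= => tk.
have [a [b [/andP[ta tb] essa essb ab]]] := maximal_arc tk.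
pose c := arc_center (rb_arc k).
pose phi (s : R) := dot v (on_arc k s).
have phiE s : phi s = dot v c + r * cos (s - v) by rewrite /phi dotD dotZ dot_cis.
have cphi : continuous phi.
  have dphi (s : R) : derivable phi s 1.
    have dc := is_derive_cos_shift v s.
    have -> : phi = (fun s => dot v c + r * cos (s - v)) by apply/funext.
    have di : is_derive s 1 (fun s => dot v c + r * cos (s - v)) (r * - sin (s - v)).
      by apply: is_derive_eq; rewrite /GRing.scale /=; ring.
    by case: di.
  by move=> s; exact/differentiable_continuous/derivable1_diffP.
have phit : L < phi t by rewrite /phi /on_arc tE.
have [s1 s1t e1] : exists2 s, s \in `[a, t] & phi s = L.
  apply: IVT => //; first exact: continuous_subspaceT.
  have := essL _ essa; rewrite -/(phi a) => h.
  by rewrite ge_min le_max h (ltW phit) orbT.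
have [s2 s2t e2] : exists2 s, s \in `[t, b] & phi s = L.
  apply: IVT => //; first exact: continuous_subspaceT.
  have := essL _ essb; rewrite -/(phi b) => h.
  by rewrite ge_min le_max h (ltW phit) orbT.
move: s1t s2t; rewrite !in_itv /= => /andP[as1 s1t] /andP[ts2 s2b].
have n1 : s1 != t by apply/eqP => E; move: phit; rewrite -E e1 ltxx.
have n2 : t != s2 by apply/eqP => E; move: phit; rewrite E e2 ltxx.
have lt1 : s1 < t by rewrite lt_neqAle n1.
have lt2 : t < s2 by rewrite lt_neqAle n2.
have B1 : boundary K (on_arc k s1) by apply: ab; apply/andP; split; lra.
have B2 : boundary K (on_arc k s2) by apply: ab; apply/andP; split; lra.
have dist s : sqn (on_arc k s - c) = r ^+ 2.
  by rewrite /on_arc /arc_point addrAC subrr add0r sqnZ sqn_cis mulr1.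
have q12 : on_arc k s1 <> on_arc k s2.
  move=> E; have ds : s2 - s1 < 2 * pi.
    rewrite ltNge; apply/negP => ge.
    (* Otherwise B contains two opposite points of a circle of radius r. *)
    have K1 : K (on_arc k s1) by exact: (boundary_sub_body K_body K_width).
    have K2 : K (on_arc k (s1 + pi)).
      apply: (boundary_sub_body K_body K_width); apply: ab.
      by have := pi_gt0 R => ?; apply/andP; split; lra.
    have := body_diam K_body K_width K1 K2.
    rewrite /on_arc /arc_point opprD addrACA subrr add0r cisD cispi mulrN1 mulrN opprK.
    rewrite -mulr2n -[X in sqn X]mulr_natl (_ : 2%:R = (2%:R)%:C); last by rewrite rmorph_nat.
    rewrite !sqnZ sqn_cis mulr1; have : 0 < r ^+ 2 by rewrite exprn_gt0.
    rewrite -/r; lra.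
  have r0 : r%:C != 0 by rewrite eq_complex /= eqxx andbT lt0r_neq0.
  move: E; rewrite /on_arc /arc_point => /addrI/(mulfI r0) E.
  have : 0 < sin ((s2 - s1) / 2) by apply: sin_gt0_pi; apply/andP; split; lra.
  have : cos (s2 - s1) = 1.
    by rewrite -dot_cis -E dot_cis subrr cos0.
  rewrite {1}(_ : s2 - s1 = ((s2 - s1) / 2) *+ 2); last by rewrite mulr2n; lra.
  by rewrite cos_mulr2n cos2sin2 mulr2n; nra.
have line s : boundary K (on_arc k s) -> phi s = L -> on_arc k s = p \/ on_arc k s = q.
  move=> Bs es; apply: (boundary_line K_body K_width Bp Bq Bs pq (v := v)).
    by rewrite pL -es.
  by rewrite qL -es.
exists c; split; first exact: center_essential.
  have [f|f] := line s1 B1 e1; first by rewrite -f dist.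
  have [f'|f'] := line s2 B2 e2; first by rewrite -f' dist.
  by exfalso; apply: q12; rewrite f f'.
have [f|f] := line s1 B1 e1; last by rewrite -f dist.
have [f'|f'] := line s2 B2 e2; last by rewrite -f' dist.
by exfalso; apply: q12; rewrite f f'.
Qed.

End EdgeCenters.

(** * Directions with equal maxima of the width *)

Section EqualMaxima.
Variable R : realType.
Variables (n : nat) (s : nat -> R) (eta : R).
Hypothesis n_gt1 : (1 < n)%N.
Hypothesis s_sorted : sorted_modpi n s.
Hypothesis eta_gt0 : 0 < eta.
Hypothesis eta_le : 2 * eta <= pi.

Let G := sinsum n s (fun=> 2).
Hypothesis G_le : forall w, G w * sin eta <= 1.
Hypothesis G_right : forall m, (m < n)%N -> 1 <= G (s m + eta) * sin eta.
Hypothesis G_left : forall m, (m < n)%N -> 1 <= G (s m - eta) * sin eta.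
Hypothesis G_mid : forall m, (m < n)%N -> cos eta <= G (s m) * sin eta.

Let n_gt0 : (0 < n)%N. Proof. exact: ltn_trans n_gt1. Qed.
Let sin_eta : 0 < sin eta.
Proof. by apply: sin_gt0_pi; rewrite eta_gt0 /=; move: (pi_gt0 R) eta_le; lra. Qed.
Let cos_eta : 0 <= cos eta.
Proof. by apply: cos_ge0_pihalf; move: eta_gt0 eta_le => ? ?; apply/andP; split; lra. Qed.

Let GE w : G w = \sum_(i < n) `|sin (w - s i)|.
Proof. by rewrite /G /sinsum -mulr_sumr mulrC mulKf. Qed.

(** The second difference which annihilates the sinusoids of period 2 * pi, applied to
    `|sin|: it vanishes unless x is within eta of a multiple of pi. *)
Let bend (x : R) := `|sin (x + eta)| + `|sin (x - eta)| - 2 * cos eta * `|sin x|.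

Let bend_ge0 x : 0 <= bend x.
Proof.
rewrite /bend subr_ge0; apply: le_trans (ler_normD _ _).
have -> : sin (x + eta) + sin (x - eta) = 2 * cos eta * sin x by rewrite sinD sinB; ring.
by rewrite normrM ger0_norm // mulr_ge0.
Qed.

Let bend_small x (q : int) : `|x + q%:~R * pi| < eta -> 0 < bend x.
Proof.
have -> : bend x = bend (x + q%:~R * pi).
  by rewrite /bend !(addrAC _ (q%:~R * pi)) !normr_sinDkpi.
move: (x + _) => y; rewrite ltr_norml => /andP[y1 y2]; move: eta_gt0 eta_le => e1 e2.
have s1 : 0 <= sin (y + eta) by apply: sin_ge0_pi; apply/andP; split; lra.
have s2 : sin (y - eta) <= 0.
  by rewrite -[y - eta]opprK sinN oppr_le0; apply: sin_ge0_pi; apply/andP; split; lra.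
rewrite /bend (ger0_norm s1) (ler0_norm s2) sinD sinB.
have [y0|y0] := leP 0 y.
  rewrite ger0_norm; last by apply: sin_ge0_pi; apply/andP; split; lra.
  have : 0 < sin (eta - y) by apply: sin_gt0_pi; apply/andP; split; lra.
  by rewrite sinB; lra.
rewrite ler0_norm; last first.
  by rewrite -[y]opprK sinN oppr_le0; apply: sin_ge0_pi; apply/andP; split; lra.
have : 0 < sin (eta + y) by apply: sin_gt0_pi; apply/andP; split; lra.
by rewrite sinD; lra.
Qed.

(** The bends at s m add up to at most 2 * sin eta, because G has its maximum at s m - eta and
    s m + eta and is not too small at s m. The direction s m contributes 2 * sin eta by
    itself, which leaves nothing for a direction within eta of it. *)
Let far i m (q : int) : (i < n)%N -> (m < n)%N -> i != m ->
  eta <= `|s m - s i + q%:~R * pi|.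
Proof.
move=> ltin ltmn im; rewrite leNgt; apply/negP => /bend_small.
have sumE : \sum_(j < n) bend (s m - s j) = G (s m + eta) + G (s m - eta) - 2 * cos eta * G (s m).
  rewrite !GE mulr_sumr -big_split -sumrB /=; apply: eq_bigr => j _.
  by rewrite /bend ![s m + _ - s j]addrAC.
have le : \sum_(j < n) bend (s m - s j) <= 2 * sin eta.
  rewrite sumE -(ler_pM2r sin_eta) mulrBl mulrDl.
  have h1 := G_le (s m + eta); have h2 := G_le (s m - eta); have h3 := G_mid ltmn.
  have : cos eta * cos eta <= cos eta * (G (s m) * sin eta) by rewrite ler_wpM2l.
  by have := cos2Dsin2 eta; rewrite !expr2; lra.
have mm : bend (s m - s m) = 2 * sin eta.
  rewrite /bend subrr sin0 normr0 mulr0 subr0 add0r sub0r sinN normrN gtr0_norm //; lra.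
move: le; rewrite (bigD1 (Ordinal ltmn)) //= mm (bigD1 (Ordinal ltin)) //=.
have : 0 <= \sum_(j < n | (j != Ordinal ltmn) && (j != Ordinal ltin)) bend (s m - s j).
  by apply: sumr_ge0 => j _; exact: bend_ge0.
by lra.
Qed.

Let gap_ge i : (i < n)%N -> eta <= gap n s i.
Proof.
move=> ltin; move: eta_gt0 => e1; have := gap_ge0 n_gt1 s_sorted ltin; rewrite /gap /breakpoint ltin.
case: ltnP => lt g0.
  have := @far i.+1 i 0 lt ltin; rewrite mul0r addr0 => /(_ _).
  by rewrite distrC ger0_norm //; apply; rewrite gtn_eqF.
have := @far i 0 1 ltin n_gt0; rewrite mul1r.
have -> : s 0%N - s i + pi = s 0%N + pi - s i by ring.
by rewrite ger0_norm //; apply; lia.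
Qed.

Let gapE i : (i < n)%N -> gap n s i = 2 * eta.
Proof.
move=> ltin; move: eta_gt0 eta_le => h1 h2; have g1 := gap_ge ltin; have g2 := gap_le_pi n_gt1 s_sorted ltin.
pose x := gap n s i / 2 - eta.
have m1 : midpoint n s i - x = breakpoint n s i + eta.
  by rewrite /midpoint /x /gap; lra.
have m2 : midpoint n s i + x = breakpoint n s i.+1 - eta.
  by rewrite /midpoint /x /gap; lra.
have wav w : breakpoint n s i <= w <= breakpoint n s i.+1 -> G w = wave n s (fun=> 2) i w.
  exact: (sinsum_wave _ n_gt1 s_sorted ltin).
have g1' := g1; rewrite /gap in g1'.
have E1 : 1 <= wave n s (fun=> 2) i (midpoint n s i - x) * sin eta.
  rewrite -wav m1; last by apply/andP; split; lra.
  by rewrite /breakpoint ltin; exact: G_right.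
have E2 : 1 <= wave n s (fun=> 2) i (midpoint n s i + x) * sin eta.
  rewrite -wav m2; last by apply/andP; split; lra.
  rewrite /breakpoint; case: ltnP => lt; first exact: G_left.
  by rewrite addrAC /G sinsumDpi; exact: G_left.
have ev0 : even_part n s (fun=> 2) i * sin eta <= 1.
  by rewrite /even_part -wav //; rewrite /midpoint; apply/andP; split; lra.
have ev1 : 0 <= even_part n s (fun=> 2) i * sin eta.
  apply: mulr_ge0; last exact: ltW.
  rewrite /even_part -wav; last by rewrite /midpoint; apply/andP; split; lra.
  by apply: sinsum_ge0.
move: E1 E2; rewrite !(waveE _ _ _ _ (midpoint n s i - x)) !(waveE _ _ _ _ (midpoint n s i + x)).
rewrite [midpoint n s i - x - _]addrAC [midpoint n s i + x - _]addrAC subrr !add0r cosN sinN.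
move: ev0 ev1; move: (even_part _ _ _ _) (odd_part _ _ _ _) => e o ev0 ev1 E1 E2.
have c1 : 1 <= (e * sin eta) * cos x by lra.
have cx : cos x <= 1 by exact: cos_le1.
have cx1 : 1 <= cos x.
  rewrite leNgt; apply/negP => lt.
  have [c0|c0] := leP 0 (cos x).
    have : (e * sin eta) * cos x <= 1 * cos x by rewrite ler_wpM2r.
    by lra.
  by have := mulr_ge0_le0 ev1 (ltW c0); lra.
have xpi : - pi < x /\ x < pi by rewrite /x; have := pi_gt0 R => ?; split; lra.
have sx : sin (x / 2) = 0.
  have : cos x = 1 by apply/eqP; rewrite eq_le cx.
  rewrite {1}(_ : x = (x / 2) *+ 2); last by rewrite mulr2n; lra.
  rewrite cos_mulr2n cos2sin2 mulr2n => h.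
  by apply/eqP; rewrite -sqrf_eq0; apply/eqP; lra.
have x0 : x = 0.
  have [lt|gt|//] := ltgtP x 0.
    have : 0 < sin (- (x / 2)) by apply: sin_gt0_pi; apply/andP; split; lra.
    by rewrite sinN sx oppr0 ltxx.
  have : 0 < sin (x / 2) by apply: sin_gt0_pi; apply/andP; split; lra.
  by rewrite sx ltxx.
by move: x0; rewrite /x; lra.
Qed.

(** The points s m + eta and s m.+1 - eta lie between the neighboring breakpoints s m and
    s m.+1, by [gap_ge], hence on one sinusoid. Both are maxima of it, so they coincide: all
    the gaps are 2 * eta, and they add up to pi. *)
Lemma equal_maxima_equispaced m : (m < n)%N -> s m = s 0%N + m%:R * (pi / n%:R).
Proof.
have n2 : 2 * eta = pi / n%:R.
  have n0 : n%:R != 0 :> R by rewrite pnatr_eq0 -lt0n.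
  have := sum_gap s n_gt1; rewrite (eq_bigr (fun=> 2 * eta)); last by move=> i _; exact: gapE.
  by rewrite sumr_const card_ord => <-; rewrite -[_ *+ n]mulr_natl [RHS]mulrC mulKf.
rewrite -n2; elim: m => [|m IH] ltmn; first by rewrite mul0r addr0.
have := gapE (ltnW ltmn); rewrite /gap /breakpoint ltmn (ltnW ltmn) (IH (ltnW ltmn)).
by rewrite -(natr1 m); lra.
Qed.

End EqualMaxima.

(** * Reinhardt polygons have equispaced directions *)

Section ReinhardtIsEquispaced.
Variable R : realType.
Variables (n : nat) (alpha : 'I_n -> R[i]) (A : nat -> R[i]) (th l : nat -> R).
Variable B : reuleaux_body R.
Hypothesis n_gt1 : (1 < n)%N.
Hypothesis ch : chain_of alpha A th l.
Hypothesis l_eq : forall i j : 'I_n, l i = l j.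
Hypothesis alpha_boundary : range alpha `<=` boundary B.
Hypothesis essential_alpha : essential_endpoints B `<=` range alpha.

Let n_gt0 : (0 < n)%N. Proof. exact: ltn_trans n_gt1. Qed.
Let K := rb_set B.
Let r := rb_width B.
Let K_body : convex_body K := rb_convex_body B.
Let K_width : forall w, proj_length K w = r := rb_constant_width B.
Let r_gt0 : 0 < r := width_gt0 K_body K_width.
Let l0 := l (Ordinal n_gt0).
Let l0_gt0 : 0 < l0. Proof. exact: chain_length_gt0 ch.1 _. Qed.

Let A_range i : range alpha (A i).
Proof. by rewrite -(chain_of_range n_gt1 ch); exists i. Qed.

Let A_boundary i : boundary K (A i). Proof. exact/alpha_boundary/A_range. Qed.
Let A_body i : K (A i). Proof. exact: (boundary_sub_body K_body K_width). Qed.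

Let W := dirsum (fun j : 'I_n => th j) (fun j => l j).

Let W_ge w i j : coproj w (A i) - coproj w (A j) <= W w.
Proof. exact: (chain_le n_gt0 ch.1). Qed.

Let W_le w : W w <= r.
Proof.
have [j [i e]] := chain_exists n_gt0 ch.1 w.
have {}e : coproj w (A i) - coproj w (A j) = W w := e.
rewrite -e -coprojB coprojE; apply: dot_le; first exact: ltW.
exact: (body_diam K_body K_width).
Qed.

(** Seen along the edge j, the edges after the vertex j climb until the angle has turned by
    pi and descend afterwards; so the climb realizes the full width, from the vertex j on. *)
Lemma chain_edge_support (j i : nat) : coproj (th j) (A j) <= coproj (th j) (A i).
Proof.
have pi0 := pi_gt0 R.
have ex : exists i, th j + pi <= th i.
  by exists (j + n)%N; rewrite (chain_angle_period ch.1); lra.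
pose e := ex_minn ex.
have [eP emin] : th j + pi <= th e /\ forall i, th j + pi <= th i -> (e <= i)%N.
  by rewrite /e; case: ex_minnP.
have je : (j <= e)%N.
  by rewrite leqNgt; apply/negP => /ltnW/(chain_mono ch.1); lra.
have ejn : (e <= j + n)%N by apply: emin; rewrite (chain_angle_period ch.1); lra.
have := chain_width ch.1 (w := th j) (j := j) (a := e); rewrite je ejn => /(_ isT) E.
have {}E : coproj (th j) (A e) - coproj (th j) (A j) = W (th j).
  apply: E => k.
    move=> /andP[jk ke]; have := chain_mono ch.1 jk => m.
    have lt : th k < th j + pi by rewrite ltNge; apply/negP => /emin; rewrite leqNgt ke.
    by apply/andP; split; lra.
  move=> /andP[ek kjn]; have m1 := chain_mono ch.1 ek; have m2 := chain_mono ch.1 (ltnW kjn).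
  by rewrite (chain_angle_period ch.1) in m2; apply/andP; split; lra.
by have := W_ge (th j) e i; lra.
Qed.

(** By [chain_edge_support] no vertex lies beyond the edge j, hence no essential endpoint. *)
Let edge_center (j : nat) : exists c i, [/\ c = A i, sqn (A j - c) = r ^+ 2
  & sqn (A j.+1 - c) = r ^+ 2].
Proof.
have step := chain_step ch.1 j; have lj := chain_length_gt0 ch.1 j.
have neq : A j <> A j.+1.
  move=> e; have : sqn ((l j)%:C * cis (th j)) = 0.
    by rewrite -[X in sqn X](addKr (A j)) -step -e addNr sqn0.
  by rewrite sqnZ sqn_cis mulr1 => /eqP; rewrite sqrf_eq0 gt_eqF.
pose v := th j - pi / 2.
have dE z : dot v z = - coproj (th j) z.
  by rewrite coprojE (_ : th j + pi / 2 = v + pi) ?dotDpi ?opprK // /v; lra.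
have [||z /essential_alpha|c [/essential_alpha cr c1 c2]] :=
    @chord_center R B v (dot v (A j)) (A j) (A j.+1) (A_boundary _) (A_boundary _) neq.
- by [].
- by rewrite step dotD dotZ dot_cis /v opprB addrCA subrr addr0 cos_pihalf mulr0 addr0.
- rewrite -(chain_of_range n_gt1 ch) => -[i _ <-].
  by rewrite !dE lerN2; exact: chain_edge_support.
move: cr; rewrite -(chain_of_range n_gt1 ch) => -[i _ iE].
by exists c, i.
Qed.

(** Two vertices are at distance at most r, so l0 <= r. *)
Let ratio_le : l0 / (2 * r) <= 2^-1.
Proof.
rewrite ler_pdivrMr ?mulr_gt0 // mulKf //.
have := dot_le (th 0%N) (ltW r_gt0) (body_diam K_body K_width (A_body 1) (A_body 0)).
by rewrite (chain_step ch.1) addrAC subrr add0r dotZ dot_cis subrr cos0 mulr1.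
Qed.

Let eta : R := asin (l0 / (2 * r)).
Let ratio_gt0 : 0 < l0 / (2 * r). Proof. by rewrite divr_gt0 // mulr_gt0. Qed.
Let ratio_itv : -1 <= l0 / (2 * r) <= 1.
Proof. by move: ratio_gt0 ratio_le => ? ?; apply/andP; split; lra. Qed.
Let sin_eta : sin eta = l0 / (2 * r).
Proof. by rewrite asinK. Qed.
Let l0E : l0 = 2 * r * sin eta.
Proof. by rewrite sin_eta mulrC divfK // lt0r_neq0 // mulr_gt0. Qed.
Let eta_le : 2 * eta <= pi.
Proof. by have := asin_lepi2 ratio_itv; rewrite -/eta; lra. Qed.
Let eta_gt0 : 0 < eta.
Proof.
rewrite ltNge; apply/negP => le.
have := asin_geNpi2 ratio_itv; rewrite -/eta => ge.
have : 0 <= sin (- eta) by apply: sin_ge0_pi; have := pi_gt0 R => ?; apply/andP; split; lra.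
by rewrite sinN sin_eta; move: ratio_gt0; lra.
Qed.
Let cos_eta : 0 <= cos eta.
Proof. by apply: cos_ge0_pihalf; move: eta_gt0 eta_le => ? ?; apply/andP; split; lra. Qed.

(** The edge j and the vertex found by [edge_center] span an isosceles triangle with legs r and
    apex angle 2 * eta; its legs and its altitude bound the width from below. *)
Let edge_widths (j : 'I_n) :
  [/\ r <= W (th j - eta), r <= W (th j + eta) & r * cos eta <= W (th j)].
Proof.
have [c [i [cE c1 c2]]] := edge_center j.
have lj : l j = 2 * r * sin eta by rewrite -l0E; exact: l_eq.
pose x := dot (th j) (A j - c); pose y := coproj (th j) (A j - c).
have y0 : y <= 0 by rewrite /y coprojB subr_le0 cE; exact: chain_edge_support.
have sx : x ^+ 2 + y ^+ 2 = r ^+ 2 by rewrite -c1 (sqn_dot (th j)) /x /y coprojE.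
have step : A j.+1 - c = (A j - c) + (l j)%:C * cis (th j).
  by rewrite (chain_step ch.1) addrAC.
have x1 : dot (th j) (A j.+1 - c) = x + l j.
  by rewrite step dotD dotZ dot_cis subrr cos0 mulr1.
have y1 : coproj (th j) (A j.+1 - c) = y.
  by rewrite step coprojD coprojZ coproj_cis subrr sin0 mulr0 addr0.
have sx1 : (x + l j) ^+ 2 + y ^+ 2 = r ^+ 2.
  by rewrite -c2 (sqn_dot (th j)) x1 -coprojE y1.
have l_gt0 : 0 < l j by exact: chain_length_gt0 ch.1 j.
have xE : x = - (r * sin eta).
  have : l j * (2 * x + l j) = 0 by move: sx sx1; rewrite !expr2; lra.
  by move/eqP; rewrite mulf_eq0 gt_eqF //= => /eqP; rewrite lj; lra.
have yE : y = - (r * cos eta).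
  apply/eqP; rewrite -[y]opprK eqr_opp -(@eqrXn2 _ 2) // ?oppr_ge0 ?mulr_ge0 ?(ltW r_gt0) //.
  apply/eqP; rewrite sqrrN; have := cos2Dsin2 eta.
  move: sx; rewrite xE !expr2 => h1 h2.
  have : r * r * (cos eta * cos eta + sin eta * sin eta) = r * r by rewrite h2 mulr1.
  by lra.
have cop w z : coproj w z = coproj (th j) z * cos (w - th j) - dot (th j) z * sin (w - th j).
  rewrite !coprojE /dot cosB sinB !cosDpihalf !sinDpihalf.
  have := cos2Dsin2 (th j); move: (cos (th j)) (sin (th j)) => C S e.
  case: z => a b /=.
  transitivity ((b * cos w - a * sin w) * (C ^+ 2 + S ^+ 2)); last by ring.
  by rewrite e; ring.
split.
- have := W_ge (th j - eta) i j; rewrite -cE -opprB -coprojB.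
  rewrite cop -/x -/y addrAC subrr add0r cosN sinN xE yE; have := cos2Dsin2 eta.
  rewrite !expr2 => h; have : r * (cos eta * cos eta + sin eta * sin eta) = r by rewrite h mulr1.
  by lra.
- have := W_ge (th j + eta) i j.+1; rewrite -cE -opprB -coprojB.
  rewrite cop x1 y1 addrAC subrr add0r xE yE lj; have := cos2Dsin2 eta.
  rewrite !expr2 => h; have : r * (cos eta * cos eta + sin eta * sin eta) = r by rewrite h mulr1.
  by lra.
- by have := W_ge (th j) i j; rewrite -cE -opprB -coprojB -/y yE; lra.
Qed.

(** In units of r, the width function satisfies the hypotheses of [equal_maxima_equispaced]. *)
Lemma reinhardt_equispaced : equispaced_equilateral n th l.
Proof.
split; last exact: l_eq.
have [s [lam [p [k [ss p_inj thE _]]]]] :=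
  sort_directions (fun j : 'I_n => th j) (fun j => l j) n_gt0.
pose G := sinsum n s (fun=> 2).
have sin_gt0 : 0 < sin eta by rewrite sin_eta.
have GW w : G w * sin eta * r = W w.
  have -> : W w = sinsum n s (fun=> l0) w.
    by rewrite -(dirsum_reindex p_inj thE (l := fun j => l j)) // => j; exact: l_eq.
  rewrite /G /sinsum -!mulr_sumr l0E; move: (\sum_(_ < n) _) => S; by field.
have Gle w : G w * sin eta <= 1 by rewrite -(ler_pM2r r_gt0) GW mul1r.
have Gshift (j : 'I_n) x : G (s (p j) + x) = G (th j + x).
  rewrite /G /sinsum thE; congr (_ / 2); apply: eq_bigr => m _; congr (_ * _).
  by rewrite -(normr_sinDkpi _ (k j)); congr (`|sin _|); ring.
have surj m : (m < n)%N -> exists j, p j = m :> nat.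
  by move=> lt; exists (invF p_inj (Ordinal lt)); rewrite f_invF.
have eq : forall m, (m < n)%N -> s m = s 0%N + m%:R * (pi / n%:R).
  apply: (equal_maxima_equispaced n_gt1 ss eta_gt0 eta_le Gle) => m /surj[j <-];
    have [w1 w2 w3] := edge_widths j.
  - by rewrite -/G Gshift -(ler_pM2r r_gt0) GW mul1r.
  - by rewrite -/G Gshift -(ler_pM2r r_gt0) GW mul1r.
  - rewrite -/G -[s (p j)]addr0 Gshift addr0 -(ler_pM2r r_gt0) GW; lra.
by exists (s 0%N), p, k; split=> // j; rewrite thE (eq _ (ltn_ord _)).
Qed.

End ReinhardtIsEquispaced.

(** * The characterization *)

Lemma reinhardt_chain (R : realType) n (T : set R[i]) : (1 < n)%N -> reinhardt n T ->
  exists (alpha : 'I_n -> R[i]) A th l,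
  [/\ polygon_on alpha T, chain_of alpha A th l & equispaced_equilateral n th l].
Proof.
move=> n_gt1 [alpha [pT _ len [B [alphaB essB]]]].
have [A [th [l ch]]] := polygon_chain n_gt1 pT.
exists alpha, A, th, l; split=> //.
apply: (reinhardt_equispaced n_gt1 ch _ alphaB essB) => i j.
have := len i j; rewrite !(chain_of_edge_norm _ ch).
by move/complexI.
Qed.

Lemma equispaced_equilateral_reinhardt (R : realType) n (alpha : 'I_n -> R[i]) A th l T :
  (1 < n)%N -> polygon_on alpha T -> chain_of alpha A th l ->
  equispaced_equilateral n th l -> reinhardt n T.
Proof.
move=> n_gt1 pT ch [[a [p [k [p_inj thE]]]] l_eq].
exact: (equispaced_reinhardt n_gt1 pT ch p_inj thE l_eq).
Qed.

Unset Implicit Arguments.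

Theorem theorem7 (R : realType) (n : nat) (hn : (1 < n)%N) :
  ((~ exists k : nat, n = (2 ^ k)%N) ->
    forall T : set R[i], Theta n T ->
      (minimizes_delta n T <-> reinhardt n T)) /\
  ((exists T : set R[i], reinhardt n T) <-> ~ exists k : nat, n = (2 ^ k)%N).
Proof.
have n_gt0 : (0 < n)%N by exact: ltnW.
split=> [not_pow2 T [alpha pT]|].
  have [alpha0 [T0 [A0 [th0 [l0 [pT0 ch0 eq0]]]]]] := exists_equispaced R n_gt0 not_pow2.
  split=> [minT|/(reinhardt_chain hn)[beta [A [th [l [pT' ch eq]]]]]].
    have [A [th [l ch]]] := polygon_chain hn pT.
    apply: (equispaced_equilateral_reinhardt hn pT ch).
    exact: (minimizes_equispaced hn pT0 ch0 eq0 pT ch).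
  exact: (equispaced_minimizes hn pT' ch eq).
split=> [[T /(reinhardt_chain hn)[alpha [A [th [l [_ ch eq]]]]]]|not_pow2].
  exact: (equispaced_not_pow2 hn ch eq).
have [alpha [T [A [th [l [pT ch eq]]]]]] := exists_equispaced R n_gt0 not_pow2.
by exists T; exact: (equispaced_equilateral_reinhardt hn pT ch).
Qed.
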